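(* Let $M,N$ be two real symmetric positive-definite $n\times n$ matrices, let $S=\begin{pmatrix}A&B\\C&D\end{pmatrix}\in\operatorname{Sp}(2n,\mathbb{R})$ be a free symplectic matrix ($\det B\neq0$), and let $f\in L^2(\mathbb{R}^n)\setminus\{0\}$. Assume that $$|f(x)|\lesssim e^{-Mx^2},\qquad |\widehat f_S(\xi)|\lesssim e^{-N\xi^2}.$$ Let $\lambda_1,\dots,\lambda_n$ denote the eigenvalues of $MB^TNB$. (a) The eigenvalues satisfy $\lambda_j\le\pi^2$ for $j=1,\dots,n$. (b) If $\lambda_1=\cdots=\lambda_n=\pi^2$, then there exists $K\in\mathbb{C}$ such that $$f(x)=K\,e^{-x\cdot(M+i\pi B^{-1}A)x}.$$
   Context: $J=\begin{pmatrix}0&I_n\\-I_n&0\end{pmatrix}$, and $\operatorname{Sp}(2n,\mathbb{R})$ is the group of real $2n\times2n$ matrices $S$ with $S^TJS=J$; blocks are $n\times n$. $Mx^2$ means $x\cdot Mx$. $F(x)\lesssim G(x)$ means there is a constant $C>0$ with $F(x)\le C\,G(x)$ for all $x$. The linear canonical transform associated with a free $S$ is $$\widehat f_S(\xi)=(\mathcal{L}_Sf)(\xi)=\frac{1}{i^{n/2}\sqrt{\det B}}\int_{\mathbb{R}^n}f(x)\,e^{i\pi(\xi\cdot DB^{-1}\xi+x\cdot B^{-1}Ax)-2\pi i\,x\cdot B^{-1}\xi}\,dx,$$ extended to a unitary operator on $L^2(\mathbb{R}^n)$ (the choice of square roots affects only a unimodular factor). Pointwise statements about $L^2$ functions are understood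 almost everywhere. The eigenvalues of $MB^TNB$ are real and positive, since $M$ and $B^TNB$ are positive definite. *)

(* Defs.v *)
From HB Require Import structures.
From mathcomp Require Import all_boot all_order all_algebra.
From mathcomp Require Import all_classical all_reals all_analysis.
From mathcomp Require Import complex.
Set Implicit Arguments.
Unset Strict Implicit.
Unset Printing Implicit Defensive.
Import Order.TTheory GRing.Theory Num.Theory.
Import numFieldNormedType.Exports.
Import ComplexField.Normc.
Local Open Scope classical_set_scope.
Local Open Scope ring_scope.
Local Open Scope complex_scope.

(* Points of R^n are n-tuples, with the library's product (Borel)
   sigma-algebra on tuples; matrices act on the associated column vectors. *)
Notation Rn R n := (n.-tuple (measurableTypeR R)).

Definition vec (R : realType) (n : nat) (x : Rn R n) : 'cV[R]_n :=
  \col_i tnth x i.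

Definition dot (K : comNzRingType) (n : nat) (u v : 'cV[K]_n) : K :=
  (u^T *m v) ord0 ord0.

Section Lebesgue.
Context {R : realType}.

Definition tcons n (p : measurableTypeR R * Rn R n) : Rn R n.+1 :=
  [tuple of p.1 :: p.2].

Lemma measurable_tcons n : measurable_fun setT (@tcons n).
Proof. exact: (measurable_cons measurable_fst measurable_snd). Qed.

Section cons.
Variables (n : nat) (mu : {sigma_finite_measure set (Rn R n) -> \bar R}).

Definition leb_cons : set (Rn R n.+1) -> \bar R :=
  pushforward (@lebesgue_measure R \x mu)%E (@tcons n).

Let leb_cons0 : leb_cons set0 = 0%E.
Proof. by rewrite /leb_cons /pushforward preimage_set0 measure0. Qed.

Let mtcons A : measurable A -> measurable (@tcons n @^-1` A).
Proof.
by move=> mA; rewrite -[X in measurable X]setTI; exact: measurable_tcons.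
Qed.

Let leb_cons_ge0 A : (0 <= leb_cons A)%E.
Proof. by rewrite /leb_cons /pushforward; exact: measure_ge0. Qed.

Let leb_cons_sigma_additive : semi_sigma_additive leb_cons.
Proof.
move=> F mF tF mUF; rewrite /leb_cons /pushforward preimage_bigcup.
apply: measure_semi_sigma_additive.
- by move=> k; exact: mtcons.
- apply/trivIsetP => /= i j _ _ ij; rewrite -preimage_setI.
  by move/trivIsetP : tF => /(_ _ _ _ _ ij) ->//; rewrite preimage_set0.
- by rewrite -preimage_bigcup; exact: mtcons.
Qed.

HB.instance Definition _ := isMeasure.Build _ _ _ leb_cons
  leb_cons0 leb_cons_ge0 leb_cons_sigma_additive.

Definition tuncons (t : Rn R n.+1) : measurableTypeR R * Rn R n :=
  (thead t, [tuple of behead t]).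

Lemma tconsK : cancel (@tcons n) tuncons.
Proof.
by move=> [x t]; rewrite /tuncons theadE; congr (_, _); exact/val_inj.
Qed.

Lemma measurable_tuncons : measurable_fun setT tuncons.
Proof.
apply: measurable_fun_pair; first exact: measurable_tnth.
exact: measurable_behead.
Qed.

Let leb_cons_sigma_finite : sigma_finite setT leb_cons.
Proof.
have /sigma_finiteP[F [TF ndF Foo]] := sigma_finiteT (@lebesgue_measure R).
have /sigma_finiteP[G [TG ndG Goo]] := sigma_finiteT mu.
exists (fun k => tuncons @^-1` (F k `*` G k)).
  apply/esym/seteqP; split => // t _.
  have [k _ Fk] : (\bigcup_k F k) (tuncons t).1 by rewrite -TF.
  have [l _ Gl] : (\bigcup_k G k) (tuncons t).2 by rewrite -TG.
  exists (maxn k l) => //; split.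
  - by move: Fk; exact/subsetPset/ndF/leq_maxl.
  - by move: Gl; exact/subsetPset/ndG/leq_maxr.
move=> k; have [mF Fk] := Foo k; have [mG Gk] := Goo k; split.
  rewrite -[X in measurable X]setTI; apply: measurable_tuncons => //.
  exact: measurableX.
rewrite /leb_cons /pushforward -comp_preimage.
rewrite (_ : tuncons \o @tcons n = id); last by apply/funext => p; exact: tconsK.
by rewrite preimage_id product_measure1E// lte_mul_pinfty// ge0_fin_numE.
Qed.

HB.instance Definition _ := Measure_isSigmaFinite.Build _ _ _ leb_cons
  leb_cons_sigma_finite.

End cons.

(* n-dimensional Lebesgue measure, as an n-fold product measure. *)
Fixpoint leb (n : nat) : {sigma_finite_measure set (Rn R n) -> \bar R} :=
  match n return {sigma_finite_measure set (Rn R n) -> \bar R} with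
  | 0 => dirac ([tuple] : Rn R 0)
  | m.+1 => leb_cons (leb m)
  end.

End Lebesgue.

Section Complex.
Context {R : realType}.

Definition cexp (z : R[i]) : R[i] :=
  (expR (complex.Re z))%:C * (cos (complex.Im z) +i* sin (complex.Im z)).

Definition cmeasurable n (f : Rn R n -> R[i]) : Prop :=
  measurable_fun setT (fun x => complex.Re (f x) : measurableTypeR R) /\
  measurable_fun setT (fun x => complex.Im (f x) : measurableTypeR R).

Definition cintegral n (f : Rn R n -> R[i]) : R[i] :=
  (\int[leb n]_x complex.Re (f x)) +i* (\int[leb n]_x complex.Im (f x)).

Definition Lpnorm (p : \bar R) n (f : Rn R n -> R[i]) : \bar R :=
  Lnorm (leb n) p (fun x => (normc (f x))%:E).

Definition inLp (p : \bar R) n (f : Rn R n -> R[i]) : Prop :=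
  cmeasurable f /\ (Lpnorm p f < +oo)%E.

Definition eq_ae n (f g : Rn R n -> R[i]) : Prop :=
  {ae leb n, forall x, f x = g x}.

Definition gauss_bounded n (M : 'M[R]_n) (f : Rn R n -> R[i]) : Prop :=
  exists2 K : R, 0 < K &
    {ae leb n, forall x,
      normc (f x) <= K * expR (- dot (vec x) (M *m vec x))}.

End Complex.

Definition cmx (R : realType) (m n : nat) (X : 'M[R]_(m, n)) : 'M[R[i]]_(m, n) :=
  map_mx (real_complex R) X.

Section Matrices.
Context {R : realType} {n : nat}.

Definition posdef (M : 'M[R]_n) : Prop :=
  M^T = M /\ forall x : 'cV[R]_n, x != 0 -> 0 < dot x (M *m x).

Definition Jmx : 'M[R]_(n + n) := block_mx 0 1%:M (- 1%:M) 0.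

Definition symplectic (S : 'M[R]_(n + n)) : Prop := S^T *m Jmx *m S = Jmx.

End Matrices.

Section LCT.
Context {R : realType} {n : nat}.
Implicit Types (A B D : 'M[R]_n) (f g : Rn R n -> R[i]).

Definition lct_phase A B D (xi x : Rn R n) : R[i] :=
  'i%C * (pi * (dot (vec xi) (D *m invmx B *m vec xi)
              + dot (vec x) (invmx B *m A *m vec x)))%:C
  - 'i%C * (2 * pi * dot (vec x) (invmx B *m vec xi))%:C.

(* [kappa] stands for i^{n/2} (det B)^{1/2}, a square root of i^n det B. *)
Definition lct_int (kappa : R[i]) A B D f (xi : Rn R n) : R[i] :=
  kappa^-1 * cintegral (fun x => f x * cexp (lct_phase A B D xi x)).

(* [is_lct kappa A B D f g]: [g] represents the class in L^2 of the transform
   of [f].  The operator is the integral on the dense subspace of L^1 and L^2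
   functions, extended by continuity to L^2; in general [lct_int f] makes no
   sense for f in L^2, hence a relation, through limits in L^2-norm. *)
Definition is_lct (kappa : R[i]) A B D f g : Prop :=
  [/\ inLp 2%:E f, inLp 2%:E g,
      inLp 1%:E f -> eq_ae g (lct_int kappa A B D f) &
      exists u : nat -> Rn R n -> R[i],
        [/\ forall k, inLp 1%:E (u k) /\ inLp 2%:E (u k),
            Lpnorm 2%:E (fun x => u k x - f x) @[k --> \oo] --> 0%E &
            Lpnorm 2%:E (fun xi => lct_int kappa A B D (u k) xi - g xi)
              @[k --> \oo] --> 0%E]].

End LCT.

(* Main.v *)
Require Import Defs.
From mathcomp Require Import all_boot all_order all_algebra.
From mathcomp Require Import all_classical all_reals all_analysis.
From mathcomp Require Import measurable_realfun complex ring lra.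
Set Implicit Arguments.
Unset Strict Implicit.
Unset Printing Implicit Defensive.
Import Order.TTheory GRing.Theory Num.Theory.
Import numFieldNormedType.Exports.
Import ComplexField.Normc.
Local Open Scope classical_set_scope.
Local Open Scope ring_scope.
Local Open Scope complex_scope.

(** The phase factors of the transform are chirps.  With
    [h x = f x * exp (i pi x.B^-1 A x)] and [ft h] its Fourier transform,
    [|fS (B v)|] is a constant multiple of [|ft h v|], so the two hypotheses
    become [|h x| <= C exp (- x.M x)] and [|ft h v| <= C exp (- v.P v)] with
    [P = B^T N B].  The numbers [lambda_j] are the eigenvalues of [M P], and the
    statement is Hardy's uncertainty principle for the pair [M], [P].

    It is proved line by line.  On the line [xi + s v], with [v = M a] and
    [pi a.M a = 1], the function [ft h] is the transform [E] of a measure [nu]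
    on the real line, the image of [h x exp (- 2 pi i x.xi) dx] under
    [y = x.v].  The image of [exp (- x.M x) dx] under [y] is a multiple of
    [exp (- pi y^2) dy], so [nu] has at most that growth ([gauss_type_gaussM]),
    and the bound on [ft h] controls the decay of [E].  Two facts in one variable
    suffice: if [E] decays faster than [exp (- pi s^2)] then [E 0 = 0]
    ([hardy_supercritical]); if it decays at that rate and [E 0 = 0] then [E]
    vanishes identically ([hardy_critical]).

    Both follow from the Gaussian averages
    [L1 t = int y^k exp (- pi t y^2) dnu] and
    [L2 w = int s^k E s exp (- pi w s^2) ds] for [k = 0, 1], which are
    holomorphic for real part greater than -1.  By Fubini [L2 w] is
    [c w^(- k - 1/2) L1 (1 / w)] ([fline_duality]).  In the variable
    [u = 1 / (1 + t)] this says that a function holomorphic for [Re u > 0] and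
    one holomorphic for [Re u < 1] coincide on the common strip; the growth
    assumptions bound the resulting entire function by [O (|u|^(1/2))], so it
    is constant ([psi_constant]).  The constant is [E 0] for
    [k = 0].  Under faster decay it is also the limit 0 at minus infinity.  In
    the critical case the constants for [k = 0] and [k = 1] are 0, hence all
    moments of [nu] vanish, and so does [E].

    For (a), an eigenvalue greater than [pi^2] gives a direction [v] such that
    [E] decays too fast on every line parallel to [v], so [ft h = 0], hence
    [h = 0] almost everywhere ([ft_injective]).  For (b), [P M = pi^2] because
    [P M] is symmetric for the inner product of [M]; every direction is then
    critical.  Subtracting from [h] the multiple of [exp (- x.M x)] that makes
    the transform vanish at 0 makes it vanish on all lines through 0, so that
    [h] is this multiple.

    Complex analysis is done with the quantitative notion [hol] below.  Cauchy's
    formula is replaced by averages over the [N]-th roots of unity with an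
    error of order [1 / N], which is enough for the identity theorem and for
    Liouville's theorem. *)

(** * Modulus and exponential of complex numbers *)

Section ComplexNorm.
Context {R : realType}.
Implicit Types (z w : R[i]) (a b : R).

Lemma normcE2 z : normc z ^+ 2 = complex.Re z ^+ 2 + complex.Im z ^+ 2.
Proof. by case: z => a b /=; rewrite sqr_sqrtr// addr_ge0 ?sqr_ge0. Qed.

Lemma normc_ge0 z : 0 <= normc z.
Proof. by case: z => a b; exact: sqrtr_ge0. Qed.

Lemma normc_eq0 z : (normc z == 0) = (z == 0).
Proof.
by apply/eqP/eqP => [|->]; [exact: eq0_normc|rewrite normc0].
Qed.

Lemma normc_gt0 z : (0 < normc z) = (z != 0).
Proof. by rewrite lt_def normc_eq0 normc_ge0 andbT. Qed.

Lemma normc_real a : normc a%:C = `|a|.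
Proof. by rewrite /normc /= expr0n addr0 sqrtr_sqr. Qed.

Lemma normcX z n : normc (z ^+ n) = normc z ^+ n.
Proof.
by elim: n => [|n IH]; rewrite ?normc1// !exprS normcM IH.
Qed.

Lemma le_normcB z w : normc (z - w) <= normc z + normc w.
Proof. by rewrite -(normcN w); exact: le_normcD. Qed.

Lemma normc_distC z w : normc (z - w) = normc (w - z).
Proof. by rewrite -normcN opprB. Qed.

Lemma ler_normc_Re z : `|complex.Re z| <= normc z.
Proof.
by rewrite -(ler_pXn2r (n := 2)) ?nnegrE ?normc_ge0// normcE2 real_normK ?num_real// lerDl sqr_ge0.
Qed.

Lemma ler_normc_Im z : `|complex.Im z| <= normc z.
Proof.
by rewrite -(ler_pXn2r (n := 2)) ?nnegrE ?normc_ge0// normcE2 real_normK ?num_real// lerDr sqr_ge0.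
Qed.

Lemma normc_le_ReIm z : normc z <= `|complex.Re z| + `|complex.Im z|.
Proof.
rewrite -(ler_pXn2r (n := 2)) ?nnegrE ?normc_ge0 ?addr_ge0// normcE2 sqrrD.
by rewrite !real_normK ?num_real// lerD2r lerDl mulrn_wge0// mulr_ge0.
Qed.

Lemma le_normc_sum (I : Type) (r : seq I) (P : pred I) (F : I -> R[i]) :
  normc (\sum_(i <- r | P i) F i) <= \sum_(i <- r | P i) normc (F i).
Proof.
elim/big_ind2 : _ => //; first by rewrite normc0.
by move=> x1 x2 y1 y2 h1 h2; apply: le_trans (le_normcD _ _) _; exact: lerD.
Qed.

Lemma Re_add z w : complex.Re (z + w) = complex.Re z + complex.Re w.
Proof. by case: z w => [? ?] [? ?]. Qed.
Lemma Im_add z w : complex.Im (z + w) = complex.Im z + complex.Im w.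
Proof. by case: z w => [? ?] [? ?]. Qed.
Lemma Re_opp z : complex.Re (- z) = - complex.Re z.
Proof. by case: z. Qed.
Lemma Im_opp z : complex.Im (- z) = - complex.Im z.
Proof. by case: z. Qed.
Lemma Re_sub z w : complex.Re (z - w) = complex.Re z - complex.Re w.
Proof. by rewrite Re_add Re_opp. Qed.
Lemma Im_sub z w : complex.Im (z - w) = complex.Im z - complex.Im w.
Proof. by rewrite Im_add Im_opp. Qed.
Lemma Re_mul z w : complex.Re (z * w) =
  complex.Re z * complex.Re w - complex.Im z * complex.Im w.
Proof. by case: z w => [? ?] [? ?]. Qed.
Lemma Im_mul z w : complex.Im (z * w) =
  complex.Re z * complex.Im w + complex.Im z * complex.Re w.
Proof. by case: z w => [? ?] [? ?]. Qed.
Lemma Re_inv z : complex.Re z^-1 = complex.Re z / normc z ^+ 2.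
Proof. by rewrite normcE2; case: z. Qed.
Lemma Im_inv z : complex.Im z^-1 = - complex.Im z / normc z ^+ 2.
Proof. by rewrite normcE2; case: z => a b /=; rewrite mulNr. Qed.

Lemma Re_sum (I : Type) (r : seq I) (P : pred I) (F : I -> R[i]) :
  complex.Re (\sum_(i <- r | P i) F i) = \sum_(i <- r | P i) complex.Re (F i).
Proof. by apply: (big_morph _ Re_add). Qed.

Lemma Im_sum (I : Type) (r : seq I) (P : pred I) (F : I -> R[i]) :
  complex.Im (\sum_(i <- r | P i) F i) = \sum_(i <- r | P i) complex.Im (F i).
Proof. by apply: (big_morph _ Im_add). Qed.

Lemma complex_ext z w : complex.Re z = complex.Re w -> complex.Im z = complex.Im w -> z = w.
Proof. by case: z w => [? ?] [? ?] /= -> ->. Qed.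

End ComplexNorm.

Section Exponential.
Context {R : realType}.
Implicit Types (z w : R[i]) (a b : R).

Lemma Re_cexp z : complex.Re (cexp z) = expR (complex.Re z) * cos (complex.Im z).
Proof. by rewrite /cexp Re_mul /= mul0r subr0. Qed.

Lemma Im_cexp z : complex.Im (cexp z) = expR (complex.Re z) * sin (complex.Im z).
Proof. by rewrite /cexp Im_mul /= mul0r addr0. Qed.

Lemma cexpD z w : cexp (z + w) = cexp z * cexp w.
Proof.
apply: complex_ext; rewrite !(Re_mul, Im_mul, Re_cexp, Im_cexp) Re_add Im_add expRD ?cosD ?sinD; ring.
Qed.

Lemma cexp0 : cexp (0 : R[i]) = 1.
Proof. by apply: complex_ext; rewrite ?Re_cexp ?Im_cexp /= expR0 ?cos0 ?sin0 ?mul1r ?mulr0. Qed.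

Lemma normc_cexp z : normc (cexp z) = expR (complex.Re z).
Proof.
apply/eqP; rewrite -(eqrXn2 (n := 2)) ?normc_ge0 ?expR_ge0//.
by rewrite normcE2 Re_cexp Im_cexp !exprMn -mulrDr cos2Dsin2 mulr1.
Qed.

Lemma cexp_neq0 z : cexp z != 0.
Proof. by rewrite -normc_eq0 normc_cexp gt_eqF ?expR_gt0. Qed.

Lemma cexpN z : cexp (- z) = (cexp z)^-1.
Proof.
by apply: (mulfI (cexp_neq0 z)); rewrite -cexpD subrr cexp0 divff ?cexp_neq0.
Qed.

Lemma cexp_real a : cexp a%:C = (expR a)%:C.
Proof. by apply: complex_ext; rewrite ?Re_cexp ?Im_cexp /= ?cos0 ?sin0 ?mulr1 ?mulr0. Qed.

Lemma cexpM_natl z n : cexp (n%:R * z) = cexp z ^+ n.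
Proof.
elim: n => [|n IH]; first by rewrite mul0r cexp0.
by rewrite -natr1 mulrDl mul1r cexpD IH exprSr.
Qed.

Lemma ler_abs_sin b : `|sin b| <= `|b|.
Proof.
wlog b0 : b / 0 <= b.
  move=> h; have [|/ltW b0] := leP 0 b; first exact: h.
  by rewrite -normrN -sinN -[leRHS]normrN h// oppr_ge0.
have [c _] := @MVT_segment R sin cos 0 b b0 (fun x _ => is_derive_sin x)
  (continuous_subspaceT (@continuous_sin R)).
rewrite sin0 !subr0 => ->; rewrite normrM ler_piMl//; exact: cos_max.
Qed.

Lemma one_minus_cos b : 1 - cos b = 2 * sin (b / 2) ^+ 2.
Proof.
have {1}-> : b = (b / 2) *+ 2 by rewrite mulr2n; field.
by rewrite cos_mulr2n cos2sin2 mulr2n; ring.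
Qed.

Lemma ler_one_minus_cos b : 0 <= 1 - cos b <= b ^+ 2 / 2.
Proof.
rewrite subr_ge0 cos_le1 one_minus_cos /=.
have := ler_abs_sin (b / 2).
rewrite -(ler_pXn2r (n := 2)) ?nnegrE// !real_normK ?num_real// expr_div_n.
set s := sin _ ^+ 2; rewrite (_ : 2%:R ^+ 2 = 4 :> R); last by ring.
by move=> h; lra.
Qed.

Lemma ler_sinB b : `|sin b - b| <= b ^+ 2.
Proof.
wlog b0 : b / 0 <= b.
  move=> h; have [|/ltW b0] := leP 0 b; first exact: h.
  by rewrite -normrN -[b ^+ 2]sqrrN (_ : - (sin b - b) = sin (- b) - - b) ?h ?oppr_ge0// sinN; ring.
have [c cI] := @MVT_segment R sin cos 0 b b0 (fun x _ => is_derive_sin x)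
  (continuous_subspaceT (@continuous_sin R)).
rewrite sin0 !subr0 => ->.
rewrite -{2}[b]mul1r -mulrBl normrM (ger0_norm b0) expr2 ler_wpM2r// distrC.
move: cI; rewrite in_itv/= => /andP[c0 cb].
have /andP[h0 h1] := ler_one_minus_cos c.
rewrite ger0_norm// one_minus_cos; apply: le_trans cb.
have := ler_abs_sin (c / 2); rewrite [X in _ <= X]ger0_norm ?divr_ge0// => hs.
have := sin_max (c / 2) => hm.
have : sin (c / 2) ^+ 2 <= c / 2 * 1.
  by rewrite -[_ ^+ 2]real_normK ?num_real// expr2 ler_pM.
by rewrite mulr1; lra.
Qed.

Lemma expR_sub1_le a : expR a - 1 <= a * expR a.
Proof.
by have := expR_ge1Dx (- a); rewrite -(ler_pM2r (expR_gt0 a)) -expRD addNr expR0; lra.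
Qed.

Lemma ler_expRB1 a : `|expR a - 1| <= `|a| * expR `|a|.
Proof.
have [a0|a0] := leP 0 a.
  by rewrite (ger0_norm a0) ger0_norm ?expR_sub1_le// subr_ge0 -expR0 ler_expR.
have := expR_ge1Dx a => h2.
rewrite (ltr0_norm a0) ltr0_norm ?subr_lt0 ?expR_lt1// opprB.
apply: (@le_trans _ _ (- a)); first lra.
by rewrite ler_peMr ?oppr_ge0 ?(ltW a0)// -expR0 ler_expR oppr_ge0 ltW.
Qed.

Lemma ler_expRB1D a : `|expR a - 1 - a| <= a ^+ 2 * expR `|a|.
Proof.
have h0 := expR_ge1Dx a.
rewrite ger0_norm; last lra.
have h := expR_sub1_le a.
apply: (@le_trans _ _ (a * (expR a - 1))); first by rewrite mulrBr mulr1; lra.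
apply: le_trans (ler_norm _) _; rewrite normrM -[a ^+ 2]real_normK ?num_real//.
by rewrite expr2 -mulrA ler_wpM2l// ler_expRB1.
Qed.

(** Real and imaginary parts of the remainder are combinations of real
    second-order remainders; the constant 4 is a convenient upper bound. *)
Lemma normc_cexp_taylor2 w :
  normc (cexp w - 1 - w) <= 4 * normc w ^+ 2 * expR `|complex.Re w|.
Proof.
apply: le_trans (normc_le_ReIm _) _.
rewrite !Re_sub !Im_sub Re_cexp Im_cexp normcE2 /=; case: w => a b /=.
set e := expR `|a|; have e1 : 1 <= e by rewrite -expR0 ler_expR.
have ea : expR a <= e by rewrite ler_expR ler_norm.
have ea0 := expR_gt0 a.
have /andP[c0 c1] := ler_one_minus_cos b.
have hre : `|expR a * cos b - 1 - a| <= a ^+ 2 * e + e * b ^+ 2.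
  rewrite (_ : _ - a = (expR a - 1 - a) - expR a * (1 - cos b)); last by ring.
  apply: le_trans (ler_normB _ _) _; apply: lerD; first exact: ler_expRB1D.
  rewrite normrM (ger0_norm (ltW ea0)) (ger0_norm c0); apply: ler_pM => //.
  by have := sqr_ge0 b; lra.
have him : `|expR a * sin b - 0 - b| <= e * b ^+ 2 + `|b| * (`|a| * e).
  rewrite (_ : _ - b = expR a * (sin b - b) + b * (expR a - 1)); last by ring.
  apply: le_trans (ler_normD _ _) _; rewrite !normrM; apply: lerD.
    by rewrite (ger0_norm (ltW ea0)) ler_pM ?(ltW ea0) ?ler_sinB.
  by rewrite ler_wpM2l// ler_expRB1.
apply: le_trans (lerD hre him) _.
have : `|b| * `|a| <= a ^+ 2 + b ^+ 2.
  rewrite -[a ^+ 2]real_normK ?num_real// -[b ^+ 2]real_normK ?num_real//.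
  by have := sqr_ge0 (`|a| - `|b|); have := sqr_ge0 (`|a| + `|b|); rewrite sqrrB sqrrD; lra.
have := sqr_ge0 a; have := sqr_ge0 b.
set A := a ^+ 2; set B := b ^+ 2; set X := `|b| * `|a|; move=> B0 A0 hX.
rewrite [`|b| * (_ * _)]mulrA -/X.
have : 0 <= e * (A + B - X) by rewrite mulr_ge0 ?subr_ge0//; lra.
have : 0 <= e * A by rewrite mulr_ge0//; lra.
have : 0 <= e * B by rewrite mulr_ge0//; lra.
by nra.
Qed.

Lemma normc_cexpiB1 b : normc (cexp (0 +i* b) - 1) <= `|b|.
Proof.
rewrite -(ler_pXn2r (n := 2)) ?nnegrE ?normc_ge0// normcE2 real_normK ?num_real//.
rewrite Re_sub Im_sub Re_cexp Im_cexp /= expR0 !mul1r subr0.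
have /andP[_ c1] := ler_one_minus_cos b; have := cos2Dsin2 b; nra.
Qed.

End Exponential.

(** * Uniform complex differentiability *)

Section Holomorphy.
Context {R : realType}.
Implicit Types (D : R[i] -> Prop) (f g : R[i] -> R[i]).

(** Complex differentiability with a uniform quadratic remainder, together
    with bounds on the function and its derivative.  The domain can be any
    set, no limits are involved, and the class is closed under products,
    composition and gluing. *)
Definition hol D f f' := exists2 C : R, 0 < C & exists2 d : R, 0 < d &
  (forall p, D p -> normc (f p) <= C /\ normc (f' p) <= C) /\
  (forall p q, D p -> D q -> normc (q - p) <= d ->
     normc (f q - f p - f' p * (q - p)) <= C * normc (q - p) ^+ 2).

Lemma hol_sub D D' f f' : (forall p, D' p -> D p) -> hol D f f' -> hol D' f f'.
Proof.
move=> sub [C C0 [d d0 [h1 h2]]]; exists C => //; exists d => //; split.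
  by move=> p /sub; exact: h1.
by move=> p q /sub ? /sub ?; exact: h2.
Qed.

Lemma hol_ext D f f' g g' : (forall p, D p -> f p = g p) ->
  (forall p, D p -> f' p = g' p) -> hol D f f' -> hol D g g'.
Proof.
move=> fg fg' [C C0 [d d0 [h1 h2]]]; exists C => //; exists d => //; split.
  by move=> p Dp; rewrite -fg// -fg'//; exact: h1.
by move=> p q Dp Dq; rewrite -!fg// -fg'//; exact: h2.
Qed.

Lemma hol_lip D f f' : hol D f f' -> exists2 K : R, 0 < K & exists2 d : R, 0 < d &
  forall p q, D p -> D q -> normc (q - p) <= d ->
     normc (f q - f p) <= K * normc (q - p).
Proof.
move=> [C C0 [d d0 [h1 h2]]]; exists (C * d + C); first by rewrite addr_gt0 ?mulr_gt0.
exists d => // p q Dp Dq pqd.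
rewrite -[X in normc X](subrK (f' p * (q - p))).
apply: le_trans (le_normcD _ _) _; rewrite [leRHS]mulrDl; apply: lerD.
  apply: le_trans (h2 _ _ Dp Dq pqd) _.
  by rewrite expr2 mulrA ler_wpM2r ?normc_ge0// ler_wpM2l// ltW.
by rewrite normcM ler_wpM2r ?normc_ge0// (h1 _ Dp).2.
Qed.

Lemma hol_cst D (c : R[i]) : hol D (fun=> c) (fun=> 0).
Proof.
exists (normc c + 1); first by rewrite ltr_wpDl ?normc_ge0.
exists 1 => //; split => [p _|p q _ _ _].
  by rewrite normc0 lerDl; split => //; rewrite addr_ge0 ?normc_ge0.
by rewrite subrr mul0r subr0 normc0 mulr_ge0 ?sqr_ge0// addr_ge0 ?normc_ge0.
Qed.

Lemma hol_affine D (r : R) (a b : R[i]) : (forall p, D p -> normc p <= r) ->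
  hol D (fun p => a * p + b) (fun=> a).
Proof.
move=> Dr; exists (normc a * `|r| + normc b + normc a + 1).
  by rewrite ltr_wpDl// !addr_ge0 ?mulr_ge0 ?normc_ge0.
exists 1 => //; split => [p Dp|p q _ _ _].
  split.
    apply: le_trans (le_normcD _ _) _; rewrite normcM.
    have : normc a * normc p <= normc a * `|r|.
      by rewrite ler_wpM2l ?normc_ge0//; apply: le_trans (Dr _ Dp) _; exact: ler_norm.
    by have := normc_ge0 a; lra.
  have : 0 <= normc a * `|r| by rewrite mulr_ge0 ?normc_ge0.
  by have := normc_ge0 b; lra.
rewrite (_ : _ - _ = 0); last by ring.
by rewrite normc0 mulr_ge0 ?sqr_ge0// !addr_ge0 ?mulr_ge0 ?normc_ge0.
Qed.

Lemma hol_subtract D f f' g g' : hol D f f' -> hol D g g' ->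
  hol D (fun p => f p - g p) (fun p => f' p - g' p).
Proof.
move=> [C C0 [d d0 [h1 h2]]] [C' C'0 [d' d'0 [h1' h2']]].
exists (C + C'); first exact: addr_gt0.
exists (Num.min d d'); first by rewrite lt_min d0.
split => [p Dp|p q Dp Dq].
  have [? ?] := h1 _ Dp; have [? ?] := h1' _ Dp.
  by split; apply: le_trans (le_normcB _ _) _; apply: lerD.
rewrite le_min => /andP[pd pd']; rewrite [leRHS]mulrDl.
rewrite (_ : _ - _ = (f q - f p - f' p * (q - p)) - (g q - g p - g' p * (q - p))); last by ring.
by apply: le_trans (le_normcB _ _) _; apply: lerD; [exact: h2|exact: h2'].
Qed.

(** The remainder of a product is split as
    [(remainder of f) g + f (remainder of g) + f' (q - p) (g q - g p)], whose
    last term is quadratic because [g] is Lipschitz. *)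
Lemma hol_mul D f f' g g' : hol D f f' -> hol D g g' ->
  hol D (fun p => f p * g p) (fun p => f' p * g p + f p * g' p).
Proof.
move=> hf hg; have [K K0 [d3 d30 h3]] := hol_lip hg.
case: hf => C C0 [d d0 [h1 h2]]; case: hg => C' C'0 [d' d'0 [h1' h2']].
exists (C * C' + C * C' + C * K); first by rewrite !addr_gt0// mulr_gt0.
exists (Num.min d (Num.min d' d3)); first by rewrite !lt_min d0 d'0.
split => [p Dp|p q Dp Dq].
  have [a1 a2] := h1 _ Dp; have [b1 b2] := h1' _ Dp.
  have CK : 0 <= C * K by rewrite mulr_ge0 ?ltW.
  have CC : 0 <= C * C' by rewrite mulr_ge0 ?ltW.
  split; first by rewrite normcM; have := ler_pM (normc_ge0 _) (normc_ge0 _) a1 b1; lra.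
  apply: le_trans (le_normcD _ _) _; rewrite !normcM.
  have := ler_pM (normc_ge0 _) (normc_ge0 _) a1 b2.
  by have := ler_pM (normc_ge0 _) (normc_ge0 _) a2 b1; lra.
rewrite !le_min => /and3P[pd pd' pd3].
rewrite (_ : _ - _ = (f q - f p - f' p * (q - p)) * g q
   + f p * (g q - g p - g' p * (q - p)) + (f' p * (q - p)) * (g q - g p)); last by ring.
rewrite (mulrDl (C * C' + _)) (mulrDl (C * C')).
apply: le_trans (le_normcD _ _) _; apply: lerD.
  apply: le_trans (le_normcD _ _) _; rewrite !normcM; apply: lerD.
    rewrite [leRHS]mulrAC ler_pM ?normc_ge0 ?h2//.
    exact: (h1' _ Dq).1.
  by rewrite -mulrA ler_pM ?normc_ge0 ?h2'// (h1 _ Dp).1.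
rewrite !normcM (_ : C * K * _ = (C * normc (q - p)) * (K * normc (q - p))); last by ring.
rewrite ler_pM ?mulr_ge0 ?normc_ge0 ?h3//.
by rewrite ler_wpM2r ?normc_ge0// (h1 _ Dp).2.
Qed.

Lemma hol_comp D D' f f' g g' : (forall p, D p -> D' (f p)) ->
  hol D f f' -> hol D' g g' -> hol D (g \o f) (fun p => g' (f p) * f' p).
Proof.
move=> DD hf; have [K K0 [d3 d30 h3]] := hol_lip hf.
case: hf => C C0 [d d0 [h1 h2]] [C' C'0 [d' d'0 [h1' h2']]].
exists (C' + C' * C + C' * K ^+ 2 + C' * C).
  by rewrite !addr_gt0// mulr_gt0// exprn_gt0.
have CC : 0 <= C' * C by rewrite mulr_ge0 ?ltW.
have CK : 0 <= C' * K ^+ 2 by rewrite mulr_ge0 ?sqr_ge0 ?ltW.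
exists (Num.min d (Num.min (d' / K) d3)); first by rewrite !lt_min d0 divr_gt0.
split => [p Dp|p q Dp Dq] /=.
  have [a1 a2] := h1 _ Dp; have [b1 b2] := h1' _ (DD _ Dp).
  split; first lra.
  by rewrite normcM; have := ler_pM (normc_ge0 _) (normc_ge0 _) b2 a2; lra.
rewrite !le_min => /and3P[pd pd' pd3].
have fl := h3 _ _ Dp Dq pd3.
have fd : normc (f q - f p) <= d'.
  by apply: le_trans fl _; rewrite mulrC -ler_pdivlMr.
rewrite (_ : _ - _ = (g (f q) - g (f p) - g' (f p) * (f q - f p))
   + g' (f p) * (f q - f p - f' p * (q - p))); last by ring.
have e1 := h2' _ _ (DD _ Dp) (DD _ Dq) fd.
have e2 := h2 _ _ Dp Dq pd.
apply: le_trans (le_normcD _ _) _; rewrite normcM.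
set x := normc (q - p) ^+ 2 in e2 *.
have x0 : 0 <= x by exact: sqr_ge0.
have : normc (f q - f p) ^+ 2 <= K ^+ 2 * x.
  by rewrite -exprMn ler_pXn2r ?nnegrE ?mulr_ge0 ?normc_ge0// ltW.
move=> /(ler_wpM2l (ltW C'0)); rewrite mulrA => e3.
have e4 := ler_pM (normc_ge0 _) (normc_ge0 _) (h1' _ (DD _ Dp)).2 e2.
rewrite mulrA in e4.
have : 0 <= C' * x by rewrite mulr_ge0// ltW.
have : 0 <= C' * C * x by rewrite mulr_ge0.
rewrite !mulrDl; lra.
Qed.

Lemma hol_inv D (e : R) : 0 < e -> (forall p, D p -> e <= normc p) ->
  hol D (fun p => p^-1) (fun p => - p^-1 ^+ 2).
Proof.
move=> e0 De; exists (e^-1 + e^-1 ^+ 2 + e^-1 ^+ 3).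
  by rewrite !addr_gt0// ?exprn_gt0// invr_gt0.
have ei0 : 0 <= e^-1 by rewrite invr_ge0 ltW.
have P2 : 0 <= e^-1 ^+ 2 by rewrite exprn_ge0.
have P3 : 0 <= e^-1 ^+ 3 by rewrite exprn_ge0.
have ie p : D p -> normc p^-1 <= e^-1.
  by move=> Dp; rewrite normcV lef_pV2 ?posrE// ?De// (lt_le_trans e0) ?De.
have ne0 p : D p -> p != 0.
  by move=> Dp; rewrite -normc_gt0 (lt_le_trans e0) ?De.
exists 1 => //; split => [p Dp|p q Dp Dq _].
  split; first by have := ie _ Dp; lra.
  have : normc p^-1 ^+ 2 <= e^-1 ^+ 2 by rewrite ler_pXn2r ?nnegrE ?normc_ge0// ie.
  by rewrite normcN normcX; lra.
rewrite (_ : _ - _ = (p^-1 ^+ 2 * q^-1) * (q - p) ^+ 2); last first.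
  by field; rewrite ne0// ne0.
rewrite normcM normcX ler_wpM2r ?sqr_ge0// normcM normcX.
have : normc p^-1 ^+ 2 * normc q^-1 <= e^-1 ^+ 3.
  rewrite [leRHS]exprSr ler_pM ?sqr_ge0 ?normc_ge0 ?ie//.
  by rewrite ler_pXn2r ?nnegrE ?normc_ge0// ie.
lra.
Qed.

Lemma hol_exp D (r : R) : (forall p, D p -> normc p <= r) -> hol D cexp cexp.
Proof.
move=> Dr; exists (expR r * (4 * expR 1)); first by rewrite !mulr_gt0 ?expR_gt0.
have e1 : 1 <= expR 1 :> R by rewrite -expR0 ler_expR.
have er := expR_gt0 r.
have De p : D p -> normc (cexp p) <= expR r.
  move=> Dp; rewrite normc_cexp ler_expR.
  by apply: le_trans (Dr _ Dp); apply: le_trans (ler_norm _) (ler_normc_Re _).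
have De' p : D p -> normc (cexp p) <= expR r * (4 * expR 1).
  by move=> /De h; apply: le_trans h _; rewrite ler_peMr ?ltW//; lra.
exists 1 => //; split => [p Dp|p q Dp Dq pq]; first by split; exact: De'.
rewrite -{1}(subrK p q) cexpD.
rewrite (_ : _ - _ = cexp p * (cexp (q - p) - 1 - (q - p))); last by ring.
rewrite normcM -[leRHS]mulrA ler_pM ?normc_ge0 ?De//.
apply: le_trans (normc_cexp_taylor2 _) _.
rewrite mulrAC ler_wpM2r ?sqr_ge0// ler_wpM2l// ler_expR.
exact: le_trans (ler_normc_Re _) pq.
Qed.

(** Two holomorphic pieces whose domains overlap in a collar of width [w]. *)
Lemma hol_glue D D1 D2 (S : R[i] -> bool) f f1 f2 (w : R) : 0 < w ->
  (forall p q, D p -> D q -> normc (q - p) <= w -> S p -> D1 p /\ D1 q) ->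
  (forall p q, D p -> D q -> normc (q - p) <= w -> ~~ S p -> D2 p /\ D2 q) ->
  hol D1 f f1 -> hol D2 f f2 -> hol D f (fun p => if S p then f1 p else f2 p).
Proof.
move=> w0 s1 s2 [C C0 [d d0 [h1 h2]]] [C' C'0 [d' d'0 [h1' h2']]].
exists (C + C'); first exact: addr_gt0.
exists (Num.min w (Num.min d d')); first by rewrite !lt_min w0 d0.
have pp p : normc (p - p) <= w by rewrite subrr normc0 ltW.
split => [p Dp|p q Dp Dq].
  case: ifPn => Sp.
    have [D1p _] := s1 _ _ Dp Dp (pp p) Sp; have := h1 _ D1p; lra.
  have [D2p _] := s2 _ _ Dp Dp (pp p) Sp; have := h1' _ D2p; lra.
rewrite !le_min => /and3P[pw pd pd']; rewrite mulrDl; case: ifPn => Sp.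
  have [D1p D1q] := s1 _ _ Dp Dq pw Sp; have := h2 _ _ D1p D1q pd.
  have : 0 <= C' * normc (q - p) ^+ 2 by rewrite mulr_ge0 ?sqr_ge0 ?ltW.
  lra.
have [D1p D1q] := s2 _ _ Dp Dq pw Sp; have := h2' _ _ D1p D1q pd'.
have : 0 <= C * normc (q - p) ^+ 2 by rewrite mulr_ge0 ?sqr_ge0 ?ltW.
lra.
Qed.

Definition cvx D := forall p q (t : R), D p -> D q -> 0 <= t <= 1 -> D (p + t%:C * (q - p)).

(** Subdividing [0, 1] into [m] equal steps makes the quadratic terms
    contribute only [O (1 / m)]. *)
Lemma quadratic_increments (phi : R -> R[i]) (a b d : R) : 0 <= b -> 0 < d ->
  (forall s t, 0 <= s -> s < t -> t <= 1 -> t - s <= d ->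
     normc (phi t - phi s) <= a * (t - s) + b * (t - s) ^+ 2) ->
  normc (phi 1 - phi 0) <= a.
Proof.
move=> b0 d0 h; apply/ler_addgt0Pr => e e0.
have [m mP] : exists m : nat, d^-1 + b / e < m.+1%:R.
  exists (Num.truncn (d^-1 + b / e)); exact: truncnS_gt.
have m0 : 0 < m.+1%:R :> R by rewrite ltr0n.
have be0 : 0 <= b / e by rewrite divr_ge0// ltW.
have di0 : 0 < d^-1 by rewrite invr_gt0.
have step (k : 'I_m.+1) : normc (phi (k.+1%:R / m.+1%:R) - phi (k%:R / m.+1%:R)) <=
    a / m.+1%:R + b / m.+1%:R ^+ 2.
  have e1 : k.+1%:R / m.+1%:R - k%:R / m.+1%:R = m.+1%:R^-1 :> R.
    by rewrite -mulrBl -natrB// subSnn mul1r.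
  rewrite -exprVn; have := h (k%:R / m.+1%:R) (k.+1%:R / m.+1%:R); rewrite e1; apply.
  - by rewrite divr_ge0// ler0n.
  - by rewrite ltr_pM2r ?invr_gt0// ltr_nat.
  - by rewrite ler_pdivrMr// mul1r ler_nat ltn_ord.
  - by rewrite -[leRHS]invrK lef_pV2 ?posrE//; lra.
have -> : phi 1 - phi 0 =
    \sum_(k < m.+1) (phi (k.+1%:R / m.+1%:R) - phi (k%:R / m.+1%:R)).
  rewrite -(big_mkord xpredT (fun k => phi (k.+1%:R / m.+1%:R) - phi (k%:R / m.+1%:R))).
  by rewrite (telescope_sumr (fun k => phi (k%:R / m.+1%:R)))// divff ?gt_eqF// mul0r.
apply: le_trans (le_normc_sum _ _ _) _.
apply: le_trans (ler_sum _ (fun k _ => step k)) _.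
rewrite sumr_const card_ord -[leLHS]mulr_natr mulrDl divfK ?gt_eqF// lerD2l.
rewrite expr2 invfM mulrA divfK ?gt_eqF// ler_pdivrMr//.
have : b / e < m.+1%:R by lra.
by rewrite ltr_pdivrMr// mulrC => /ltW.
Qed.

End Holomorphy.

(** * A discrete Cauchy formula *)

Section RootOfUnity.
Context {R : realType}.

Definition rootu (N : nat) : R[i] := cexp (0 +i* (2 * pi / N%:R)).

Lemma rootuX N : (0 < N)%N -> rootu N ^+ N = 1.
Proof.
move=> N0; rewrite -cexpM_natl.
have -> : N%:R * (0 +i* (2 * pi / N%:R)) = 0 +i* (pi *+ 2) :> R[i].
  have N0' : N%:R != 0 :> R by rewrite pnatr_eq0 -lt0n.
  rewrite -(rmorph_nat (real_complex R)).
  by apply: complex_ext; rewrite ?Re_mul ?Im_mul /=; [ring|rewrite mulr2n; field].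
by apply: complex_ext; rewrite ?Re_cexp ?Im_cexp /= expR0 ?cos2pi ?sin2pi !mul1r.
Qed.

Lemma normc_rootu N : normc (rootu N) = 1.
Proof. by rewrite normc_cexp expR0. Qed.

Lemma rootu_neq1 N : (2 < N)%N -> rootu N != 1.
Proof.
move=> N2; apply/eqP => /(congr1 (@complex.Im R)); rewrite Im_cexp /= expR0 mul1r.
apply/eqP; rewrite gt_eqF//; apply: sin_gt0_pi.
have N0 : 0 < N%:R :> R by rewrite ltr0n; case: N N2.
rewrite divr_gt0 ?mulr_gt0 ?pi_gt0//= ltr_pdivrMr// mulrC ltr_pM2l ?pi_gt0//.
by rewrite ltr_nat.
Qed.

Lemma normc_rootuB1 N : normc (rootu N - 1) <= 2 * pi / N%:R.
Proof.
apply: le_trans (normc_cexpiB1 _) _; rewrite ger0_norm// divr_ge0//.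
by rewrite mulr_ge0// pi_ge0.
Qed.

End RootOfUnity.

Section Circle.
Context {R : realType}.
Implicit Types (D : R[i] -> Prop) (f g : R[i] -> R[i]) (a z : R[i]) (r : R).

Definition circ a r N (j : nat) : R[i] := a + r%:C * rootu N ^+ j.

(** Discretised Cauchy kernel, [w / (w - z)] with [w] centred at [a]. *)
Definition cker a r z N j : R[i] := (circ a r N j - a) / (circ a r N j - z).

Lemma normc_circ a r N j : 0 < r -> normc (circ a r N j - a) = r.
Proof.
move=> r0; rewrite /circ addrAC subrr add0r normcM normc_real normcX normc_rootu.
by rewrite expr1n mulr1 gtr0_norm.
Qed.

Lemma normc_circB a r z N j : 0 < r -> normc (z - a) < r ->
  r - normc (z - a) <= normc (circ a r N j - z) <= 2 * r.
Proof.
move=> r0 zr; have nr := normc_circ a N j r0; apply/andP; split.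
  rewrite lerBlDr -{1}nr -[X in normc X <= _](subrK (z - a)).
  by apply: le_trans (le_normcD _ _) _; rewrite opprB addrA subrK.
rewrite (_ : _ - z = (circ a r N j - a) - (z - a)); last by ring.
by apply: le_trans (le_normcB _ _) _; rewrite nr; lra.
Qed.

Lemma circB_neq0 a r z N j : 0 < r -> normc (z - a) < r -> circ a r N j - z != 0.
Proof.
move=> r0 zr; rewrite -normc_gt0; have /andP[h _] := normc_circB N j r0 zr; lra.
Qed.

Lemma normc_cker a r z N j : 0 < r -> normc (z - a) < r ->
  normc (cker a r z N j) <= r / (r - normc (z - a)).
Proof.
move=> r0 zr; have /andP[h _] := normc_circB N j r0 zr.
rewrite normcM normcV normc_circ// ler_pM2l// lef_pV2 ?posrE//; lra.
Qed.

(** The image of the circle under [w / (w - z)] stays in a half-plane to the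
    right of the origin, so that the sum of the kernel cannot be small; this
    plays the part of the winding number. *)
Lemma Re_cker a r z N j : 0 < r -> normc (z - a) < r ->
  1 / 2 <= complex.Re (cker a r z N j).
Proof.
move=> r0 zr; have w0 := circB_neq0 N j r0 zr.
have := normc_circ a N j r0; have := w0; rewrite /cker.
rewrite (_ : circ a r N j - z = (circ a r N j - a) - (z - a)); last by ring.
move: (circ a r N j - a) (z - a) zr => w y yr w0' nr.
have r2 : normc y ^+ 2 <= normc w ^+ 2.
  by rewrite nr ler_pXn2r ?nnegrE ?normc_ge0 ?(ltW r0)// ltW.
have n0 : 0 < normc (w - y) ^+ 2 by rewrite exprn_gt0// normc_gt0.
suff -> : complex.Re (w / (w - y)) =
   (normc w ^+ 2 - (complex.Re w * complex.Re y + complex.Im w * complex.Im y))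
     / normc (w - y) ^+ 2.
  rewrite ler_pdivlMr//; move: r2; rewrite !normcE2 Re_sub Im_sub => r2; nra.
rewrite Re_mul Re_inv Im_inv Re_sub Im_sub (normcE2 w); field; by rewrite normc_eq0.
Qed.

(** Discrete Cauchy formula.  Moving the circle homothetically onto [z], the
    derivative of the weighted average is a Riemann sum of a total derivative
    along the circle; telescoping bounds that sum independently of [N], while
    the average has [N] terms. *)
Lemma cauchy_circle D f f' a z r : hol D f f' -> cvx D -> 0 < r ->
  (forall p, normc (p - a) <= r -> D p) -> normc (z - a) < r ->
  exists K : R, forall N : nat, (2 < N)%N -> K <= N%:R ->
    normc (\sum_(j < N) (f (circ a r N j) - f z) * cker a r z N j) <= K.
Proof.
move=> [C C0 [d d0 [h1 h2]]] Dc r0 Da zr.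
have pi0 := pi_gt0 R.
exists (2 * pi * r / d + C * r ^+ 2 * (2 * pi)) => N N2 NK.
have N0 : 0 < N%:R :> R by rewrite ltr0n; case: N N2 {NK}.
set W := circ a r N; set k := cker a r z N; pose om : R[i] := rootu N.
have Dz : D z by apply: Da; exact: ltW.
have DW j : D (W j) by apply: Da; rewrite normc_circ.
have Cr0 : 0 <= C * r ^+ 2 * (2 * pi).
  by rewrite !mulr_ge0 ?(ltW r0) ?(ltW C0) ?(ltW pi0).
have om0 : 0 < normc (om - 1) by rewrite normc_gt0 subr_eq0 rootu_neq1.
have omN : N%:R * normc (om - 1) <= 2 * pi.
  by rewrite mulrC -ler_pdivlMr// normc_rootuB1.
have omd : r * normc (om - 1) <= d.
  rewrite mulrC -ler_pdivlMr//; apply: le_trans (normc_rootuB1 N) _.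
  have : 2 * pi * r / d <= N%:R by lra.
  rewrite ler_pdivrMr// => h; rewrite ler_pdivrMr// mulrAC ler_pdivlMr//.
  by rewrite [d * _]mulrC.
pose P (t : R) j := z + t%:C * (W j - z).
have DP t j : 0 <= t <= 1 -> D (P t j) by exact: Dc.
have kW j : (W j - z) * k j = r%:C * om ^+ j.
  by rewrite /k /cker mulrC divfK ?circB_neq0// /circ addrAC subrr add0r.
pose phi t := \sum_(j < N) f (P t j) * k j.
have -> : \sum_(j < N) (f (circ a r N j) - f z) * cker a r z N j = phi 1 - phi 0.
  rewrite -sumrB; apply: eq_bigr => j _.
  rewrite -mulrBl /P mul1r mul0r addr0; congr ((f _ - _) * _).
  by rewrite /W; ring.
suff : normc (phi 1 - phi 0) <= C * r ^+ 2 * (2 * pi).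
  move/le_trans; apply; rewrite lerDr divr_ge0 ?(ltW d0)//.
  by rewrite !mulr_ge0 ?(ltW r0) ?(ltW pi0).
pose km := r / (r - normc (z - a)).
have km0 : 0 <= km by rewrite divr_ge0 ?subr_ge0 ?(ltW r0)// ltW.
apply: (@quadratic_increments _ _ _ (N%:R * (C * (2 * r) ^+ 2 * km)) (d / (2 * r))).
- by rewrite mulr_ge0 ?(ltW N0)// mulr_ge0// mulr_ge0 ?sqr_ge0// ltW.
- by rewrite divr_gt0// mulr_gt0.
move=> s t s0 st t1 std.
have t0 : 0 < t by exact: le_lt_trans st.
have tI : 0 <= t <= 1 by rewrite (ltW t0).
have sI : 0 <= s <= 1 by rewrite s0 (le_trans (ltW st)).
pose A := \sum_(j < N) f' (P t j) * (r%:C * om ^+ j).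
have Pd j : P t j.+1 - P t j = t%:C * (r%:C * om ^+ j * (om - 1)).
  by rewrite /P /W /circ exprSr -/om; ring.
have nPd j : normc (P t j.+1 - P t j) = t * (r * normc (om - 1)).
  by rewrite Pd !normcM !normc_real normcX normc_rootu expr1n mulr1 !gtr0_norm.
have hA : normc A <= C * r ^+ 2 * (2 * pi).
  have e1 : t%:C * (om - 1) * A = - \sum_(j < N)
      (f (P t j.+1) - f (P t j) - f' (P t j) * (P t j.+1 - P t j)).
    rewrite sumrB.
    have -> : \sum_(j < N) (f (P t j.+1) - f (P t j)) = 0.
      rewrite -(big_mkord xpredT (fun j => f (P t j.+1) - f (P t j))).
      rewrite (telescope_sumr (fun j => f (P t j)))//.
      by rewrite /P /W /circ rootuX ?expr0 ?subrr//; case: N N2 {NK N0 W k om om0 omN omd DW P DP kW phi A Pd nPd}.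
    rewrite sub0r opprK /A mulr_sumr; apply: eq_bigr => j _; rewrite Pd; ring.
  have : normc (t%:C * (om - 1) * A) <= N%:R * (C * (t * (r * normc (om - 1))) ^+ 2).
    rewrite e1 normcN; apply: le_trans (le_normc_sum _ _ _) _.
    apply: le_trans (_ : \sum_(j < N) C * (t * (r * normc (om - 1))) ^+ 2 <= _).
      apply: ler_sum => j _; rewrite -(nPd j); apply: h2; [exact: DP|exact: DP|].
      rewrite nPd; apply: le_trans omd; rewrite ler_piMl ?mulr_ge0 ?normc_ge0 ?(ltW r0)//.
    by rewrite sumr_const card_ord -[leLHS]mulr_natr mulrC.
  rewrite !normcM normc_real gtr0_norm//.
  set x := normc (om - 1) in om0 omN *; set y := normc A.
  rewrite (_ : N%:R * _ = (t * x) * (C * t * r ^+ 2 * (N%:R * x))); last by ring.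
  rewrite ler_pM2l ?mulr_gt0// => /le_trans; apply.
  apply: ler_pM => //; first by rewrite !mulr_ge0 ?sqr_ge0 ?ltW.
    by rewrite mulr_ge0// ltW.
  by rewrite ler_wpM2r ?sqr_ge0// ger_pMr.
have e2 : phi t - phi s = - (\sum_(j < N)
     (f (P s j) - f (P t j) - f' (P t j) * (P s j - P t j)) * k j + (s - t)%:C * A).
  rewrite /phi /A mulr_sumr -sumrB -big_split -sumrN; apply: eq_bigr => j _ /=.
  rewrite -kW /P rmorphB /=; ring.
rewrite e2 normcN; apply: le_trans (le_normcD _ _) _; rewrite addrC; apply: lerD.
  rewrite normcM normc_real distrC gtr0_norm ?subr_gt0// mulrC.
  by rewrite ler_pM2r ?subr_gt0.
apply: le_trans (le_normc_sum _ _ _) _.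
apply: le_trans (_ : \sum_(j < N) (C * (2 * r) ^+ 2 * km) * (t - s) ^+ 2 <= _).
  apply: ler_sum => j _; rewrite normcM.
  have /andP[_ Wz] := normc_circB N j r0 zr.
  have dist : normc (P s j - P t j) <= (t - s) * (2 * r).
    rewrite (_ : P s j - P t j = (s - t)%:C * (W j - z)); last by rewrite /P rmorphB /=; ring.
    by rewrite normcM normc_real distrC gtr0_norm ?subr_gt0// ler_pM2l ?subr_gt0.
  rewrite [leRHS]mulrAC; apply: ler_pM; rewrite ?normc_ge0//; last exact: normc_cker.
  apply: le_trans (h2 _ _ (DP _ _ tI) (DP _ _ sI) _) _.
    by apply: le_trans dist _; rewrite -ler_pdivlMr// mulr_gt0.
  rewrite -mulrA ler_pM2l// -exprMn [2 * r * _]mulrC.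
  by apply: lerXn2r => //; rewrite nnegrE ?normc_ge0// (le_trans _ dist) ?normc_ge0.
by rewrite sumr_const card_ord -[leLHS]mulr_natr mulrC [leLHS]mulrA.
Qed.

End Circle.

(** * Identity theorem and Liouville's theorem *)

Section IdentityLiouville.
Context {R : realType}.
Implicit Types (f g : R[i] -> R[i]) (a z : R[i]) (r : R).

Definition cdisc a r (p : R[i]) : Prop := normc (p - a) <= r.

Lemma cvx_cdisc a r : cvx (cdisc a r).
Proof.
move=> p q t pr qr /andP[t0 t1]; rewrite /cdisc.
rewrite (_ : _ - a = (1 - t)%:C * (p - a) + t%:C * (q - a)); last first.
  by rewrite rmorphB rmorph1; ring.
apply: le_trans (le_normcD _ _) _; rewrite !normcM !normc_real.
rewrite ger0_norm ?subr_ge0// ger0_norm//.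
have h1 : (1 - t) * normc (p - a) <= (1 - t) * r by rewrite ler_wpM2l ?subr_ge0.
have h2 : t * normc (q - a) <= t * r by rewrite ler_wpM2l.
lra.
Qed.

(** Used to let the number [N] of sample points tend to infinity. *)
Lemma linear_growth_le0 (u K N0 : R) :
  (forall N : nat, (2 < N)%N -> N0 <= N%:R -> N%:R * u <= K) -> u <= 0.
Proof.
move=> h; rewrite leNgt; apply/negP => u0.
pose M := `|N0| + `|K| / u + 3.
have M1 : M < (Num.truncn M).+1%:R := truncnS_gt M.
have Ku : 0 <= `|K| / u by rewrite divr_ge0// ltW.
have n0 := normr_ge0 N0; have n1 := ler_norm N0; have k1 := ler_norm K.
have N2 : (2 < (Num.truncn M).+1)%N by rewrite -(ltr_nat R); apply: le_lt_trans M1; rewrite /M; lra.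
have NN : N0 <= (Num.truncn M).+1%:R by apply: le_trans (ltW M1); rewrite /M; lra.
have := h _ N2 NN; rewrite -ler_pdivlMr// => h1.
have : K / u <= `|K| / u by rewrite ler_pM2r ?invr_gt0.
by move: M1; rewrite /M; lra.
Qed.

Lemma geometric_le0 (q x K : R) : 0 <= q < 1 -> (forall m, x <= K * q ^+ m) -> x <= 0.
Proof.
move=> /andP[q0 q1] h; rewrite leNgt; apply/negP => x0.
have q1' : `|q| < 1 by rewrite ger0_norm.
have /cvgrPdist_lt/(_ _ x0)[m _ /(_ m (leqnn m))] := cvg_geometric K q1'.
rewrite sub0r normrN /geometric /= => /(le_lt_trans (ler_norm _)).
by rewrite ltNge h.
Qed.

Lemma sum_cker_ge a r z N : 0 < r -> normc (z - a) < r ->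
  N%:R / 2 <= normc (\sum_(j < N) cker a r z N j).
Proof.
move=> r0 zr; apply: (le_trans _ (le_trans (ler_norm _) (ler_normc_Re _))).
rewrite Re_sum; apply: (@le_trans _ _ (\sum_(j < N) 1 / 2)).
  by rewrite sumr_const card_ord -[leRHS]mulr_natr; lra.
by apply: ler_sum => j _; exact: Re_cker.
Qed.

Lemma normc_sum_cker_le f (B : R) a r z N : 0 < r -> normc (z - a) < r ->
  (forall p, normc (p - a) = r -> normc (f p) <= B) ->
  normc (\sum_(j < N) f (circ a r N j) * cker a r z N j)
    <= N%:R * (B * (r / (r - normc (z - a)))).
Proof.
move=> r0 zr fB; apply: le_trans (le_normc_sum _ _ _) _.
apply: le_trans (_ : \sum_(j < N) B * (r / (r - normc (z - a))) <= _).
  apply: ler_sum => j _; rewrite normcM.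
  by apply: ler_pM; rewrite ?normc_ge0 ?fB ?normc_circ ?normc_cker.
by rewrite sumr_const card_ord -[leLHS]mulr_natr mulrC.
Qed.

(** A weak maximum principle: the factor does not depend on [f], so applying
    it to the quotients [f p / (p - a) ^ m] loses only a constant. *)
Lemma normc_le_circle f f' (B : R) a r z : hol (cdisc a r) f f' -> 0 < r ->
  normc (z - a) < r -> (forall p, normc (p - a) = r -> normc (f p) <= B) ->
  normc (f z) <= 2 * (B * (r / (r - normc (z - a)))).
Proof.
move=> hf r0 zr fB.
have [K hK] := cauchy_circle hf (@cvx_cdisc a r) r0 (fun p h => h) zr.
rewrite -subr_le0; apply: (@linear_growth_le0 _ (2 * K) K) => N N2 NK.
have h1 := hK N N2 NK; have h2 := normc_sum_cker_le N r0 zr fB.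
have h3 := sum_cker_ge N r0 zr.
have : normc (f z) * normc (\sum_(j < N) cker a r z N j) <=
    K + N%:R * (B * (r / (r - normc (z - a)))).
  rewrite -normcM mulr_sumr.
  rewrite (_ : \sum_(j < N) _ = (\sum_(j < N) f (circ a r N j) * cker a r z N j) -
    \sum_(j < N) (f (circ a r N j) - f z) * cker a r z N j); last first.
    by rewrite -sumrB; apply: eq_bigr => j _; ring.
  by apply: le_trans (le_normcB _ _) _; lra.
have := ler_wpM2l (normc_ge0 (f z)) h3.
set A := normc (f z); set T := B * _; lra.
Qed.

(** The quotient [f p / (p - a) ^ m] is holomorphic because [f] vanishes
    near [a]; comparing its value at [z] with its values on the circle gives
    [|f z| <= c (|z - a| / r) ^ m] for all [m]. *)
Lemma identity_disc f f' a r e z : hol (cdisc a r) f f' -> 0 < r -> 0 < e ->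
  (forall p, normc (p - a) < e -> normc (p - a) <= r -> f p = 0) ->
  normc (z - a) < r -> f z = 0.
Proof.
move=> hf r0 e0 f0 zr.
have [ze|ez] := ltP (normc (z - a)) e; first by apply: f0 => //; exact: ltW.
have za0 : 0 < normc (z - a) by exact: lt_le_trans ez.
have e3 : 0 < e / 3 by rewrite divr_gt0.
have [C C0 [d d0 [hC _]]] := hf.
pose D1 p := e / 3 <= normc (p - a) /\ cdisc a r p.
pose D2 p := normc (p - a) < e /\ cdisc a r p.
have hinv : exists g', hol D1 (fun p => (p - a)^-1) g'.
  have h1 : hol D1 (fun p => 1 * p + - a) (fun=> 1).
    apply: (@hol_affine _ _ (r + normc a)) => p [_ pr].
    by rewrite -(subrK a p); apply: le_trans (le_normcD _ _) _; rewrite lerD2r.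
  have h2 := @hol_inv _ (fun p => e / 3 <= normc p) _ e3 (fun p h => h).
  have h3 : forall p, D1 p -> e / 3 <= normc (1 * p + - a) by move=> p []; rewrite mul1r.
  by eexists; apply: hol_ext (hol_comp h3 h1 h2) => [p _|//] /=; rewrite mul1r.
have hinvm m : exists g', hol D1 (fun p => (p - a)^-1 ^+ m) g'.
  elim: m => [|m [g' hg']].
    by eexists; apply: hol_ext (hol_cst _ 1) => //.
  have [h' hh'] := hinv; eexists.
  by apply: hol_ext (hol_mul hh' hg') => // p _; rewrite exprS.
have hg m : exists g', hol (cdisc a r) (fun p => f p * (p - a)^-1 ^+ m) g'.
  have [h' hh'] := hinvm m.
  eexists; apply: (@hol_glue _ _ D1 D2 (fun p => e * 2 / 3 <= normc (p - a)) _ _ (fun=> 0) (e / 3)) => //.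
  - move=> p q pr qr qp Sp; split; split=> //; first lra.
    have := le_normcD (p - q) (q - a); rewrite addrA subrK normc_distC; lra.
  - move=> p q pr qr qp; rewrite -ltNge => Sp; split; split => //; first lra.
    have := le_normcD (q - p) (p - a); rewrite addrA subrK; lra.
  - by apply: hol_mul hh'; apply: hol_sub hf => p [].
  - by apply: hol_ext (hol_cst _ 0) => // p [pe pr]; rewrite f0// mul0r.
apply/eqP; rewrite -normc_eq0 eq_le normc_ge0 andbT.
pose km := r / (r - normc (z - a)).
apply: (@geometric_le0 (normc (z - a) / r) _ (2 * (C * km))).
  by rewrite divr_ge0 ?normc_ge0 ?(ltW r0)//= ltr_pdivrMr// mul1r.
move=> m; have [g' hg'] := hg m.
have fB p : normc (p - a) = r -> normc (f p * (p - a)^-1 ^+ m) <= C * r^-1 ^+ m.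
  move=> pr; rewrite normcM normcX normcV pr; apply: ler_wpM2r.
    by rewrite exprn_ge0// invr_ge0 ltW.
  by apply: (hC p _).1; rewrite /cdisc pr.
have := normc_le_circle hg' r0 zr fB.
rewrite normcM normcX normcV -/km -ler_pdivlMr ?exprn_gt0 ?invr_gt0//.
move/le_trans; apply.
by rewrite expr_div_n !exprVn invrK le_eqVlt; apply/orP; left; apply/eqP; ring.
Qed.

(** On a circle of radius [r] the kernels for [z] and for [0] differ by
    [O(1 / r)] while [f] is [O(r^(1/2))], so [f z - f 0] is [O(r^(-1/2))]. *)
Lemma liouville f (C : R) : (forall r, exists f', hol (cdisc 0 r) f f') ->
  (forall u, normc (f u) ^+ 2 <= C * (1 + normc u)) -> forall z, f z = f 0.
Proof.
move=> hf fC z; apply/eqP; rewrite -subr_eq0 -normc_eq0 eq_le normc_ge0 andbT.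
have z00 : 0 <= normc z := normc_ge0 z.
have key r : normc z < r -> normc (f z - f 0) * (r - normc z) <=
    4 * Num.sqrt (C * (1 + r)) * normc z.
  move=> zr; have r0 : 0 < r by exact: le_lt_trans zr.
  have [f' hf'] := hf r.
  have zr' : normc (z - 0) < r by rewrite subr0.
  have o0r : normc (0 - 0 : R[i]) < r by rewrite subrr normc0.
  have [K hK] := cauchy_circle hf' (@cvx_cdisc 0 r) r0 (fun p h => h) zr'.
  have [K' hK'] := cauchy_circle hf' (@cvx_cdisc 0 r) r0 (fun p h => h) o0r.
  set B := Num.sqrt _.
  have fB p : normc (p - 0) = r -> normc (f p) <= B.
    move=> pr; have := fC p; rewrite -[p in C * (1 + normc p)]subr0 pr => h.
    by rewrite -(ler_pXn2r (n := 2)) ?nnegrE ?normc_ge0 ?sqrtr_ge0// sqr_sqrtr// (le_trans _ h)// sqr_ge0.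
  rewrite -subr_le0; apply: (@linear_growth_le0 _ (2 * ((K + K') * (r - normc z))) (`|K| + `|K'|)) => N N2 NK.
  have kK := ler_norm K; have kK' := ler_norm K'.
  have nK := normr_ge0 K; have nK' := normr_ge0 K'.
  have h1 : _ <= K := hK N N2 ltac:(lra).
  have h2 : _ <= K' := hK' N N2 ltac:(lra).
  have h3 := sum_cker_ge N r0 zr'.
  have zr0 : 0 < r - normc z by rewrite subr_gt0.
  have h4 : normc (\sum_(j < N) (f (circ 0 r N j) - f 0) * (cker 0 r z N j - 1)) <=
      N%:R * (2 * B * (normc z / (r - normc z))).
    apply: le_trans (le_normc_sum _ _ _) _.
    apply: le_trans (_ : \sum_(j < N) 2 * B * (normc z / (r - normc z)) <= _).
      apply: ler_sum => j _; rewrite normcM; apply: ler_pM; rewrite ?normc_ge0//.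
        apply: le_trans (le_normcB _ _) _.
        have := fB _ (normc_circ 0 N j r0); have : normc (f 0) <= B; last by lra.
        have := fC 0; rewrite normc0 => h.
        rewrite -(ler_pXn2r (n := 2)) ?nnegrE ?normc_ge0 ?sqrtr_ge0// sqr_sqrtr.
          apply: le_trans h _; rewrite addr0 mulr1; apply: ler_peMr; last by lra.
          by apply: le_trans (sqr_ge0 (normc (f 0))) _; have := fC 0; rewrite normc0 addr0 mulr1.
        apply: le_trans (sqr_ge0 (normc (f (circ 0 r N j)))) _.
        by have := fC (circ 0 r N j); rewrite -{2}[circ _ _ _ _]subr0 normc_circ.
      have c0 := circB_neq0 N j r0 zr'.
      have -> : cker 0 r z N j - 1 = z / (circ 0 r N j - z).
        by rewrite /cker subr0 -[X in _ - X](divff c0) -mulrBl opprB addrC subrK.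
      rewrite normcM normcV ler_wpM2l// lef_pV2 ?posrE ?normc_gt0//.
      by have /andP[] := normc_circB N j r0 zr'; rewrite subr0.
    by rewrite sumr_const card_ord -[leLHS]mulr_natr mulrC.
  have k1 j : cker 0 r 0 N j = 1 by rewrite /cker divff ?circB_neq0.
  have h5 : normc (f z - f 0) * normc (\sum_(j < N) cker 0 r z N j) <=
      K + K' + N%:R * (2 * B * (normc z / (r - normc z))).
    rewrite -normcM mulr_sumr.
    rewrite (_ : \sum_(j < N) _ = - (\sum_(j < N) (f (circ 0 r N j) - f z) * cker 0 r z N j) +
      \sum_(j < N) (f (circ 0 r N j) - f 0) * cker 0 r 0 N j +
      \sum_(j < N) (f (circ 0 r N j) - f 0) * (cker 0 r z N j - 1)); last first.
      by rewrite -sumrN -!big_split; apply: eq_bigr => j _ /=; rewrite k1; ring.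
    apply: le_trans (le_normcD _ _) _; apply: lerD => //.
    by apply: le_trans (le_normcD _ _) _; rewrite normcN; apply: lerD.
  have := ler_wpM2l (normc_ge0 (f z - f 0)) h3 => /le_trans/(_ h5).
  rewrite -(ler_pM2r zr0) [leRHS]mulrDl.
  rewrite (_ : N%:R * (2 * B * _) * _ = N%:R * (2 * B * normc z)); last first.
    by field; exact: lt0r_neq0.
  by set A := normc (f z - f 0); lra.
have C0 : 0 <= C by have := fC 0; rewrite normc0 addr0 mulr1; apply: le_trans; exact: sqr_ge0.
set X := normc (f z - f 0) in key *.
have X0 : 0 <= X := normc_ge0 _.
rewrite leNgt; apply/negP => Xp.
(* compare squares at a radius dominating [C |z|^2 / X^2] *)
pose r := 2 * normc z + 1 + 64 * C * (1 + normc z ^+ 2) * 2 / X ^+ 2.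
pose T := C * (1 + normc z ^+ 2) / X ^+ 2.
have T0 : 0 <= T by rewrite divr_ge0 ?mulr_ge0 ?addr_ge0 ?sqr_ge0.
have rE : r = 2 * normc z + 1 + 128 * T by rewrite /r /T; ring.
have zr : normc z < r by rewrite rE; lra.
have r1 : 1 <= r by rewrite rE; lra.
have := key r zr; rewrite -(ler_pXn2r (n := 2)) ?nnegrE//; first last.
- by rewrite !mulr_ge0 ?sqrtr_ge0.
- by rewrite mulr_ge0// subr_ge0 ltW.
have c1 : 0 <= C * (1 + r) by rewrite mulr_ge0//; lra.
rewrite !exprMn sqr_sqrtr//.
have h1 : r ^+ 2 / 4 <= (r - normc z) ^+ 2.
  have : r / 2 <= r - normc z by rewrite rE; lra.
  have rz : 0 <= r - normc z by lra.
  have r2 : 0 <= r / 2 by lra.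
  rewrite -(ler_pXn2r (n := 2)) ?nnegrE//.
  by rewrite expr_div_n (_ : 2%:R ^+ 2 = 4 :> R)//; ring.
have CT : C * normc z ^+ 2 <= T * X ^+ 2.
  rewrite /T divfK ?expf_neq0 ?gt_eqF// ler_wpM2l//; lra.
have X2 : 0 < X ^+ 2 by rewrite exprn_gt0.
move=> h2.
have h3 : X ^+ 2 * (r ^+ 2 / 4) <= X ^+ 2 * (r - normc z) ^+ 2 by rewrite ler_pM2l.
have h4 : 4 ^+ 2 * (C * (1 + r)) * normc z ^+ 2 <= 16 * (1 + r) * (T * X ^+ 2).
  rewrite (_ : _ * normc z ^+ 2 = 16 * (1 + r) * (C * normc z ^+ 2)); last by ring.
  by rewrite ler_wpM2l// mulr_ge0//; lra.
have : X ^+ 2 * (r ^+ 2 / 4) <= X ^+ 2 * (16 * (1 + r) * T).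
  apply: le_trans h3 (le_trans h2 (le_trans h4 _)).
  by rewrite le_eqVlt; apply/orP; left; apply/eqP; ring.
rewrite ler_pM2l// => h5.
have : r * (2 * normc z + 1) + r * (128 * T) = r ^+ 2 by rewrite -mulrDr -rE.
have : 0 <= r * normc z by rewrite mulr_ge0//; lra.
have : T <= r * T by rewrite ler_peMl.
lra.
Qed.

End IdentityLiouville.

(** * Gluing two half-plane functions *)

Section HalfPlanes.
Context {R : realType}.
Implicit Types (b r : R) (t u w z : R[i]).

Definition hplane b r (t : R[i]) : Prop := b <= complex.Re t /\ normc t <= r.

Lemma Re_inv_gt0 u : 0 < complex.Re u -> 0 < complex.Re u^-1.
Proof.
move=> u0; rewrite Re_inv divr_gt0// exprn_gt0// (lt_le_trans u0)//.
by apply: le_trans (ler_norm _) (ler_normc_Re _).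
Qed.

Lemma Re_gt0_neq0 u : 0 < complex.Re u -> u != 0.
Proof. by apply: contraTneq => ->; rewrite ltxx. Qed.

Lemma Re_le_normc u : complex.Re u <= normc u.
Proof. exact: le_trans (ler_norm _) (ler_normc_Re _). Qed.

Variables (G L : R[i] -> R[i]) (k : nat) (C : R).
Hypothesis hG : forall b r, 0 < b -> exists G', hol (hplane b r) G G'.
Hypothesis G2 : forall w, 0 < complex.Re w -> w * G w ^+ 2 = 1.
Hypothesis hL : forall b r, -1 < b -> exists L', hol (hplane b r) L L'.
Hypothesis bL : forall t, -1 < complex.Re t -> complex.Re t <= 1 ->
  normc (L t) ^+ 2 * (1 + complex.Re t) ^+ k.+1 <= C.

(** For [G w] the square root of [1 / w] and [t = 1 / u - 1], the
    normalisation for which the duality [w = 1 / t] between two transforms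
    reads [u = 1 - u'] without any remaining factor. *)
Definition psi (u : R[i]) := L (u^-1 - 1) * G u^-1 * u^-1 ^+ k.+1.

Lemma hol_psi b r : 0 < b -> 0 < r -> exists f', hol (hplane b r) psi f'.
Proof.
move=> b0 r0.
have up p : hplane b r p -> 0 < normc p.
  by move=> [bp _]; apply: lt_le_trans b0 _; exact: le_trans bp (Re_le_normc _).
have hi : hol (hplane b r) (fun u => u^-1) (fun u => - u^-1 ^+ 2).
  by apply: hol_inv b0 _ => p [bp _]; exact: le_trans bp (Re_le_normc _).
have pi0 p : hplane b r p -> hplane (b / r ^+ 2) b^-1 p^-1.
  move=> pH; have n0 := up _ pH; have [bp pr] := pH; split.
    rewrite Re_inv; apply: ler_pM => //; first exact: ltW.
      by rewrite invr_ge0 sqr_ge0.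
    by rewrite lef_pV2 ?posrE ?exprn_gt0// lerXn2r// nnegrE ltW.
  by rewrite normcV lef_pV2 ?posrE//; exact: le_trans bp (Re_le_normc _).
have [G' hG'] := hG b^-1 (divr_gt0 b0 (exprn_gt0 2 r0)).
have br1 : -1 < b / r ^+ 2 - 1 by rewrite ltrBrDr addNr divr_gt0// exprn_gt0.
have [L' hL'] := hL (b^-1 + 1) br1.
have pi1 p : hplane b r p -> hplane (b / r ^+ 2 - 1) (b^-1 + 1) (1 * p^-1 + (-1)).
  move=> /pi0[h1 h2]; rewrite mul1r; split; first by rewrite Re_sub /= lerD2r.
  by apply: le_trans (le_normcB _ _) _; rewrite normc1 lerD2r.
have ha : hol (hplane (b / r ^+ 2) b^-1) (fun p => 1 * p + (-1)) (fun=> 1).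
  by apply: (@hol_affine _ _ b^-1) => p [].
have hm m : exists f', hol (hplane b r) (fun u => u^-1 ^+ m) f'.
  elim: m => [|m [g' hg']]; first by eexists; exact: hol_cst.
  by eexists; apply: hol_ext (hol_mul hi hg') => // p _; rewrite exprS.
have [f' hf'] := hm k.+1.
eexists; apply: hol_ext (hol_mul (hol_mul (hol_comp pi1 (hol_comp pi0 hi ha) hL')
  (hol_comp pi0 hi hG')) hf') => // p _.
by rewrite /psi /= mul1r.
Qed.

(** The bound on [L] is the blow-up rate at real part -1; in the variable
    [u] it becomes a growth of order [|u|^(1/2)]. *)
Lemma normc_psi u : 1 / 2 <= complex.Re u ->
  normc (psi u) ^+ 2 * complex.Re u ^+ k.+1 <= C * normc u.
Proof.
move=> u2; have u0 : 0 < complex.Re u by lra.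
have n0 : 0 < normc u by exact: lt_le_trans (Re_le_normc _).
have ru := Re_le_normc u.
have t1 : 0 < complex.Re u^-1 := Re_inv_gt0 u0.
have t2 : complex.Re u^-1 <= 2.
  rewrite Re_inv ler_pdivrMr ?exprn_gt0//.
  have : complex.Re u ^+ 2 <= normc u ^+ 2 by rewrite lerXn2r ?nnegrE ?(ltW u0) ?(ltW n0).
  nra.
have := bL (t := u^-1 - 1); rewrite Re_sub /= => /(_ ltac:(lra) ltac:(lra)).
rewrite addrCA subrr addr0 Re_inv => h.
have Gn : normc (G u^-1) ^+ 2 = normc u.
  have := G2 t1 => /(congr1 (@normc R)); rewrite normc1 normcM normcX normcV => e.
  by rewrite -[LHS]mul1r -(mulfV (lt0r_neq0 n0)) -mulrA e mulr1.
rewrite /psi !normcM !exprMn Gn normcX normcV.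
move: h; rewrite expr_div_n -!exprM mulnC exprM => h.
rewrite (_ : _ * complex.Re u ^+ k.+1 =
  (normc (L (u^-1 - 1)) ^+ 2 * (complex.Re u ^+ k.+1 / (normc u ^+ k.+1) ^+ 2)) * normc u).
  by rewrite ler_pM2r.
by rewrite [((normc u)^-1 ^+ (_ * _))%R]exprM !exprVn -exprM mulnC exprM; ring.
Qed.

End HalfPlanes.

Section TwoHalfPlanes.
Context {R : realType}.
Implicit Types (b r : R) (t u w z : R[i]).
Variables (G L1 L2 : R[i] -> R[i]) (k : nat) (C : R) (kap : R[i]).
Hypothesis hG : forall b r, 0 < b -> exists G', hol (hplane b r) G G'.
Hypothesis G2 : forall w, 0 < complex.Re w -> w * G w ^+ 2 = 1.
Hypothesis GD : forall w, 0 < complex.Re w -> G (1 + w) = G w * G (1 + w^-1).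
Hypothesis hL1 : forall b r, -1 < b -> exists L', hol (hplane b r) L1 L'.
Hypothesis hL2 : forall b r, -1 < b -> exists L', hol (hplane b r) L2 L'.
Hypothesis bL1 : forall t, -1 < complex.Re t -> complex.Re t <= 1 ->
  normc (L1 t) ^+ 2 * (1 + complex.Re t) ^+ k.+1 <= C.
Hypothesis bL2 : forall t, -1 < complex.Re t -> complex.Re t <= 1 ->
  normc (L2 t) ^+ 2 * (1 + complex.Re t) ^+ k.+1 <= C.
Hypothesis kap0 : kap != 0.
Hypothesis L12 : forall w, 0 < complex.Re w ->
  L2 w = kap * w^-1 ^+ k * G w * L1 w^-1.

Let psi1 u := psi G L1 k u.
Let psi2 u := kap^-1 * psi G L2 k (1 - u).

Let hol_psi2 b r : b < 1 -> 0 < r -> exists f', hol (fun u => complex.Re u <= b /\ normc u <= r) psi2 f'.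
Proof.
move=> b1 r0; have b0 : 0 < 1 - b by lra.
have r10 : 0 < r + 1 by lra.
have [f' hf'] := hol_psi k hG hL2 b0 r10.
pose D u := complex.Re u <= b /\ normc u <= r.
have ha : hol D (fun p => -1 * p + 1) (fun=> -1).
  by apply: (@hol_affine _ _ r) => p [].
have h1 p : D p -> hplane (1 - b) (r + 1) (-1 * p + 1).
  move=> [pb pr]; split; first by rewrite mulN1r Re_add Re_opp /=; lra.
  apply: le_trans (le_normcD _ _) _; rewrite normc1 mulN1r normcN; lra.
eexists; apply: hol_ext (hol_mul (hol_cst _ kap^-1) (hol_comp h1 ha hf')) => // p _.
by rewrite /psi2 /= mulN1r [- p + 1]addrC.
Qed.

(** The condition on [u] means that [1 / u - 1] has positive real part, which
    is where the relation between [L1] and [L2] is available. *)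
Let psi12_disc u : normc (u - (1 / 2)%:C) < 1 / 2 -> psi1 u = psi2 u.
Proof.
move=> u2.
have nu : normc u ^+ 2 < complex.Re u.
  have : normc (u - (1 / 2)%:C) ^+ 2 < (1 / 2) ^+ 2 by rewrite ltr_pXn2r ?nnegrE ?normc_ge0//; lra.
  rewrite !normcE2 Re_sub Im_sub /= subr0 => h; nra.
have u0 : 0 < complex.Re u by apply: le_lt_trans nu; exact: sqr_ge0.
have un0 := Re_gt0_neq0 u0.
have n0 : 0 < normc u by rewrite normc_gt0.
have t0 : 0 < complex.Re (u^-1 - 1).
  by rewrite Re_sub /= subr_gt0 Re_inv ltr_pdivlMr ?exprn_gt0// mul1r.
have w0 := Re_inv_gt0 t0; set w := (u^-1 - 1)^-1 in w0.
have wn0 := Re_gt0_neq0 w0.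
have wV : w^-1 = u^-1 - 1 by rewrite invrK.
have u1 : 1 - u != 0.
  have := Re_gt0_neq0 t0; apply: contra_neq => /subr0_eq <-.
  by rewrite invr1 subrr.
have wE : (1 - u)^-1 = 1 + w.
  have -> : w = u / (1 - u) by rewrite /w (_ : u^-1 - 1 = (1 - u) / u) ?invf_div//; field.
  by rewrite -{2}(divff u1) -mulrDl subrK mul1r.
have w1 : w * (1 - u) = u.
  have : (1 + w) * (1 - u) = 1 by rewrite -wE mulVf.
  by rewrite mulrDl mul1r => h; apply: (addrI (1 - u)); rewrite h subrK.
rewrite /psi2 /psi1 /psi wE [1 + w - 1]addrAC subrr add0r L12// GD// wV.
rewrite [1 + (_ - 1)]addrCA subrr addr0.
have Gw : G w ^+ 2 = w^-1 by rewrite -[LHS]mul1r -(mulVf wn0) -mulrA G2// mulr1.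
rewrite -wE -wV.
transitivity (w^-1 ^+ k * (G w ^+ 2) * (L1 w^-1 * G u^-1) * (1 - u)^-1 ^+ k.+1); last by field.
rewrite [u^-1 ^+ k.+1](_ : _ = w^-1 ^+ k.+1 * (1 - u)^-1 ^+ k.+1); last first.
  by rewrite -exprMn -invfM w1.
rewrite Gw -(exprSr w^-1 k).
move: (w^-1 ^+ k.+1) ((1 - u)^-1 ^+ k.+1) (L1 _) (G _) => X Y Z T; ring.
Qed.

(** Propagation of the identity from the disc centred at [1 / 2] along
    overlapping discs centred on the line of real part [1 / 2]. *)
Let psi12_strip u : 1 / 4 <= complex.Re u <= 3 / 4 -> psi1 u = psi2 u.
Proof.
move=> /andP[u1 u2].
pose a (s : R) (n : nat) : R[i] := (1 / 2) +i* (s * (n%:R / 4)).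
(* discs of radius just below 1 / 2 with centres 1 / 4 apart cover the strip,
   and consecutive discs overlap around each centre *)
pose rr : R := 12 / 25.
have rr0 : 0 < rr by rewrite /rr; lra.
have hd s n : exists f', hol (cdisc (a s n) rr) (fun u => psi1 u - psi2 u) f'.
  pose r := rr + normc (a s n).
  have r0 : 0 < r by rewrite ltr_wpDr ?normc_ge0.
  have sub p : cdisc (a s n) rr p -> [/\ 1 / 50 <= complex.Re p, complex.Re p <= 49 / 50 & normc p <= r].
    rewrite /cdisc => h; have := le_trans (ler_normc_Re _) h.
    rewrite Re_sub /= ler_norml /rr => /andP[h1 h2]; split; [lra|lra|].
    by rewrite -(subrK (a s n) p); apply: le_trans (le_normcD _ _) _; rewrite lerD2r.
  have [f1 hf1] := @hol_psi _ _ _ k hG hL1 (1 / 50) r ltac:(lra) r0.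
  have [f2 hf2] := @hol_psi2 (49 / 50) r ltac:(lra) r0.
  have hf2' : hol (cdisc (a s n) rr) psi2 f2 by apply: hol_sub hf2 => p /sub[].
  have hf1' : hol (cdisc (a s n) rr) psi1 f1 by apply: hol_sub hf1 => p /sub[].
  by eexists; exact: hol_subtract hf1' hf2'.
have chain s n : s = 1 \/ s = -1 -> forall p, normc (p - a s n) < rr -> psi1 p - psi2 p = 0.
  move=> s1; elim: n => [|n IH] p pn.
    rewrite psi12_disc ?subrr//; move: pn; rewrite /a /rr mul0r mulr0 => pn.
    by apply: lt_trans pn _; lra.
  have [f' hf'] := hd s n.+1.
  apply: (identity_disc (e := 1 / 5) hf' rr0 ltac:(lra) _ pn) => q q1 _.
  apply: IH; rewrite -(subrK (a s n.+1) q) -addrA; apply: le_lt_trans (le_normcD _ _) _.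
  have -> : normc (a s n.+1 - a s n) = 1 / 4.
    have -> : a s n.+1 - a s n = (s / 4)%:C * (0 +i* 1).
      by apply: complex_ext; rewrite ?Re_sub ?Im_sub ?Re_mul ?Im_mul /= -?natr1; ring.
    rewrite normcM normc_real normrM normrV ?unitfE// (_ : normc _ = 1).
      by case: s1 => ->; rewrite ?normrN normr1 ger0_norm// mulr1 mul1r.
    by rewrite /normc expr0n add0r expr1n sqrtr1.
  by rewrite /rr; lra.
set y := complex.Im u.
pose s : R := if 0 <= y then 1 else -1.
have s1 : s = 1 \/ s = -1 by rewrite /s; case: ifP => _; [left|right].
pose n := Num.truncn (4 * `|y|).
have sy : y = s * `|y|.
  rewrite /s; case: ifPn => h; first by rewrite mul1r ger0_norm.
  by rewrite mulN1r ltr0_norm ?opprK// ltNge.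
have := truncn_itv (_ : 0 <= 4 * `|y|); rewrite mulr_ge0// => /(_ isT)/andP[n1 n2].
apply/eqP; rewrite -subr_eq0; apply/eqP; apply: (chain s n s1).
rewrite -(ltr_pXn2r (n := 2)) ?nnegrE ?normc_ge0 ?(ltW rr0)// normcE2 Re_sub Im_sub /=.
rewrite -/y sy -mulrBr exprMn.
have -> : s ^+ 2 = 1 by case: s1 => ->; rewrite ?sqrrN expr1n.
have m1 : n%:R <= 4 * `|y| := n1.
have m2 : 4 * `|y| < n%:R + 1 by rewrite natr1.
rewrite /rr; nra.
Qed.

(** The two functions agree on a strip and glue to an entire function of
    order [|u|^(1/2)]. *)
Lemma psi_constant : exists c : R[i],
  (forall u, 1 / 2 <= complex.Re u -> psi G L1 k u = c) /\
  (forall u, complex.Re u <= 1 / 2 -> kap^-1 * psi G L2 k (1 - u) = c).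
Proof.
pose S (u : R[i]) := 1 / 2 <= complex.Re u.
pose F u := if S u then psi1 u else psi2 u.
have F1 u : 1 / 4 <= complex.Re u -> F u = psi1 u.
  move=> u1; rewrite /F /S; case: ifPn => //; rewrite -ltNge => u2.
  by rewrite psi12_strip// u1 /=; lra.
have F2 u : complex.Re u <= 3 / 4 -> F u = psi2 u.
  move=> u1; rewrite /F /S; case: ifPn => // u2.
  by rewrite psi12_strip// u1 andbT; lra.
have hF r : exists f', hol (cdisc 0 r) F f'.
  pose r' := `|r| + 1.
  have r0 : 0 < r' by rewrite ltr_wpDl.
  have rr' : r <= r' by rewrite /r'; have := ler_norm r; lra.
  have [f1 hf1] := @hol_psi _ _ _ k hG hL1 (1 / 4) r' ltac:(lra) r0.
  have [f2 hf2] := @hol_psi2 (3 / 4) r' ltac:(lra) r0.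
  pose D1 := hplane (1 / 4 : R) r'.
  pose D2 (u : R[i]) := complex.Re u <= 3 / 4 /\ normc u <= r'.
  eexists; apply: (@hol_glue _ _ D1 D2 S _ _ _ (1 / 4)); first lra.
  - move=> p q; rewrite /cdisc !subr0 => pr qr /(le_trans (ler_normc_Re _)).
    rewrite Re_sub ler_norml /S => /andP[h1 h2] Sp.
    by split; split; lra.
  - move=> p q; rewrite /cdisc !subr0 => pr qr /(le_trans (ler_normc_Re _)).
    rewrite Re_sub ler_norml /S -ltNge => /andP[h1 h2] Sp.
    by split; split; lra.
  - by apply: hol_ext hf1 => // p [p1 _]; rewrite F1.
  - by apply: hol_ext hf2 => // p [p1 _]; rewrite F2.
have C0 : 0 <= C.
  have h0 : -1 < complex.Re (0 : R[i]) by rewrite /= ltrN10.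
  have h1 : complex.Re (0 : R[i]) <= 1 by rewrite /= ler01.
  by apply: le_trans (bL1 h0 h1); rewrite mulr_ge0 ?sqr_ge0 ?exprn_ge0//= addr0.
have half (L : R[i] -> R[i]) : (forall t, -1 < complex.Re t -> complex.Re t <= 1 ->
    normc (L t) ^+ 2 * (1 + complex.Re t) ^+ k.+1 <= C) -> forall u, 1 / 2 <= complex.Re u ->
    normc (psi G L k u) ^+ 2 <= C * 2 ^+ k.+1 * normc u.
  move=> bL u u2; have h := normc_psi G2 bL u2.
  have p0 : 0 < (1 / 2) ^+ k.+1 :> R by rewrite exprn_gt0//; lra.
  have : (1 / 2) ^+ k.+1 <= complex.Re u ^+ k.+1.
    by apply: lerXn2r => //; rewrite nnegrE; lra.
  move=> /(ler_wpM2l (sqr_ge0 (normc (psi G L k u)))) /le_trans/(_ h).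
  by rewrite expr_div_n expr1n mulrA mulr1 ler_pdivrMr ?exprn_gt0// mulrAC.
pose K := C * 2 ^+ k.+1.
have K0 : 0 <= K by rewrite mulr_ge0// exprn_ge0.
have bF u : normc (F u) ^+ 2 <= (K + normc kap^-1 ^+ 2 * K * 2) * (1 + normc u).
  have [u2|u2] := leP (1 / 2) (complex.Re u).
    rewrite F1; last lra.
    have h := half _ bL1 _ u2; apply: le_trans h _; rewrite -/K.
    apply: ler_pM; rewrite ?normc_ge0//; last by rewrite lerDr.
    by rewrite lerDl mulr_ge0// mulr_ge0// sqr_ge0.
  rewrite F2; last lra.
  have u2' : 1 / 2 <= complex.Re (1 - u) by rewrite Re_sub /=; lra.
  have h := half _ bL2 _ u2'.
  rewrite /psi2 normcM exprMn mulrDl; apply: le_trans (ler_wpM2l (sqr_ge0 _) h) _.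
  rewrite -/K; have n1 : normc (1 - u) <= 1 + normc u.
    by apply: le_trans (le_normcB _ _) _; rewrite normc1.
  have : normc kap^-1 ^+ 2 * (K * normc (1 - u)) <= normc kap^-1 ^+ 2 * (K * (1 + normc u)).
    by rewrite ler_wpM2l ?sqr_ge0// ler_wpM2l.
  have : 0 <= K * (1 + normc u) by rewrite mulr_ge0// addr_ge0 ?normc_ge0.
  have : 0 <= normc kap^-1 ^+ 2 * (K * (1 + normc u)).
    by rewrite mulr_ge0 ?sqr_ge0// mulr_ge0// addr_ge0 ?normc_ge0.
  by rewrite -!mulrA [_ * (2 * _)]mulrCA; lra.
have FE := liouville hF bF.
exists (F 0); split=> u u2; first by rewrite -(FE u) F1//; lra.
by rewrite -(FE u) F2//; lra.
Qed.

End TwoHalfPlanes.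

(** * Complex-valued integrals *)

Section ComplexIntegral.
Context d (T : measurableType d) {R : realType} (mu : {measure set T -> \bar R}).
Implicit Types (f g : T -> R[i]) (a b : T -> R).

Definition cmeas f := measurable_fun setT (fun x => complex.Re (f x)) /\
  measurable_fun setT (fun x => complex.Im (f x)).

Definition rintegrable a := mu.-integrable setT (EFin \o a).

Definition cintegrable f := rintegrable (fun x => complex.Re (f x)) /\
  rintegrable (fun x => complex.Im (f x)).

Definition cint f : R[i] :=
  (\int[mu]_x complex.Re (f x)) +i* (\int[mu]_x complex.Im (f x)).

Lemma cmeas_real a : measurable_fun setT a -> cmeas (fun x => (a x)%:C).
Proof. by move=> ma; split => //=; exact: measurable_cst. Qed.

Lemma cmeas_cst (c : R[i]) : cmeas (fun=> c).
Proof. by split; exact: measurable_cst. Qed.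

Lemma cmeasD f g : cmeas f -> cmeas g -> cmeas (fun x => f x + g x).
Proof.
move=> [f1 f2] [g1 g2]; split.
  by apply: eq_measurable_fun (measurable_funD f1 g1) => x _; rewrite Re_add.
by apply: eq_measurable_fun (measurable_funD f2 g2) => x _; rewrite Im_add.
Qed.

Lemma cmeasM f g : cmeas f -> cmeas g -> cmeas (fun x => f x * g x).
Proof.
move=> [f1 f2] [g1 g2]; split.
  apply: eq_measurable_fun (measurable_funB (measurable_funM f1 g1) (measurable_funM f2 g2)).
  by move=> x _; rewrite Re_mul.
apply: eq_measurable_fun (measurable_funD (measurable_funM f1 g2) (measurable_funM f2 g1)).
by move=> x _; rewrite Im_mul.
Qed.

Lemma cmeasN f : cmeas f -> cmeas (fun x => - f x).
Proof.
move=> [f1 f2]; split.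
  by apply: eq_measurable_fun (measurable_funN f1) => x _; rewrite Re_opp.
by apply: eq_measurable_fun (measurable_funN f2) => x _; rewrite Im_opp.
Qed.

Lemma cmeasB f g : cmeas f -> cmeas g -> cmeas (fun x => f x - g x).
Proof. by move=> mf mg; apply: cmeasD => //; exact: cmeasN. Qed.

Lemma measurable_normc f : cmeas f -> measurable_fun setT (fun x => normc (f x)).
Proof.
move=> [f1 f2].
have m : measurable_fun setT (fun x => complex.Re (f x) ^+ 2 + complex.Im (f x) ^+ 2).
  by apply: measurable_funD; exact: measurable_funX.
apply: eq_measurable_fun (measurableT_comp (continuous_measurable_fun (@sqrt_continuous R)) m).
by move=> x _ /=; case: (f x).
Qed.

Lemma cmeas_exp f : cmeas f -> cmeas (fun x => cexp (f x)).
Proof.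
move=> [f1 f2]; have me := measurableT_comp (@measurable_expR R) f1; split.
  have m := measurableT_comp (continuous_measurable_fun (@continuous_cos R)) f2.
  by apply: eq_measurable_fun (measurable_funM me m) => x _; rewrite Re_cexp.
have m := measurableT_comp (continuous_measurable_fun (@continuous_sin R)) f2.
by apply: eq_measurable_fun (measurable_funM me m) => x _; rewrite Im_cexp.
Qed.

Lemma rintegrable_le a b : measurable_fun setT a -> rintegrable b ->
  (forall x, `|a x| <= b x) -> rintegrable a.
Proof.
move=> ma ib ab; apply: le_integrable ib => //; first exact/measurable_EFinP.
by move=> x _ /=; rewrite lee_fin (le_trans (ab x))// ler_norm.
Qed.

Lemma rintegrable_meas a : rintegrable a -> measurable_fun setT a.
Proof. by move=> /integrableP[/measurable_EFinP]. Qed.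

Lemma rintegrableZ (k : R) a : rintegrable a -> rintegrable (fun x => k * a x).
Proof. by move=> /(integrableZl measurableT k); apply: eq_integrable. Qed.

Lemma rintegrableD a b : rintegrable a -> rintegrable b -> rintegrable (fun x => a x + b x).
Proof. by move=> ia /(integrableD measurableT ia); apply: eq_integrable. Qed.

Lemma rintegrable_norm a : rintegrable a -> rintegrable (fun x => `|a x|).
Proof. by move=> ia; apply: integrable_norm. Qed.

Lemma cintegrable_meas f : cintegrable f -> cmeas f.
Proof. by move=> [/rintegrable_meas ? /rintegrable_meas]. Qed.

Lemma cintegrable_le f b : cmeas f -> rintegrable b ->
  (forall x, normc (f x) <= b x) -> cintegrable f.
Proof.
move=> [f1 f2] ib fb; split; apply: rintegrable_le ib _ => // x.
  exact: le_trans (ler_normc_Re _) (fb x).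
exact: le_trans (ler_normc_Im _) (fb x).
Qed.

Lemma rintegrable_normc f : cintegrable f -> rintegrable (fun x => normc (f x)).
Proof.
move=> fi; have fm := measurable_normc (cintegrable_meas fi); case: fi => f1 f2.
apply: rintegrable_le (rintegrableD (rintegrable_norm f1) (rintegrable_norm f2)) _ => //.
by move=> x; rewrite ger0_norm ?normc_ge0//; exact: normc_le_ReIm.
Qed.

Lemma cintD f g : cintegrable f -> cintegrable g ->
  cint (fun x => f x + g x) = cint f + cint g.
Proof.
move=> [f1 f2] [g1 g2]; apply: complex_ext; rewrite ?Re_add ?Im_add /=.
  by rewrite -RintegralD//; apply: eq_Rintegral => x _; rewrite Re_add.
by rewrite -RintegralD//; apply: eq_Rintegral => x _; rewrite Im_add.
Qed.

Lemma cintegrableD f g : cintegrable f -> cintegrable g ->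
  cintegrable (fun x => f x + g x).
Proof.
move=> [f1 f2] [g1 g2]; split.
  by apply: eq_integrable (rintegrableD f1 g1) => // x _ /=; rewrite Re_add.
by apply: eq_integrable (rintegrableD f2 g2) => // x _ /=; rewrite Im_add.
Qed.

Lemma cintegrableZ (c : R[i]) f : cintegrable f -> cintegrable (fun x => c * f x).
Proof.
move=> fi; apply: (cintegrable_le (b := fun x => normc c * normc (f x))).
- by apply: cmeasM; [exact: cmeas_cst|exact: cintegrable_meas].
- exact/rintegrableZ/rintegrable_normc.
- by move=> x; rewrite normcM.
Qed.

Lemma cintZ (c : R[i]) f : cintegrable f -> cint (fun x => c * f x) = c * cint f.
Proof.
move=> [f1 f2]; apply: complex_ext; rewrite ?Re_mul ?Im_mul /=.
  rewrite -!RintegralZl// -RintegralB//; try exact: rintegrableZ.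
  by apply: eq_Rintegral => x _; rewrite Re_mul.
rewrite -!RintegralZl// -RintegralD//; try exact: rintegrableZ.
by apply: eq_Rintegral => x _; rewrite Im_mul.
Qed.

Lemma eq_cint f g : f =1 g -> cint f = cint g.
Proof. by move=> fg; congr (_ +i* _); apply: eq_Rintegral => x _; rewrite fg. Qed.

Lemma eq_cintegrable f g : f =1 g -> cintegrable f -> cintegrable g.
Proof. by move=> fg; rewrite (_ : g = f)//; apply/funext => x; rewrite fg. Qed.

Lemma cintegrableB f g : cintegrable f -> cintegrable g ->
  cintegrable (fun x => f x - g x).
Proof.
move=> fi gi; apply: eq_cintegrable (cintegrableD fi (cintegrableZ (-1) gi)).
by move=> x; rewrite mulN1r.
Qed.

Lemma cintB f g : cintegrable f -> cintegrable g ->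
  cint (fun x => f x - g x) = cint f - cint g.
Proof.
move=> fi gi; rewrite -[- cint g]mulN1r -cintZ// -cintD//; last exact: cintegrableZ.
by apply: eq_cint => x; rewrite mulN1r.
Qed.

Lemma cint_real a : cint (fun x => (a x)%:C) = (\int[mu]_x a x)%:C.
Proof. by congr (_ +i* _); rewrite /= Rintegral_cst// mul0r. Qed.

Lemma Re_cint f : complex.Re (cint f) = \int[mu]_x complex.Re (f x).
Proof. by []. Qed.

Lemma normc_cint f : cintegrable f -> normc (cint f) <= \int[mu]_x normc (f x).
Proof.
move=> fi; have [->|c0] := eqVneq (cint f) 0.
  by rewrite normc0 Rintegral_ge0// => x _; exact: normc_ge0.
have n0 : 0 < normc (cint f) by rewrite normc_gt0.
(* rotate the integral onto the positive axis *)
pose u : R[i] := (cint f)^*%C * (normc (cint f))^-1%:C.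
have nJ z : normc (z^*)%C = normc z :> R by case: z => x y /=; rewrite sqrrN.
have uE : u * cint f = (normc (cint f))%:C.
  have -> : u * cint f = ((cint f)^*%C * cint f) * (normc (cint f))^-1%:C by rewrite /u; ring.
  have -> : ((cint f)^*)%C * cint f = (normc (cint f) ^+ 2)%:C.
    by rewrite normcE2; case: (cint f) => x y; apply: complex_ext; rewrite ?Re_mul ?Im_mul /=; ring.
  by rewrite -rmorphM expr2 -mulrA mulfV ?mulr1// gt_eqF.
have nu : normc u = 1.
  by rewrite normcM normc_real nJ normrV ?unitfE ?gt_eqF// ger0_norm ?normc_ge0// mulfV// gt_eqF.
rewrite -[leLHS]/(complex.Re ((normc (cint f))%:C)) -uE -cintZ//.
rewrite Re_cint; apply: le_Rintegral => //; first exact: (cintegrableZ u fi).1.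
  exact: rintegrable_normc.
move=> x _; apply: le_trans (ler_norm _) _; apply: le_trans (ler_normc_Re _) _.
by rewrite normcM nu mul1r.
Qed.

Lemma normc_cint_le f b : cmeas f -> rintegrable b -> (forall x, normc (f x) <= b x) ->
  normc (cint f) <= \int[mu]_x b x.
Proof.
move=> mf ib fb; have fi := cintegrable_le mf ib fb.
apply: le_trans (normc_cint fi) _; apply: le_Rintegral => //.
exact: rintegrable_normc.
Qed.

(** Passage from Tonelli's theorem, stated with extended reals, to
    integrability and real integrals. *)
Lemma rintegrable_ge0 a (c : R) : measurable_fun setT a -> (forall x, 0 <= a x) ->
  (\int[mu]_x (a x)%:E <= c%:E)%E -> rintegrable a /\ \int[mu]_x a x <= c.
Proof.
move=> ma a0 ac; have ia : rintegrable a.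
  apply/integrableP; split; first exact/measurable_EFinP.
  under eq_integral do rewrite /= ger0_norm//.
  by rewrite (le_lt_trans ac)// ltry.
split => //; rewrite -lee_fin /Rintegral fineK//.
exact: integrable_fin_num.
Qed.

Lemma rintegrable_EFin a : rintegrable a ->
  (\int[mu]_x (a x)%:E)%E = (\int[mu]_x a x)%:E.
Proof. by move=> ia; rewrite /Rintegral fineK//; exact: integrable_fin_num. Qed.

End ComplexIntegral.

Section ComplexFubini.
Context d1 d2 (T1 : measurableType d1) (T2 : measurableType d2) {R : realType}.
Variables (m1 : {sigma_finite_measure set T1 -> \bar R})
  (m2 : {sigma_finite_measure set T2 -> \bar R}).

Lemma Rintegral_fubini (F : T1 * T2 -> R) (a : T1 -> R) (b : T2 -> R) :
  measurable_fun setT F -> rintegrable m1 a -> rintegrable m2 b ->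
  (forall x y, `|F (x, y)| <= a x * b y) ->
  \int[m1]_x (\int[m2]_y F (x, y)) = \int[m2]_y (\int[m1]_x F (x, y)).
Proof.
move=> mF ia ib Fab.
have i2 x : rintegrable m2 (fun y => F (x, y)).
  apply: rintegrable_le (rintegrableZ (a x) ib) (Fab x).
  exact: measurableT_comp mF (pair1_measurable x).
have i1 y : rintegrable m1 (fun x => F (x, y)).
  apply: rintegrable_le (rintegrableZ (b y) ia) _.
    exact: measurableT_comp mF (pair2_measurable y).
  by move=> x; rewrite mulrC.
have iF : (m1 \x m2)%E.-integrable setT (EFin \o F).
  apply/integrable12ltyP; first exact/measurable_EFinP.
  apply: (@le_lt_trans _ _ (\int[m1]_x \int[m2]_y ((`|a x| * `|b y|)%:E))%E).
    apply: ge0_le_integral => //.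
    - by move=> x _; exact: integral_ge0.
    - apply: (measurable_fun_fubini_tonelli_F (fun xy => `|(F xy)%:E|%E)) => //.
      by apply: measurableT_comp => //; exact/measurable_EFinP.
    - apply: (measurable_fun_fubini_tonelli_F (fun xy => (`|a xy.1| * `|b xy.2|)%:E)) => [|xy]; last first.
        by rewrite lee_fin mulr_ge0.
      apply/measurable_EFinP; apply: measurable_funM.
        by apply: measurableT_comp => //; apply: measurableT_comp (rintegrable_meas ia) _; exact: measurable_fst.
      by apply: measurableT_comp => //; apply: measurableT_comp (rintegrable_meas ib) _; exact: measurable_snd.
    move=> x _; apply: ge0_le_integral => //.
    - apply: measurableT_comp => //; apply/measurable_EFinP; exact: rintegrable_meas (i2 x).
    - apply/measurable_EFinP; apply: measurable_funM; first exact: measurable_cst.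
      by apply: measurableT_comp => //; exact: rintegrable_meas ib.
    - move=> y _; rewrite lee_fin (le_trans (Fab x y))// -normrM ler_norm//.
  have eb x : (\int[m2]_y (`|a x| * `|b y|)%:E = (`|a x| * \int[m2]_y `|b y|)%:E)%E.
    by rewrite (rintegrable_EFin (rintegrableZ _ (rintegrable_norm ib))) RintegralZl//; exact: rintegrable_norm.
  under eq_integral do rewrite eb mulrC.
  rewrite (rintegrable_EFin (rintegrableZ _ (rintegrable_norm ia))) ltry//.
have e1 x : (\int[m2]_y (F (x, y))%:E = (\int[m2]_y F (x, y))%:E)%E by exact: rintegrable_EFin.
have e2 y : (\int[m1]_x (F (x, y))%:E = (\int[m1]_x F (x, y))%:E)%E by exact: rintegrable_EFin.
rewrite /Rintegral; congr fine.
transitivity (\int[m1]_x \int[m2]_y (F (x, y))%:E)%E.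
  by apply: eq_integral => x _; rewrite -e1.
by rewrite (Fubini iF); apply: eq_integral => y _; rewrite -e2.
Qed.

Lemma cint_fubini (F : T1 * T2 -> R[i]) (a : T1 -> R) (b : T2 -> R) :
  cmeas F -> rintegrable m1 a -> rintegrable m2 b ->
  (forall x y, normc (F (x, y)) <= a x * b y) ->
  cint m1 (fun x => cint m2 (fun y => F (x, y))) =
  cint m2 (fun y => cint m1 (fun x => F (x, y))).
Proof.
move=> [F1 F2] ia ib Fab; congr (_ +i* _).
  apply: (@Rintegral_fubini (fun xy => complex.Re (F xy)) a b) => // x y.
  exact: le_trans (ler_normc_Re _) (Fab x y).
apply: (@Rintegral_fubini (fun xy => complex.Im (F xy)) a b) => // x y.
exact: le_trans (ler_normc_Im _) (Fab x y).
Qed.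

End ComplexFubini.

(** * Affine change of variables *)

Section ChangeOfVariable.
Context d1 d2 (T1 : measurableType d1) (T2 : measurableType d2) {R : realType}.
Variables (nu : {measure set T1 -> \bar R}) (mu : {measure set T2 -> \bar R}).
Variables (phi : T1 -> T2) (k : {nonneg R}).
Hypothesis mphi : measurable_fun setT phi.
Hypothesis mu_phi : forall A, measurable A -> mu A = (k%:num%:E * nu (phi @^-1` A))%E.

Lemma ge0_integral_change (f : T2 -> \bar R) : measurable_fun setT f ->
  (forall x, 0 <= f x)%E ->
  (\int[mu]_x f x = k%:num%:E * \int[nu]_x f (phi x))%E.
Proof.
move=> mf f0.
pose push : {measure set T2 -> \bar R} :=
  measure_function_pushforward__canonical__measure_function_Measure nu mphi.
rewrite (eq_measure_integral (mscale k push)); last by move=> A mA _; exact: mu_phi.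
rewrite ge0_integral_mscale// ge0_integral_pushforward// preimage_setT//.
Qed.

Hypothesis k_gt0 : 0 < k%:num.

(** The density [k] of the change of variables is kept explicit, so that
    dilations are covered as well as translations. *)
Lemma rintegrable_change (a : T2 -> R) : rintegrable mu a ->
  rintegrable nu (fun x => a (phi x)).
Proof.
move=> ia; have ma := rintegrable_meas ia.
apply/integrableP; split.
  by apply/measurable_EFinP; exact: measurableT_comp ma mphi.
have : (\int[mu]_x `|(a x)%:E| < +oo)%E by case/integrableP : ia.
rewrite (ge0_integral_change (f := fun x => `|(a x)%:E|%E))//; last first.
  by apply: measurableT_comp => //; exact/measurable_EFinP.
rewrite !ltNge; apply: contra; rewrite !leye_eq => /eqP h.
by rewrite (_ : (\int[nu]_x _)%E = +oo%E) ?gt0_muley.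
Qed.

Lemma Rintegral_change (a : T2 -> R) : rintegrable mu a ->
  \int[mu]_x a x = k%:num * \int[nu]_x a (phi x).
Proof.
move=> ia; have ia' := rintegrable_change ia.
have ma := rintegrable_meas ia.
have hp (f : T2 -> \bar R) : measurable_fun setT f -> (forall x, 0 <= f x)%E ->
    nu.-integrable setT (f \o phi) ->
    fine (\int[mu]_x f x) = k%:num * fine (\int[nu]_x f (phi x)).
  move=> mf f0 fi; rewrite ge0_integral_change// fineM//.
  exact: integrable_fin_num.
have m0 : measurable_fun setT (EFin \o a) by exact/measurable_EFinP.
have i1 : nu.-integrable setT ((EFin \o a)^\+%E \o phi).
  by rewrite -funepos_comp; exact: integrable_funepos.
have i2 : nu.-integrable setT ((EFin \o a)^\-%E \o phi).
  by rewrite -funeneg_comp; exact: integrable_funeneg.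
have j1 : (\int[mu]_x ((EFin \o a)^\+%E) x)%E \is a fin_num.
  by apply: integrable_fin_num => //; exact: integrable_funepos.
have j2 : (\int[mu]_x ((EFin \o a)^\-%E) x)%E \is a fin_num.
  by apply: integrable_fin_num => //; exact: integrable_funeneg.
have l1 := integrable_fin_num measurableT i1.
have l2 := integrable_fin_num measurableT i2.
have e1 := integralE mu setT (EFin \o a).
have e2 := integralE nu setT ((EFin \o a) \o phi).
rewrite funepos_comp funeneg_comp in e2.
have {e1}-> : \int[mu]_x a x = fine (\int[mu]_x (EFin \o a)^\+ x - \int[mu]_x (EFin \o a)^\- x)%E.
  by rewrite -e1.
have {e2}-> : \int[nu]_x a (phi x) = fine (\int[nu]_x ((EFin \o a)^\+ \o phi)%E x
    - \int[nu]_x ((EFin \o a)^\- \o phi)%E x)%E by rewrite -e2.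
rewrite (fineB j1 j2) (fineB l1 l2) mulrBr; congr (_ - _); apply: hp => //.
  exact: measurable_funepos.
exact: measurable_funeneg.
Qed.

Lemma cint_change (f : T2 -> R[i]) : cintegrable mu f ->
  cint mu f = (k%:num)%:C * cint nu (fun x => f (phi x)).
Proof.
move=> [f1 f2]; apply: complex_ext; rewrite ?Re_mul ?Im_mul /=.
  by rewrite mul0r subr0 Rintegral_change.
by rewrite mul0r addr0 Rintegral_change.
Qed.

End ChangeOfVariable.

Section LebesgueAffine.
Context {R : realType}.
Notation mu := (@lebesgue_measure R).

Lemma measurable_affine (a b : R) :
  measurable_fun setT ((fun x => a * x + b) : measurableTypeR R -> measurableTypeR R).
Proof. by apply: measurable_funD => //; exact: measurable_cst. Qed.

Lemma lebesgue_affine (a b : R) (a0 : 0 < a) (A : set (measurableTypeR R)) :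
  measurable A -> mu A = (a%:E * mu ((fun x => (a * x + b)%R) @^-1` A))%E.
Proof.
move=> mA.
pose k : {nonneg R} := NngNum (ltW a0).
pose push : {measure set (measurableTypeR R) -> \bar R} :=
  measure_function_pushforward__canonical__measure_function_Measure mu (measurable_affine a b).
rewrite (lebesgue_measure_unique (mu := mscale k push))//.
move=> _ [[x y] _ <-].
change (mu `]x, y] = (a%:E * mu ((fun z : R => (a * z + b)%R) @^-1` `]x, y]))%E).
rewrite [X in (_ * mu X)%E](_ : _ = `](x - b) / a, (y - b) / a]%classic); last first.
  apply/seteqP; split => z /=; rewrite !in_itv/= ltr_pdivrMr// ler_pdivlMr//.
    by rewrite ltrBlDr lerBrDr mulrC.
  by rewrite ltrBlDr lerBrDr mulrC.
rewrite !lebesgue_measure_itv/= !lte_fin ltr_pM2r ?invr_gt0// ltrD2r.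
case: ifPn => xy; last by rewrite mule0.
rewrite -EFinB -EFinM; congr EFin; field; exact: lt0r_neq0.
Qed.

End LebesgueAffine.

(** * Laplace transforms *)

Section HolConstant.
Context {R : realType}.
Implicit Types (D : R[i] -> Prop) (f g : R[i] -> R[i]).

Lemma le0_mul_small (x C : R) : (forall e, 0 < e -> x <= C * e) -> x <= 0.
Proof.
move=> h; rewrite leNgt; apply/negP => x0.
have C1 : 0 < `|C| + 1 by rewrite ltr_wpDl.
have := h (x / (2 * (`|C| + 1))); rewrite divr_gt0 ?mulr_gt0// => /(_ isT).
have -> : C * (x / (2 * (`|C| + 1))) = (C / (`|C| + 1)) * (x / 2).
  by field; rewrite gt_eqF.
have : C / (`|C| + 1) <= 1.
  by rewrite ler_pdivrMr// mul1r; have := ler_norm C; lra.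
have x2 : 0 < x / 2 by lra.
by rewrite -(ler_pM2r x2); lra.
Qed.

Lemma hol_der_unique D f f1 f2 p : hol D f f1 -> hol D f f2 -> D p ->
  (forall e : R, 0 < e -> exists q, [/\ D q, q != p & normc (q - p) <= e]) -> f1 p = f2 p.
Proof.
move=> [C C0 [d d0 [_ h1]]] [C' C'0 [d' d'0 [_ h2]]] Dp acc.
apply/eqP; rewrite -subr_eq0 -normc_eq0 eq_le normc_ge0 andbT.
apply: (@le0_mul_small _ (C + C')) => e e0.
have [q [Dq qp]] := acc (Num.min e (Num.min d d')) ltac:(by rewrite !lt_min e0 d0).
rewrite !le_min => /and3P[qe qd qd'].
have n0 : 0 < normc (q - p) by rewrite normc_gt0 subr_eq0.
have : normc ((f1 p - f2 p) * (q - p)) <= (C + C') * normc (q - p) ^+ 2.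
  rewrite (_ : _ * _ = (f q - f p - f2 p * (q - p)) - (f q - f p - f1 p * (q - p))); last by ring.
  by apply: le_trans (le_normcB _ _) _; rewrite mulrDl addrC; apply: lerD; [exact: h1|exact: h2].
rewrite normcM expr2 mulrA ler_pM2r// => h; apply: le_trans h _.
by rewrite ler_wpM2l// ltW// addr_gt0.
Qed.

(** A function taking the value [f p] again arbitrarily close to [p] has zero
    derivative at [p].  With invariance under a one-parameter group this
    replaces analytic continuation from the real axis. *)
Lemma hol_locally_repeating D D' f f' : hol D f f' -> cvx D' ->
  (forall p, D' p -> D p) ->
  (forall p, D' p -> forall e : R, 0 < e ->
     exists q, [/\ D q, q != p, normc (q - p) <= e & f q = f p]) ->
  forall p q, D' p -> D' q -> f p = f q.
Proof.
move=> [C C0 [d d0 [h1 h2]]] Dc sub acc.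
have f'0 p : D' p -> f' p = 0.
  move=> D'p; have Dp := sub _ D'p.
  apply/eqP; rewrite -normc_eq0 eq_le normc_ge0 andbT.
  apply: (@le0_mul_small _ C) => e e0.
  have [q [Dq qp]] := acc p D'p (Num.min e d) ltac:(by rewrite lt_min e0).
  rewrite le_min => /andP[qe qd] fqp.
  have n0 : 0 < normc (q - p) by rewrite normc_gt0 subr_eq0.
  have := h2 p q Dp Dq qd; rewrite fqp subrr sub0r normcN normcM expr2 mulrA ler_pM2r//.
  by move=> h; apply: le_trans h _; rewrite ler_wpM2l// ltW.
move=> p q Dp Dq; apply/esym/eqP; rewrite -subr_eq0 -normc_eq0 eq_le normc_ge0 andbT.
pose phi (t : R) := f (p + t%:C * (q - p)).
have -> : f q - f p = phi 1 - phi 0 by rewrite /phi mul1r mul0r addr0; congr (f _ - _); ring.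
have n0 := normc_ge0 (q - p).
apply: (@quadratic_increments _ _ _ (C * normc (q - p) ^+ 2) (d / (normc (q - p) + 1))).
- by rewrite mulr_ge0 ?sqr_ge0 ?ltW.
- by rewrite divr_gt0// ltr_wpDl.
move=> s t s0 st t1 std.
have Dt u : 0 <= u <= 1 -> D' (p + u%:C * (q - p)) by exact: Dc.
have sI : 0 <= s <= 1 by rewrite s0 ltW// (lt_le_trans st).
have tI : 0 <= t <= 1 by rewrite t1 ltW// (le_lt_trans s0).
have e1 : p + t%:C * (q - p) - (p + s%:C * (q - p)) = (t - s)%:C * (q - p).
  by rewrite rmorphB; ring.
have nd : normc (p + t%:C * (q - p) - (p + s%:C * (q - p))) = (t - s) * normc (q - p).
  by rewrite e1 normcM normc_real gtr0_norm ?subr_gt0.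
have := h2 _ _ (sub _ (Dt _ sI)) (sub _ (Dt _ tI)).
rewrite nd (f'0 _ (Dt _ sI)) !mul0r subr0 add0r exprMn => h.
apply: le_trans (h _) _; last by rewrite [in leRHS]mulrAC mulrA.
move: std; rewrite ler_pdivlMr ?ltr_wpDl// mulrDr mulr1.
have : 0 < t - s by rewrite subr_gt0.
lra.
Qed.

Lemma cvx_hplane (b r : R) : cvx (hplane b r).
Proof.
move=> p q t [pb pr] [qb qr] tI; split.
  have /andP[t0 t1] := tI; rewrite Re_add Re_mul Re_sub /= mul0r subr0.
  have h1 : (1 - t) * b <= (1 - t) * complex.Re p by rewrite ler_wpM2l ?subr_ge0.
  have h2 : t * b <= t * complex.Re q by rewrite ler_wpM2l.
  lra.
have := @cvx_cdisc _ 0 r p q t; rewrite /cdisc !subr0.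
by apply.
Qed.

End HolConstant.

Section Laplace.
Context d (T : measurableType d) {R : realType} (mu : {measure set T -> \bar R}).
Implicit Types (g : T -> R[i]) (q : T -> R) (z : R[i]).

Definition laplace g q z : R[i] :=
  cint mu (fun x => g x * cexp (- (z * (q x)%:C))).

Lemma abs_le_expR (e x : R) : 0 < e -> `|x| <= e^-1 * expR (e * `|x|).
Proof.
move=> e0; rewrite mulrC ler_pdivlMr// mulrC.
by have := expR_ge1Dx (e * `|x|); lra.
Qed.

Lemma sqr_le_expR (e x : R) : 0 < e -> x ^+ 2 <= 2 / e ^+ 2 * expR (e * `|x|).
Proof.
move=> e0; have ex : 0 <= e * `|x| by rewrite mulr_ge0// ltW.
have := expR_ge1Dxn 1 ex; rewrite (_ : 2`!%:R = 2 :> R)// => h.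
rewrite mulrAC ler_pdivlMr ?exprn_gt0// mulrC -[x ^+ 2]real_normK ?num_real//.
rewrite -exprMn; lra.
Qed.

Lemma laplace_meas g q z : cmeas g -> measurable_fun setT q ->
  cmeas (fun x => g x * cexp (- (z * (q x)%:C))).
Proof.
move=> mg mq; apply: cmeasM => //; apply: cmeas_exp; apply: cmeasN.
by apply: cmeasM; [exact: cmeas_cst|exact: cmeas_real].
Qed.

Lemma normc_laplace_kernel (z : R[i]) (y : R) :
  normc (cexp (- (z * y%:C))) = expR (- complex.Re z * y).
Proof. by rewrite normc_cexp Re_opp Re_mul /= mulr0 subr0 mulNr. Qed.

(** Differentiation under the integral sign, with the uniform quadratic
    remainder supplied by the Taylor bound of the exponential. *)
Lemma laplace_hol D g q (e : R) (G0 : T -> R) : 0 < e -> cmeas g ->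
  measurable_fun setT q -> rintegrable mu G0 ->
  (forall z x, D z -> normc (g x) * expR (- complex.Re z * q x + e * `|q x|) <= G0 x) ->
  hol D (laplace g q) (laplace (fun x => - (q x)%:C * g x) q).
Proof.
move=> e0 mg mq iG gG.
pose c := 1 + e^-1 + 32 / e ^+ 2.
pose I := \int[mu]_x `|G0 x|.
have I0 : 0 <= I by apply: Rintegral_ge0 => x _; exact: normr_ge0.
have ei : 0 < e^-1 by rewrite invr_gt0.
have e2 : 0 < 32 / e ^+ 2 by rewrite divr_gt0// exprn_gt0.
have iG' := rintegrable_norm iG.
have mg1 : cmeas (fun x => - (q x)%:C * g x).
  by apply: cmeasM => //; apply: cmeasN; exact: cmeas_real.
have gG' z x : D z -> normc (g x) * expR (- complex.Re z * q x) * expR (e * `|q x|) <= `|G0 x|.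
  by move=> Dz; rewrite -mulrA -expRD (le_trans (gG z x Dz))// ler_norm.
have b0 z x : D z -> normc (g x * cexp (- (z * (q x)%:C))) <= `|G0 x|.
  move=> Dz; apply: le_trans (gG' z x Dz); rewrite normcM normc_laplace_kernel.
  by rewrite ler_peMr ?mulr_ge0 ?normc_ge0 ?expR_ge0// -expR0 ler_expR mulr_ge0// ltW.
have b1 z x : D z -> normc (- (q x)%:C * g x * cexp (- (z * (q x)%:C))) <= e^-1 * `|G0 x|.
  move=> Dz; rewrite -mulrA normcM normcN normc_real.
  have := abs_le_expR (q x) e0 => h.
  apply: le_trans (ler_wpM2r (normc_ge0 _) h) _.
  rewrite -mulrA ler_wpM2l ?(ltW ei)//; apply: le_trans (gG' z x Dz).
  by rewrite normcM normc_laplace_kernel mulrC.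
have i0 z : D z -> cintegrable mu (fun x => g x * cexp (- (z * (q x)%:C))).
  by move=> Dz; apply: cintegrable_le iG' _; [exact: laplace_meas|move=> x; exact: b0].
have i1 z : D z -> cintegrable mu (fun x => - (q x)%:C * g x * cexp (- (z * (q x)%:C))).
  move=> Dz; apply: cintegrable_le (rintegrableZ e^-1 iG') _.
    exact: laplace_meas.
  by move=> x; exact: b1.
exists (c * I + 1); first by rewrite ltr_wpDl// mulr_ge0// /c; lra.
have cI : c * I = I + e^-1 * I + 32 / e ^+ 2 * I by rewrite /c; ring.
have h1 : 0 <= e^-1 * I by rewrite mulr_ge0// ltW.
have h2 : 0 <= 32 / e ^+ 2 * I by rewrite mulr_ge0// ltW.
exists (e / 2); first by rewrite divr_gt0.
split => [p Dp|p z Dp Dz pz].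
  split.
    have : normc (laplace g q p) <= I.
      by apply: normc_cint_le => //; [exact: laplace_meas|move=> x; exact: b0].
    lra.
  have : normc (laplace (fun x => - (q x)%:C * g x) q p) <= \int[mu]_x (e^-1 * `|G0 x|).
    apply: normc_cint_le; [exact: laplace_meas|exact: rintegrableZ|].
    by move=> x; exact: b1.
  by rewrite RintegralZl// -/I; lra.
have -> : laplace g q z - laplace g q p - laplace (fun x => - (q x)%:C * g x) q p * (z - p) =
  cint mu (fun x => g x * cexp (- (z * (q x)%:C)) - g x * cexp (- (p * (q x)%:C))
     - (z - p) * (- (q x)%:C * g x * cexp (- (p * (q x)%:C)))).
  rewrite cintB; [|by apply: cintegrableB; exact: i0|exact/cintegrableZ/i1].
  by rewrite cintB ?cintZ; [rewrite [_ * (z - p)]mulrC|exact: i1|exact: i0|exact: i0].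
have := @normc_cint_le _ _ _ mu (fun x => g x * cexp (- (z * (q x)%:C)) - g x * cexp (- (p * (q x)%:C))
     - (z - p) * (- (q x)%:C * g x * cexp (- (p * (q x)%:C))))
     (fun x => (32 / e ^+ 2 * normc (z - p) ^+ 2) * `|G0 x|).
have mm : cmeas (fun x => g x * cexp (- (z * (q x)%:C)) - g x * cexp (- (p * (q x)%:C))
     - (z - p) * (- (q x)%:C * g x * cexp (- (p * (q x)%:C)))).
  apply: cmeasB; first by apply: cmeasB; exact: laplace_meas.
  by apply: cmeasM; [exact: cmeas_cst|exact: laplace_meas].
move=> /(_ mm (rintegrableZ _ iG')); rewrite RintegralZl// -/I => h.
apply: le_trans (h _) _ => [x|]; last first.
  rewrite mulrAC ler_wpM2r ?sqr_ge0//; lra.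
set y := q x; set w := - ((z - p) * y%:C).
have -> : g x * cexp (- (z * y%:C)) - g x * cexp (- (p * y%:C))
     - (z - p) * (- y%:C * g x * cexp (- (p * y%:C))) =
   g x * cexp (- (p * y%:C)) * (cexp w - 1 - w).
  have -> : - (z * y%:C) = - (p * y%:C) + w by rewrite /w; ring.
  rewrite cexpD {3}/w; ring.
rewrite normcM normcM normc_laplace_kernel.
have hw := normc_cexp_taylor2 w.
have nw : normc w = normc (z - p) * `|y| by rewrite /w normcN normcM normc_real.
have rw : `|complex.Re w| <= e / 2 * `|y|.
  apply: le_trans (ler_normc_Re _) _; rewrite nw ler_wpM2r//.
have hy := sqr_le_expR y (divr_gt0 e0 (ltr0Sn R 1)).
set N := normc (z - p) ^+ 2.
have N0 : 0 <= N by exact: sqr_ge0.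
have {}hw : normc (cexp w - 1 - w) <= 32 / e ^+ 2 * N * expR (e * `|y|).
  apply: le_trans hw _; rewrite nw exprMn -/N real_normK ?num_real//.
  have -> : e * `|y| = e / 2 * `|y| + e / 2 * `|y| by field.
  rewrite expRD [leRHS]mulrA; apply: ler_pM; rewrite ?expR_ge0 ?ler_expR//.
    by rewrite mulr_ge0// mulr_ge0// sqr_ge0.
  have : N * y ^+ 2 <= N * (2 / (e / 2) ^+ 2 * expR (e / 2 * `|y|)) by rewrite ler_wpM2l.
  have -> : 2 / (e / 2) ^+ 2 = 8 / e ^+ 2 :> R by field; exact: lt0r_neq0.
  by lra.
apply: le_trans (ler_wpM2l _ hw) _; first by rewrite mulr_ge0 ?normc_ge0 ?expR_ge0.
rewrite [leLHS]mulrC -[leLHS]mulrA ler_wpM2l//; first by rewrite mulr_ge0// ltW.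
by rewrite mulrC; exact: gG'.
Qed.

End Laplace.

(** * Gaussian integrals with complex parameters *)

Section Gaussian.
Context {R : realType}.
Local Notation mu := (@lebesgue_measure R).
Local Notation RR := (measurableTypeR R).
Implicit Types (w z : R[i]) (b c r s t : R).

Lemma measurable_sqr c : measurable_fun setT ((fun s => c * s ^+ 2) : RR -> RR).
Proof. by apply: measurable_funM; [exact: measurable_cst|exact: measurable_funX]. Qed.

Lemma measurable_lin c : measurable_fun setT ((fun s => c * s) : RR -> RR).
Proof. by apply: measurable_funM; [exact: measurable_cst|exact: measurable_id]. Qed.

Lemma rintegrable_gauss0 c : 0 < c -> rintegrable mu (fun s => expR (- (c * s ^+ 2))).
Proof.
move=> c0; pose sg := Num.sqrt (2 * c)^-1.
have c2 : 0 < (2 * c)^-1 by rewrite invr_gt0 mulr_gt0.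
have sg0 : sg != 0 by rewrite gt_eqF// sqrtr_gt0.
have := rintegrableZ (normal_peak sg)^-1 (@integrable_normal_pdf R 0 sg).
apply: eq_integrable => // s _ /=; congr EFin.
rewrite normal_pdfE// mulrA mulVf ?gt_eqF ?normal_peak_gt0// mul1r /normal_fun.
congr expR; rewrite subr0 sqr_sqrtr ?(ltW c2)// mulr2n; field; exact: lt0r_neq0.
Qed.

Lemma gauss_linear_bound c b s : 0 < c ->
  - (c * s ^+ 2) + b * `|s| <= b ^+ 2 / (2 * c) + - (c / 2 * s ^+ 2).
Proof.
move=> c0; have h : 0 <= (c * `|s| - b) ^+ 2 by exact: sqr_ge0.
rewrite -(ler_pM2r (mulr_gt0 (ltr0Sn R 1) c0)) mulrDl [leRHS]mulrDl divfK; last first.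
  by rewrite gt_eqF// mulr_gt0.
move: h; rewrite sqrrB exprMn real_normK ?num_real// mulr2n; set x := `|s|; nra.
Qed.

Lemma rintegrable_gauss c b : 0 < c ->
  rintegrable mu (fun s => expR (- (c * s ^+ 2) + b * `|s|)).
Proof.
move=> c0; have c2 : 0 < c / 2 by rewrite divr_gt0.
apply: rintegrable_le (rintegrableZ (expR (b ^+ 2 / (2 * c))) (rintegrable_gauss0 c2)) _.
  apply: measurableT_comp => //; apply: measurable_funD.
    by apply: measurableT_comp => //; exact: measurable_sqr.
  by apply: measurable_funM; [exact: measurable_cst|exact: normr_measurable].
by move=> s; rewrite ger0_norm ?expR_ge0// -expRD ler_expR gauss_linear_bound.
Qed.

Lemma real_complex_pi_sqr t : (pi * t ^+ 2)%:C = pi%:C * t%:C ^+ 2.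
Proof. by rewrite rmorphM rmorphXn. Qed.

Lemma real_complex_2pi t : (2 * pi * t)%:C = 2 * pi%:C * t%:C.
Proof. by rewrite !rmorphM rmorph_nat. Qed.

(** The branch of [w ^ (- 1 / 2)] on the right half-plane. *)
Definition gauss_int w : R[i] := laplace mu (fun=> 1) (fun s => pi * s ^+ 2) w.

Definition gauss_ft w z : R[i] :=
  laplace mu (fun s => cexp (- (w * (pi * s ^+ 2)%:C))) (fun s => 2 * pi * s) z.

Lemma gauss_int_hol b r : 0 < b -> exists G', hol (hplane b r) gauss_int G'.
Proof.
move=> b0; have bp : 0 < b / 2 * pi by rewrite mulr_gt0 ?pi_gt0// divr_gt0.
eexists; apply: (@laplace_hol _ RR R mu (hplane b r) (fun=> 1) (fun s => pi * s ^+ 2) (b / 2)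
  (fun s => expR (- (b / 2 * pi * s ^+ 2)))).
- by rewrite divr_gt0.
- exact: cmeas_cst.
- exact: measurable_sqr.
- exact: rintegrable_gauss0.
move=> z s [bz _]; rewrite normc1 mul1r ler_expR.
have p0 : 0 <= pi * s ^+ 2 by rewrite mulr_ge0 ?pi_ge0 ?sqr_ge0.
rewrite ger0_norm// -[b / 2 * pi * _]mulrA; set x := pi * _ in p0 *; nra.
Qed.

Lemma cintegrable_gauss_int w : 0 < complex.Re w ->
  cintegrable mu (fun s => 1 * cexp (- (w * (pi * s ^+ 2)%:C))).
Proof.
move=> w0; apply: (cintegrable_le (b := fun s : RR => expR (- (complex.Re w * pi * s ^+ 2)))).
- by apply: laplace_meas; [exact: cmeas_cst|exact: measurable_sqr].
- by apply: rintegrable_gauss0; rewrite mulr_gt0// pi_gt0.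
by move=> s; rewrite mul1r normc_laplace_kernel mulNr mulrA.
Qed.

Lemma gauss_int1 : gauss_int 1 = 1.
Proof.
pose sg : R := Num.sqrt (2 * pi)^-1.
have p2 : 0 < (2 * pi)^-1 :> R by rewrite invr_gt0 mulr_gt0 ?pi_gt0.
have pi0 := pi_gt0 R.
have sg0 : sg != 0 by rewrite gt_eqF// sqrtr_gt0.
have k1 (p x : R) : 0 < p -> - (p * x ^+ 2) = - x ^+ 2 / ((2 * p)^-1 *+ 2).
  by move=> p0; rewrite mulr2n; field; exact: lt0r_neq0.
have k2 (p : R) : 0 < p -> (2 * p)^-1 * p *+ 2 = 1.
  by move=> p0; rewrite mulr2n; field; exact: lt0r_neq0.
have := @integral_normal_pdf R 0 sg => h.
have -> : gauss_int 1 = (\int[mu]_s normal_pdf 0 sg s)%:C.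
  rewrite -cint_real; apply: eq_cint => s; rewrite !mul1r -rmorphN cexp_real; congr _%:C.
  rewrite normal_pdfE// /normal_peak /normal_fun subr0 sqr_sqrtr ?(ltW p2)//.
  rewrite (_ : (2 * pi)^-1 * pi *+ 2 = 1) ?sqrtr1 ?invr1 ?mul1r.
    by congr expR; exact: k1.
  exact: k2.
by rewrite /Rintegral h.
Qed.

Lemma gauss_int_scale (l : R) w : 0 < l -> 0 < complex.Re w -> gauss_int w = l%:C * gauss_int ((l ^+ 2)%:C * w).
Proof.
move=> l0 w0; pose k : {nonneg R} := NngNum (ltW l0).
have := @cint_change _ _ RR RR R mu mu (fun s => l * s + 0) k (measurable_affine l 0).
move=> /(_ (@lebesgue_affine R l 0 l0) l0 _ (cintegrable_gauss_int w0)).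
rewrite /gauss_int /laplace => ->; congr (_ * _); apply: eq_cint => s.
by rewrite addr0; congr (_ * cexp (- _)); rewrite exprMn !rmorphM /=; ring.
Qed.

(** Dilating the variable shows that [w * gauss_int w ^+ 2] takes the same
    value at [w] and at [l ^+ 2 * w] for every [l > 0], so it is constant. *)
Lemma gauss_int_sqr w : 0 < complex.Re w -> w * gauss_int w ^+ 2 = 1.
Proof.
move=> w0.
pose b := Num.min (complex.Re w) 1; pose r := Num.max (normc w) 1.
have b0 : 0 < b by rewrite lt_min w0 ltr01.
have [G' hG] := @gauss_int_hol (b / 2) (2 * r) (divr_gt0 b0 (ltr0Sn R 1)).
have r1 : 1 <= r by rewrite le_max lexx orbT.
have ha : hol (hplane (b / 2) (2 * r)) (fun p => 1 * p + 0) (fun=> 1).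
  by apply: (@hol_affine _ _ (2 * r)) => p [].
have hF := hol_mul ha (hol_mul hG hG).
have -> : 1 = 1 * gauss_int 1 ^+ 2 :> R[i] by rewrite gauss_int1 expr1n mulr1.
suff : (1 * w + 0) * (gauss_int w * gauss_int w) = (1 * 1 + 0) * (gauss_int 1 * gauss_int 1).
  by rewrite !mul1r !addr0 !expr2 mul1r.
apply: (hol_locally_repeating hF (@cvx_hplane _ b r)).
- by move=> p [pb pr]; split; lra.
- move=> p [pb pr] e e0.
  (* a dilation by a real factor close to 1 *)
  pose l := 1 + Num.min 1 (e / (3 * r)) / 3.
  have er : 0 < e / (3 * r) by rewrite divr_gt0// mulr_gt0//; lra.
  have m0 : 0 < Num.min 1 (e / (3 * r)) by rewrite lt_min ltr01.
  have m1 : Num.min 1 (e / (3 * r)) <= 1 by rewrite ge_min lexx.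
  have m2 : Num.min 1 (e / (3 * r)) <= e / (3 * r) by rewrite ge_min lexx orbT.
  have l1 : 1 < l by rewrite /l; lra.
  have l2 : 1 < l ^+ 2 <= 2 by rewrite expr2 /l; apply/andP; split; nra.
  have lm : l ^+ 2 - 1 <= Num.min 1 (e / (3 * r)) by rewrite expr2 /l; nra.
  have p0 : 0 < complex.Re p by lra.
  have pn : 0 < normc p by exact: lt_le_trans (Re_le_normc p).
  have /andP[l3 l4] := l2.
  have e1 : (l ^+ 2)%:C * p - p = (l ^+ 2 - 1)%:C * p by rewrite rmorphB rmorph1; ring.
  exists ((l ^+ 2)%:C * p); split.
  + split; first by rewrite Re_mul /= mul0r subr0; nra.
    by rewrite normcM normc_real gtr0_norm; nra.
  + by rewrite -subr_eq0 e1 mulf_neq0 -?normc_gt0// normc_real normr_gt0 gt_eqF// subr_gt0.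
  + rewrite e1 normcM normc_real gtr0_norm ?subr_gt0//.
    have h1 : (l ^+ 2 - 1) * normc p <= e / (3 * r) * r.
      by apply: ler_pM; rewrite ?normc_ge0//; lra.
    apply: le_trans h1 _; rewrite (_ : e / (3 * r) * r = e / 3); first lra.
    by field; rewrite gt_eqF//; lra.
  + rewrite !mul1r !addr0 (gauss_int_scale (lt_trans ltr01 l1) p0) rmorphXn; ring.
- by split; [rewrite ge_min lexx|rewrite le_max lexx].
- by split; [rewrite ge_min lexx orbT|rewrite normc1].
Qed.

Lemma gauss_ft_dom w r : 0 < complex.Re w -> exists2 G0 : R -> R, rintegrable mu G0 &
  forall z s, normc z <= r -> normc (cexp (- (w * (pi * s ^+ 2)%:C))) *
    expR (- complex.Re z * (2 * pi * s) + 1 * `|2 * pi * s|) <= G0 s.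
Proof.
move=> w0; have pi0 := pi_gt0 R.
exists (fun s => expR (- ((complex.Re w * pi) * s ^+ 2) + (2 * pi * (`|r| + 1)) * `|s|)).
  by apply: rintegrable_gauss; rewrite mulr_gt0.
move=> z s zr; rewrite normc_laplace_kernel -expRD ler_expR mulNr mulrA lerD2l.
rewrite !normrM [`|2|]ger0_norm// [`|pi|]gtr0_norm// mul1r.
rewrite (_ : 2 * pi * _ * _ = `|r| * (2 * pi * `|s|) + 2 * pi * `|s|); last by ring.
rewrite lerD2r; apply: le_trans (ler_norm _) _; rewrite normrM normrN.
rewrite !normrM [`|2|]ger0_norm// [`|pi|]gtr0_norm// ler_wpM2r ?mulr_ge0// ?(ltW pi0)//.
by apply: le_trans (ler_normc_Re _) (le_trans zr (ler_norm _)).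
Qed.

Lemma gauss_ft_meas w : cmeas (fun s : RR => cexp (- (w * (pi * s ^+ 2)%:C)) : R[i]).
Proof.
apply: cmeas_exp; apply: cmeasN; apply: cmeasM; first exact: cmeas_cst.
by apply: cmeas_real; exact: measurable_sqr.
Qed.

(** The exponential factor of linear order is absorbed by the Gaussian,
    uniformly on bounded sets of frequencies. *)
Lemma gauss_ft_hol w r : 0 < complex.Re w -> hol (cdisc 0 r) (gauss_ft w)
  (laplace mu (fun s => - (2 * pi * s)%:C * cexp (- (w * (pi * s ^+ 2)%:C))) (fun s => 2 * pi * s)).
Proof.
move=> w0; have [G0 iG hG] := gauss_ft_dom r w0.
apply: laplace_hol iG _; [exact: ltr01|exact: gauss_ft_meas|exact: measurable_lin|].
by move=> z s; rewrite /cdisc subr0; exact: hG.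
Qed.

Lemma cintegrable_gauss_ft w z : 0 < complex.Re w ->
  cintegrable mu (fun s => cexp (- (w * (pi * s ^+ 2)%:C)) * cexp (- (z * (2 * pi * s)%:C))).
Proof.
move=> w0; have [G0 iG hG] := gauss_ft_dom (normc z) w0.
apply: cintegrable_le iG _.
  by apply: laplace_meas; [exact: gauss_ft_meas|exact: measurable_lin].
move=> s; apply: le_trans (hG z s (lexx _)); rewrite normcM ler_wpM2l ?normc_ge0//.
by rewrite normc_laplace_kernel ler_expR lerDl mulr_ge0.
Qed.

Lemma gauss_ft0 w : gauss_ft w 0 = gauss_int w.
Proof. by apply: eq_cint => s; rewrite mul0r oppr0 cexp0 mul1r mulr1. Qed.

Lemma gauss_ft_shift (h : R) w z : 0 < complex.Re w ->
  gauss_ft w z = cexp (- (w * (pi * h ^+ 2)%:C) - z * (2 * pi * h)%:C) * gauss_ft w (z + w * h%:C).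
Proof.
move=> w0; pose k : {nonneg R} := NngNum (@ler01 R).
have := @cint_change _ _ RR RR R mu mu (fun s => 1 * s + h) k (measurable_affine 1 h).
move=> /(_ (@lebesgue_affine R 1 h ltr01) ltr01 _ (cintegrable_gauss_ft z w0)).
rewrite /gauss_ft /laplace => ->; rewrite mul1r -cintZ; last exact: cintegrable_gauss_ft.
apply: eq_cint => s; rewrite -!cexpD; congr cexp; rewrite mul1r.
have -> : pi * (s + h) ^+ 2 = pi * s ^+ 2 + pi * h ^+ 2 + (2 * pi * s) * h by ring.
have -> : 2 * pi * (s + h) = 2 * pi * s + 2 * pi * h by ring.
rewrite !rmorphD /= (rmorphM (real_complex R) (2 * pi * s) h) /=; ring.
Qed.

Lemma hol_quadexp r (a : R[i]) : hol (cdisc 0 r) (fun z => cexp (a * z ^+ 2))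
  (fun z => cexp (a * z ^+ 2) * (a * (2 * z))).
Proof.
have hid : hol (cdisc 0 r) (fun z => 1 * z + 0) (fun=> 1).
  by apply: (@hol_affine _ _ r) => p; rewrite /cdisc subr0.
have hq := hol_mul (hol_cst (cdisc 0 r) a) (hol_mul hid hid).
have := @hol_comp _ _ (fun p => normc p <= normc a * r ^+ 2) _ _ _ _ _ hq (hol_exp (fun p h => h)).
move=> h; apply: hol_ext (h _) => [p _|p _|p] /=.
- by rewrite mul1r addr0.
- by congr (cexp _ * _); ring.
rewrite /cdisc subr0 => pr; rewrite mul1r addr0 !normcM ler_wpM2l ?normc_ge0//.
by rewrite expr2 ler_pM ?normc_ge0.
Qed.

(** Completing the square with a complex shift is legitimate: the quotient of
    the two sides is holomorphic in [z] and unchanged by the real multiples of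
    [w], which come from real shifts of an integration variable. *)
Lemma gauss_of_shift (J : R[i] -> R[i]) w z : w != 0 ->
  (forall r, exists J', hol (cdisc 0 r) J J') ->
  (forall (h : R) z, J z = cexp (- (w * (pi * h ^+ 2)%:C) - z * (2 * pi * h)%:C) * J (z + w * h%:C)) ->
  J z = J 0 * cexp (pi%:C / w * z ^+ 2).
Proof.
move=> wn0 holJ shJ; pose r := normc z; have [J' hJ] := holJ (r + 1).
have h := hol_mul hJ (hol_quadexp (r + 1) (- (pi%:C / w))).
have : J z * cexp (- (pi%:C / w) * z ^+ 2) = J 0 * cexp (- (pi%:C / w) * 0 ^+ 2).
  apply: (hol_locally_repeating h (@cvx_cdisc _ 0 r)).
  - by move=> p; rewrite /cdisc => pr; lra.
  - move=> p; rewrite /cdisc subr0 => pr e e0.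
    have nw : 0 < normc w by rewrite normc_gt0.
    pose t := Num.min e 1 / normc w.
    have m0 : 0 < Num.min e 1 by rewrite lt_min e0 ltr01.
    have t0 : 0 < t by rewrite divr_gt0.
    have nt : normc (w * t%:C) = Num.min e 1.
      by rewrite normcM normc_real gtr0_norm// mulrC divfK// gt_eqF.
    exists (p + w * t%:C); split.
    + rewrite /cdisc subr0; apply: le_trans (le_normcD _ _) _; rewrite nt.
      by apply: lerD; rewrite // ge_min lexx orbT.
    + by rewrite -subr_eq0 addrAC subrr add0r -normc_gt0 nt.
    + by rewrite addrAC subrr add0r nt ge_min lexx.
    rewrite (shJ t p) [RHS]mulrAC -cexpD [RHS]mulrC; congr (_ * cexp _).
    by rewrite real_complex_pi_sqr real_complex_2pi; field.
  - by rewrite /cdisc subr0.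
  - by rewrite /cdisc subrr normc0 normc_ge0.
rewrite expr0n mulr0 cexp0 mulr1 => <-.
by rewrite -mulrA -cexpD mulNr addNr cexp0 mulr1.
Qed.

Lemma gauss_ft_val w z : 0 < complex.Re w -> gauss_ft w z = gauss_int w * cexp (pi%:C / w * z ^+ 2).
Proof.
move=> w0; rewrite -gauss_ft0; apply: gauss_of_shift; first exact: Re_gt0_neq0.
  by move=> r; eexists; exact: gauss_ft_hol.
by move=> h z'; exact: gauss_ft_shift.
Qed.

Lemma gauss_ft1_val w z : 0 < complex.Re w ->
  cint mu (fun s => s%:C * cexp (- (w * (pi * s ^+ 2)%:C)) * cexp (- (z * (2 * pi * s)%:C))) =
  - (z / w) * gauss_int w * cexp (pi%:C / w * z ^+ 2).
Proof.
move=> w0; have wn0 := Re_gt0_neq0 w0; pose r := normc z + 1.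
have h1 := @gauss_ft_hol w r w0.
have h2 := hol_mul (hol_cst (cdisc 0 r) (gauss_int w)) (hol_quadexp r (pi%:C / w)).
have h3 := hol_ext (fun p _ => esym (gauss_ft_val p w0)) (fun p _ => erefl) h2.
have i1 : cintegrable mu (fun s => s%:C * cexp (- (w * (pi * s ^+ 2)%:C)) * cexp (- (z * (2 * pi * s)%:C))).
  have [G0 iG hG] := gauss_ft_dom (normc z) w0.
  apply: cintegrable_le (rintegrableZ ((2 * pi)^-1) iG) _.
    apply: laplace_meas; last exact: measurable_lin.
    apply: cmeasM; last exact: gauss_ft_meas.
    by apply: (@cmeas_real _ RR R (fun s => s)); exact: measurable_id.
  move=> s; rewrite -mulrA normcM normc_real.
  have p0 : 0 < 2 * pi :> R by rewrite mulr_gt0// pi_gt0.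
  have := abs_le_expR (2 * pi * s) (ltr01 : 0 < 1 :> R).
  rewrite invr1 mul1r normrM (gtr0_norm p0) mulrC -ler_pdivlMr// [leRHS]mulrC => h.
  apply: le_trans (ler_wpM2r (normc_ge0 _) h) _.
  rewrite -[leLHS]mulrA ler_wpM2l ?invr_ge0 ?(ltW p0)//; apply: le_trans (hG z s (lexx _)).
  rewrite normcM (normc_laplace_kernel z) mulrCA ler_wpM2l ?normc_ge0// -expRD addrC ler_expR.
  by rewrite lerD2l !mul1r [`|2 * pi * s|]normrM (gtr0_norm p0) mulrC.
have p0 : (2 * pi)%:C != 0 :> R[i].
  by rewrite -normc_eq0 normc_real normr_eq0 gt_eqF// mulr_gt0// pi_gt0.
have zr : cdisc 0 r z by rewrite /cdisc subr0 /r lerDl.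
have acc (e : R) : 0 < e -> exists q, [/\ cdisc 0 r q, q != z & normc (q - z) <= e].
  move=> e0; pose t := Num.min e 1.
  have t0 : 0 < t by rewrite lt_min e0 ltr01.
  exists (z + t%:C); split.
  - rewrite /cdisc subr0; apply: le_trans (le_normcD _ _) _; rewrite normc_real gtr0_norm//.
    by rewrite /r lerD2l ge_min lexx orbT.
  - by rewrite -subr_eq0 addrAC subrr add0r -normc_eq0 normc_real gtr0_norm// gt_eqF.
  - by rewrite addrAC subrr add0r normc_real gtr0_norm// ge_min lexx.
have := hol_der_unique h1 h3 zr acc; rewrite mul0r add0r /laplace.
set I := cint _ _; set J := cint _ _ => IE.
have JI : - (2 * pi)%:C * J = I.
  rewrite -cintZ; last exact: i1.
  by apply: eq_cint => s; rewrite rmorphM /=; ring.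
apply: (mulfI (_ : - (2 * pi)%:C != 0)); first by rewrite oppr_eq0.
rewrite JI IE rmorphM /= rmorph_nat; ring.
Qed.

End Gaussian.

(** * Measures of critical Gaussian growth *)

Section RealGaussian.
Context {R : realType}.
Local Notation mu := (@lebesgue_measure R).
Local Notation RR := (measurableTypeR R).
Implicit Types (w z r s : R).

Lemma rintegrable_rgauss w : 0 < w ->
  rintegrable mu (fun s => expR (- (w * (pi * s ^+ 2)))).
Proof.
move=> w0; have := rintegrable_gauss0 (mulr_gt0 w0 (pi_gt0 R)).
by apply: eq_integrable => // s _ /=; rewrite mulrA.
Qed.

Lemma Rintegral_rgauss w : 0 < w ->
  \int[mu]_s expR (- (w * (pi * s ^+ 2))) = (Num.sqrt w)^-1.
Proof.
move=> w0; set x := \int[mu]_s _.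
have x0 : 0 <= x by apply: Rintegral_ge0 => s _; exact: expR_ge0.
have gE : gauss_int w%:C = x%:C.
  by rewrite -cint_real; apply: eq_cint => s; rewrite mul1r -rmorphM -rmorphN cexp_real.
have := @gauss_int_sqr R w%:C w0; rewrite gE -rmorphXn -rmorphM => /complexI h.
have s0 : 0 < Num.sqrt w by rewrite sqrtr_gt0.
apply/eqP; rewrite -(eqrXn2 (n := 2)) ?invr_ge0 ?(ltW s0)//; apply/eqP.
by rewrite exprVn sqr_sqrtr ?(ltW w0)// -[LHS]mul1r -(mulVf (lt0r_neq0 w0)) -mulrA h mulr1.
Qed.

Lemma rintegrable_rgauss_lin w z : 0 < w ->
  rintegrable mu (fun s => expR (- (w * (pi * s ^+ 2)) + z * (2 * pi * s))).
Proof.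
move=> w0; have wp : 0 < w * pi by rewrite mulr_gt0 ?pi_gt0.
apply: rintegrable_le (rintegrable_gauss (`|z| * (2 * pi)) wp) _.
  apply: measurableT_comp => //; apply: measurable_funD.
    apply: measurableT_comp => //; apply: measurable_funM; first exact: measurable_cst.
    exact: measurable_sqr.
  by apply: measurable_funM; [exact: measurable_cst|exact: measurable_lin].
move=> s; rewrite ger0_norm ?expR_ge0// ler_expR mulrA lerD2l.
apply: le_trans (ler_norm _) _; rewrite !normrM [`|2|]ger0_norm// [`|pi|]gtr0_norm ?pi_gt0//.
by rewrite !mulrA.
Qed.

(** The Gaussian weight [exp (pi z^2 / w)] is a superposition of exponentials
    that are linear in [z]. *)
Lemma Rintegral_rgauss_lin w z : 0 < w ->
  \int[mu]_s expR (- (w * (pi * s ^+ 2)) + z * (2 * pi * s)) =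
  (Num.sqrt w)^-1 * expR (pi / w * z ^+ 2).
Proof.
move=> w0; apply: (@complexI R); rewrite -cint_real rmorphM /=.
transitivity (gauss_ft w%:C (- z)%:C).
  apply: eq_cint => s; rewrite -cexpD -cexp_real; congr cexp.
  by rewrite rmorphD !rmorphN !rmorphM /= mulNr opprK.
rewrite gauss_ft_val// -cexp_real -Rintegral_rgauss// -cint_real; congr (_ * _).
  by apply: eq_cint => s; rewrite mul1r -rmorphM -rmorphN cexp_real.
by congr cexp; rewrite rmorphN sqrrN !rmorphM fmorphV.
Qed.

End RealGaussian.

Section GaussType.
Context d (T : measurableType d) {R : realType} (mu : {measure set T -> \bar R}).
Implicit Types (nu : T -> R[i]) (y : T -> R) (C r : R).

(** The growth of the measure [exp (- pi y^2) dy], whose integral against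
    [exp ((1 - r) pi y^2)] is [r ^ (- 1 / 2)]; the rate of this blow-up, and not
    only the finiteness of the integrals, is what bounds the entire function
    to which Liouville's theorem is applied. *)
Definition gauss_type nu y C := [/\ cmeas nu, measurable_fun setT y &
  forall r, 0 < r <= 1 ->
    rintegrable mu (fun x => normc (nu x) * expR ((1 - r) * (pi * y x ^+ 2))) /\
    \int[mu]_x (normc (nu x) * expR ((1 - r) * (pi * y x ^+ 2))) <= C / Num.sqrt r].

Lemma pow_le_gauss (k : nat) (a y : R) : (k <= 1)%N -> 0 < a ->
  `|y| ^+ k <= (Num.sqrt a)^-1 ^+ k * expR (a * (pi * y ^+ 2)).
Proof.
move=> k1 a0; have s0 : 0 < Num.sqrt a by rewrite sqrtr_gt0.
have y0 : 0 <= pi * y ^+ 2 by rewrite mulr_ge0 ?pi_ge0 ?sqr_ge0.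
have e1 : 1 <= expR (a * (pi * y ^+ 2)) by rewrite -expR0 ler_expR mulr_ge0// ltW.
case: k k1 => [_|[_|//]]; first by rewrite !expr0 mul1r.
rewrite !expr1 mulrC ler_pdivlMr//.
apply: le_trans (expR_ge1Dx _).
have p1 : 1 <= pi :> R by have := pi_ge2 R; lra.
have : a * y ^+ 2 <= a * (pi * y ^+ 2).
  by rewrite ler_pM2l// ler_peMl// sqr_ge0.
have -> : a * y ^+ 2 = (`|y| * Num.sqrt a) ^+ 2.
  by rewrite exprMn sqr_sqrtr ?(ltW a0)// real_normK ?num_real// mulrC.
set x := `|y| * _; have : 0 <= (x - 1) ^+ 2 by exact: sqr_ge0.
rewrite sqrrB mulr2n; have : 0 <= x by rewrite mulr_ge0// sqrtr_ge0.
have := sqr_ge0 x; lra.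
Qed.

(** A factor [|y|] is absorbed by half of the available Gaussian weight,
    which costs one more power of [r ^ (- 1 / 2)]. *)
Lemma gauss_type_moment nu y C k r : gauss_type nu y C -> (k <= 1)%N -> 0 < r <= 2 ->
  rintegrable mu (fun x => normc ((y x)%:C ^+ k * nu x) * expR ((1 - r) * (pi * y x ^+ 2))) /\
  (\int[mu]_x (normc ((y x)%:C ^+ k * nu x) * expR ((1 - r) * (pi * y x ^+ 2)))) ^+ 2
     * r ^+ k.+1 <= 2 ^+ k.+1 * C ^+ 2.
Proof.
move=> [mnu my H] k1 /andP[r0 r2].
have r20 : 0 < r / 2 by rewrite divr_gt0.
have [i1 i2] := H (r / 2) ltac:(by rewrite r20 /=; lra).
pose b x := (Num.sqrt (r / 2))^-1 ^+ k * (normc (nu x) * expR ((1 - r / 2) * (pi * y x ^+ 2))).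
have ib : rintegrable mu b by exact: rintegrableZ.
have mf : measurable_fun setT (fun x => normc ((y x)%:C ^+ k * nu x) * expR ((1 - r) * (pi * y x ^+ 2))).
  apply: measurable_funM.
    apply: measurable_normc; apply: cmeasM => //.
    by rewrite (_ : (fun x => _) = (fun x => (y x ^+ k)%:C));
      [apply: cmeas_real; exact: measurable_funX|apply/funext => x; rewrite rmorphXn].
  apply: measurableT_comp => //; apply: measurable_funM; first exact: measurable_cst.
  by apply: measurable_funM; [exact: measurable_cst|exact: measurable_funX].
have fb x : normc ((y x)%:C ^+ k * nu x) * expR ((1 - r) * (pi * y x ^+ 2)) <= b x.
  rewrite normcM normcX normc_real.
  have := pow_le_gauss (y x) k1 r20.
  move=> /(ler_wpM2r (normc_ge0 (nu x)))/(ler_wpM2r (expR_ge0 ((1 - r) * (pi * y x ^+ 2)))) h.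
  apply: le_trans h _; rewrite /b.
  have -> : expR ((1 - r / 2) * (pi * y x ^+ 2)) =
      expR (r / 2 * (pi * y x ^+ 2)) * expR ((1 - r) * (pi * y x ^+ 2)).
    by rewrite -expRD; congr expR; field.
  by rewrite le_eqVlt; apply/orP; left; apply/eqP; ring.
have fge0 x : 0 <= normc ((y x)%:C ^+ k * nu x) * expR ((1 - r) * (pi * y x ^+ 2)).
  by rewrite mulr_ge0 ?normc_ge0 ?expR_ge0.
have jf : rintegrable mu (fun x => normc ((y x)%:C ^+ k * nu x) * expR ((1 - r) * (pi * y x ^+ 2))).
  by apply: rintegrable_le ib _ => // x; rewrite ger0_norm.
split => //.
have : \int[mu]_x (normc ((y x)%:C ^+ k * nu x) * expR ((1 - r) * (pi * y x ^+ 2))) <=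
    (Num.sqrt (r / 2))^-1 ^+ k * (C / Num.sqrt (r / 2)).
  apply: le_trans (le_Rintegral measurableT jf ib (fun x _ => fb x)) _.
  rewrite RintegralZl// ler_wpM2l// exprn_ge0// invr_ge0 sqrtr_ge0//.
set I := \int[mu]_x _ => hI.
have I0 : 0 <= I by apply: Rintegral_ge0.
have : I ^+ 2 <= ((Num.sqrt (r / 2))^-1 ^+ k * (C / Num.sqrt (r / 2))) ^+ 2.
  by apply: lerXn2r => //; rewrite nnegrE// (le_trans I0).
move=> /(ler_wpM2r (exprn_ge0 k.+1 (ltW r0))) h; apply: le_trans h _.
rewrite le_eqVlt; apply/orP; left; apply/eqP.
have -> : (Num.sqrt (r / 2))^-1 ^+ k * (C / Num.sqrt (r / 2)) = C * (Num.sqrt (r / 2))^-1 ^+ k.+1.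
  by rewrite exprS; ring.
rewrite exprMn -[_^-1 ^+ k.+1 ^+ 2]exprM mulnC exprM exprVn sqr_sqrtr ?(ltW r20)//.
rewrite invf_div -mulrA -exprMn divfK ?gt_eqF// mulrC//.
Qed.

Lemma measurable_q y : measurable_fun setT y -> measurable_fun setT (fun x => pi * y x ^+ 2).
Proof.
by move=> my; apply: measurable_funM; [exact: measurable_cst|exact: measurable_funX].
Qed.

Lemma cmeas_powM y nu k : measurable_fun setT y -> cmeas nu ->
  cmeas (fun x => (y x)%:C ^+ k * nu x).
Proof.
move=> my mnu; apply: cmeasM => //.
rewrite (_ : (fun x => _) = (fun x => (y x ^+ k)%:C)); last by apply/funext => x; rewrite rmorphXn.
by apply: cmeas_real; exact: measurable_funX.
Qed.

Lemma gauss_type_hol nu y C k b r : gauss_type nu y C -> (k <= 1)%N -> -1 < b ->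
  exists L', hol (hplane b r) (laplace mu (fun x => (y x)%:C ^+ k * nu x) (fun x => pi * y x ^+ 2)) L'.
Proof.
move=> gt k1 b1; have [mnu my _] := gt.
pose c := Num.min (1 + b) 2 / 2.
have c0 : 0 < c by rewrite divr_gt0// lt_min; apply/andP; split; lra.
have c2 : c <= 1 by rewrite /c ler_pdivrMr// mul1r ge_min lexx orbT.
have cb : c <= (1 + b) / 2 by rewrite /c ler_pM2r ?invr_gt0// ge_min lexx.
have [i1 _] := gauss_type_moment gt k1 (r := c) ltac:(by rewrite c0 /=; lra).
eexists; apply: (laplace_hol c0 _ _ i1).
- exact: cmeas_powM.
- exact: measurable_q.
move=> z x [bz _]; rewrite ler_wpM2l ?normc_ge0// ler_expR.
have q0 : 0 <= pi * y x ^+ 2 by rewrite mulr_ge0 ?pi_ge0 ?sqr_ge0.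
rewrite ger0_norm// -mulrDl ler_wpM2r//; lra.
Qed.

Lemma gauss_type_bound nu y C k (t : R[i]) : gauss_type nu y C -> (k <= 1)%N ->
  -1 < complex.Re t -> complex.Re t <= 1 ->
  normc (laplace mu (fun x => (y x)%:C ^+ k * nu x) (fun x => pi * y x ^+ 2) t) ^+ 2
   * (1 + complex.Re t) ^+ k.+1 <= 2 ^+ k.+1 * C ^+ 2.
Proof.
move=> gt k1 t1 t2; have [mnu my _] := gt.
have [i1 i2] := gauss_type_moment gt k1 (r := 1 + complex.Re t) ltac:(apply/andP; split; lra).
apply: le_trans i2; apply: ler_wpM2r; first by rewrite exprn_ge0//; lra.
have h : normc (laplace mu (fun x => (y x)%:C ^+ k * nu x) (fun x => pi * y x ^+ 2) t) <=
  \int[mu]_x (normc ((y x)%:C ^+ k * nu x) * expR ((1 - (1 + complex.Re t)) * (pi * y x ^+ 2))).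
  apply: normc_cint_le => //.
    by apply: laplace_meas; [exact: cmeas_powM|exact: measurable_q].
  move=> x; rewrite [X in X <= _]normcM normc_laplace_kernel.
  by rewrite (_ : 1 - (1 + complex.Re t) = - complex.Re t)//; ring.
by apply: lerXn2r => //; rewrite nnegrE ?normc_ge0// (le_trans _ h)// normc_ge0.
Qed.

Lemma gauss_type_integrable nu y C k : gauss_type nu y C -> (k <= 1)%N ->
  rintegrable mu (fun x => normc ((y x)%:C ^+ k * nu x)).
Proof.
move=> gt k1; have [i1 _] := gauss_type_moment gt k1 (r := 1) ltac:(apply/andP; split; lra).
by apply: eq_integrable i1 => // x _ /=; rewrite subrr mul0r expR0 mulr1.
Qed.

End GaussType.

(** * Gaussian averages of a Fourier transform *)

(* the norm is kept folded, so that terms with explicit real and imaginary parts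
   stay readable and multiplicativity applies *)
#[global] Arguments normc : simpl never.

Section LipschitzMeasurable.
Context {R : realType}.

Lemma lipschitz_measurable (f : R -> R) (K : R) :
  (forall x y, `|f x - f y| <= K * `|x - y|) -> measurable_fun setT f.
Proof.
move=> fK; apply: continuous_measurable_fun => x.
apply/cvgrPdist_le => e e0.
have K1 : 0 < `|K| + 1 by rewrite ltr_wpDl.
near=> y.
apply: le_trans (fK x y) _; apply: (@le_trans _ _ ((`|K| + 1) * `|x - y|)).
  by rewrite ler_wpM2r//; have := ler_norm K; lra.
rewrite -ler_pdivlMl// mulrC; near: y.
by apply: (@cvgr_dist_le _ R^o _ _ _ id x); [exact: cvg_id|rewrite divr_gt0].
Unshelve. all: by end_near. Qed.

End LipschitzMeasurable.

Section Duality.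
Context d (T : measurableType d) {R : realType} (mu : {sigma_finite_measure set T -> \bar R}).
Local Notation leb1 := (@lebesgue_measure R).
Local Notation RR := (measurableTypeR R).
Implicit Types (nu : T -> R[i]) (y : T -> R) (s : R) (w : R[i]).

(** Fourier transform of the image under [y] of the complex measure [nu mu];
    for [y] a linear form, the restriction to a line of a Fourier transform. *)
Definition fline nu y s : R[i] :=
  cint mu (fun x => nu x * cexp (- ((0 +i* s) * (2 * pi * y x)%:C))).

Definition minus_i : R[i] := 0 +i* (-1).

Lemma normc_character (s t : R) : normc (cexp (- ((0 +i* s) * t%:C))) = 1.
Proof. by rewrite normc_cexp Re_opp Re_mul /= mulr0 mul0r subrr oppr0 expR0. Qed.

Lemma fline_meas nu y s : cmeas nu -> measurable_fun setT y ->
  cmeas (fun x => nu x * cexp (- ((0 +i* s) * (2 * pi * y x)%:C))).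
Proof.
move=> mnu my; apply: laplace_meas => //.
by apply: measurable_funM; [exact: measurable_cst|].
Qed.

Lemma fline_integrable nu y s : cmeas nu -> measurable_fun setT y ->
  rintegrable mu (fun x => normc (nu x)) ->
  cintegrable mu (fun x => nu x * cexp (- ((0 +i* s) * (2 * pi * y x)%:C))).
Proof.
move=> mnu my inu; apply: cintegrable_le inu _; first exact: fline_meas.
by move=> x; rewrite normcM normc_character mulr1.
Qed.

Lemma fline_lip nu y s t : cmeas nu -> measurable_fun setT y ->
  rintegrable mu (fun x => normc (nu x)) ->
  rintegrable mu (fun x => normc ((y x)%:C ^+ 1 * nu x)) ->
  normc (fline nu y s - fline nu y t) <=
    2 * pi * (\int[mu]_x normc ((y x)%:C ^+ 1 * nu x)) * `|s - t|.
Proof.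
move=> mnu my inu iy; rewrite /fline -cintB; [|exact: fline_integrable..].
have := @normc_cint_le _ _ _ mu _ (fun x => (2 * pi * `|s - t|) * normc ((y x)%:C ^+ 1 * nu x))
  (cmeasB (fline_meas s mnu my) (fline_meas t mnu my)) (rintegrableZ _ iy).
rewrite RintegralZl// [X in _ -> _ <= X]mulrAC; apply => x.
rewrite -mulrBr normcM normcM expr1 normc_real [leLHS]mulrC mulrA ler_wpM2r ?normc_ge0//.
rewrite (_ : cexp (- ((0 +i* s) * (2 * pi * y x)%:C)) - cexp (- ((0 +i* t) * (2 * pi * y x)%:C)) =
  cexp (- ((0 +i* t) * (2 * pi * y x)%:C)) * (cexp (0 +i* ((t - s) * (2 * pi * y x))) - 1)); last first.
  rewrite mulrBr mulr1 -cexpD; congr (cexp _ - _).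
  by apply: complex_ext; rewrite ?Re_add ?Im_add ?Re_opp ?Im_opp ?Re_mul ?Im_mul /=; ring.
rewrite normcM normc_character mul1r; apply: le_trans (normc_cexpiB1 _) _.
rewrite !normrM [`|2|]ger0_norm// [`|pi|]gtr0_norm ?pi_gt0// distrC.
by rewrite le_eqVlt; apply/orP; left; apply/eqP; ring.
Qed.

Lemma fline_cmeas nu y : cmeas nu -> measurable_fun setT y ->
  rintegrable mu (fun x => normc (nu x)) ->
  rintegrable mu (fun x => normc ((y x)%:C ^+ 1 * nu x)) ->
  @cmeas _ RR R (fline nu y).
Proof.
move=> mnu my inu iy; split.
  apply: (@lipschitz_measurable _ _ (2 * pi * (\int[mu]_x normc ((y x)%:C ^+ 1 * nu x)))) => s t.
  apply: le_trans (fline_lip s t mnu my inu iy).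
  by rewrite -Re_sub; exact: ler_normc_Re.
apply: (@lipschitz_measurable _ _ (2 * pi * (\int[mu]_x normc ((y x)%:C ^+ 1 * nu x)))) => s t.
apply: le_trans (fline_lip s t mnu my inu iy).
by rewrite -Im_sub; exact: ler_normc_Im.
Qed.

Lemma gauss_kernel k w (y : R) : (k <= 1)%N -> 0 < complex.Re w ->
  cint leb1 (fun s : RR => s%:C ^+ k * cexp (- (w * (pi * s ^+ 2)%:C)) *
       cexp (- ((0 +i* y) * (2 * pi * s)%:C))) =
  (minus_i ^+ k * w^-1 ^+ k * gauss_int w) * (y%:C ^+ k * cexp (- (w^-1 * (pi * y ^+ 2)%:C))).
Proof.
move=> k1 w0.
have eE : cexp (pi%:C / w * (0 +i* y) ^+ 2) = cexp (- (w^-1 * (pi * y ^+ 2)%:C)).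
  congr cexp; rewrite (_ : (0 +i* y) ^+ 2 = - (y ^+ 2)%:C).
    by rewrite rmorphM; ring.
  by rewrite expr2; apply: complex_ext; rewrite ?Re_mul ?Im_mul ?Re_opp ?Im_opp /=; ring.
case: k k1 => [_|[_|//]].
  rewrite !expr0 !mul1r -eE -gauss_ft_val//; apply: eq_cint => s; rewrite mul1r //.
transitivity (cint leb1 (fun s : RR => s%:C * cexp (- (w * (pi * s ^+ 2)%:C)) *
       cexp (- ((0 +i* y) * (2 * pi * s)%:C)))).
  by apply: eq_cint => s; rewrite expr1.
rewrite gauss_ft1_val// eE !expr1 (_ : (0 +i* y) = - minus_i * y%:C).
  by ring.
by apply: complex_ext; rewrite /minus_i ?Re_mul ?Im_mul /=; ring.
Qed.

(** Fubini's theorem, with the transform of a Gaussian times [s^k]. *)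
Lemma fline_duality nu y k w : cmeas nu -> measurable_fun setT y ->
  rintegrable mu (fun x => normc (nu x)) ->
  rintegrable mu (fun x => normc ((y x)%:C ^+ k * nu x)) -> (k <= 1)%N ->
  0 < complex.Re w ->
  laplace leb1 (fun s : RR => s%:C ^+ k * fline nu y s) (fun s => pi * s ^+ 2) w =
  minus_i ^+ k * w^-1 ^+ k * gauss_int w *
    laplace mu (fun x => (y x)%:C ^+ k * nu x) (fun x => pi * y x ^+ 2) w^-1.
Proof.
move=> mnu my inu iy k1 w0.
have msC : @cmeas _ RR R (fun s => s%:C) by apply: cmeas_real; exact: measurable_id.
pose F (sx : RR * T) : R[i] := (sx.1%:C ^+ k * cexp (- (w * (pi * sx.1 ^+ 2)%:C))) *
  (nu sx.2 * cexp (- ((0 +i* sx.1) * (2 * pi * y sx.2)%:C))).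
have mfst : measurable_fun setT (fun sx : RR * T => sx.1) by exact: measurable_fst.
have msnd : measurable_fun setT (fun sx : RR * T => sx.2) by exact: measurable_snd.
have mysnd : measurable_fun setT (fun sx : RR * T => y sx.2) by exact: measurableT_comp my msnd.
have mF : cmeas F.
  apply: cmeasM.
    apply: cmeas_powM => //.
    apply: cmeas_exp; apply: cmeasN; apply: cmeasM; first exact: cmeas_cst.
    by apply: cmeas_real; exact: measurable_q.
  apply: cmeasM.
    by split; [exact: measurableT_comp mnu.1 msnd|exact: measurableT_comp mnu.2 msnd].
  apply: cmeas_exp; apply: cmeasN; apply: cmeasM.
    by split => /=; [exact: measurable_cst|].
  apply: cmeas_real; apply: measurable_funM => //; exact: measurable_cst.
pose w1 := complex.Re w.
have ib : rintegrable leb1 (fun s : RR => `|s| ^+ k * expR (- (w1 * (pi * s ^+ 2)))).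
  have w2 : 0 < w1 / 2 by rewrite divr_gt0.
  apply: rintegrable_le (rintegrableZ ((Num.sqrt (w1 / 2))^-1 ^+ k) (rintegrable_rgauss w2)) _.
    apply: measurable_funM; first by apply: measurable_funX; exact: normr_measurable.
    apply: measurableT_comp => //; apply: measurableT_comp => //.
    by apply: measurable_funM; [exact: measurable_cst|exact: measurable_sqr].
  move=> s; rewrite ger0_norm ?mulr_ge0 ?expR_ge0 ?exprn_ge0//.
  apply: le_trans (ler_wpM2r (expR_ge0 _) (pow_le_gauss s k1 w2)) _.
  rewrite -[leLHS]mulrA /= ler_wpM2l ?exprn_ge0 ?invr_ge0 ?sqrtr_ge0// -expRD ler_expR.
  by rewrite le_eqVlt; apply/orP; left; apply/eqP; field.
have Fab (s : RR) (x : T) : normc (F (s, x)) <= `|s| ^+ k * expR (- (w1 * (pi * s ^+ 2))) * normc (nu x).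
  rewrite /F /= normcM (normcM (s%:C ^+ k)) (normcM (nu x)) normcX normc_real.
  rewrite (normc_character s (2 * pi * y x)) (mulr1 (normc (nu x))).
  rewrite (normc_laplace_kernel w) mulNr.
  exact: lexx.
transitivity (cint leb1 (fun s : RR => cint mu (fun x => F (s, x)))).
  apply: eq_cint => s; rewrite /F /= cintZ; last exact: fline_integrable.
  by rewrite mulrAC /fline.
rewrite (cint_fubini mF ib inu Fab) /laplace -cintZ; last first.
  apply: cintegrable_le iy _.
    by apply: laplace_meas; [exact: cmeas_powM|exact: measurable_q].
  move=> x; rewrite normcM ler_piMr ?normc_ge0// normc_laplace_kernel -expR0 ler_expR.
  by rewrite mulNr oppr_le0 mulr_ge0 ?(ltW (Re_inv_gt0 w0))// mulr_ge0 ?pi_ge0 ?sqr_ge0.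
apply: eq_cint => x.
transitivity (nu x * cint leb1 (fun s : RR => s%:C ^+ k * cexp (- (w * (pi * s ^+ 2)%:C)) *
       cexp (- ((0 +i* y x) * (2 * pi * s)%:C)))).
  rewrite -cintZ.
    apply: eq_cint => s; rewrite /F /=.
    rewrite (_ : (0 +i* s) * (2 * pi * y x)%:C = (0 +i* y x) * (2 * pi * s)%:C); first by ring.
    by apply: complex_ext; rewrite ?Re_mul ?Im_mul /=; ring.
  apply: cintegrable_le ib _.
    apply: laplace_meas; last exact: measurable_lin.
    apply: cmeas_powM; first exact: measurable_id.
    exact: gauss_ft_meas.
  move=> s; rewrite normcM normc_character mulr1 normcM normcX normc_real.
  by rewrite normc_laplace_kernel mulNr.
by rewrite gauss_kernel//; ring.
Qed.

End Duality.

(** The duality applied to a Gaussian measure. *)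
Lemma gauss_int_dual {R : realType} (w : R[i]) : 0 < complex.Re w -> gauss_int (1 + w) = gauss_int w * gauss_int (1 + w^-1).
Proof.
move=> w0; pose nu (s : measurableTypeR R) : R[i] := cexp (- (1 * (pi * s ^+ 2)%:C)).
have mnu : cmeas nu by exact: gauss_ft_meas.
have nnu s : normc (nu s) = expR (- (1 * (pi * s ^+ 2))).
  by rewrite /nu normc_laplace_kernel mulNr.
have inu : rintegrable (@lebesgue_measure R) (fun s => normc (nu s)).
  by apply: eq_integrable (rintegrable_rgauss (ltr01 : 0 < 1 :> R)) => // s _ /=; rewrite nnu.
have mid : measurable_fun setT (id : measurableTypeR R -> R) by exact: measurable_id.
have inu' : rintegrable (@lebesgue_measure R) (fun s => normc (s%:C ^+ 0 * nu s)).
  by apply: eq_integrable inu => // s _ /=; rewrite expr0 mul1r.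
have := fline_duality mnu mid inu inu' (leq0n 1) w0.
rewrite !expr0 !mul1r /laplace => h.
have fE s : fline (@lebesgue_measure R) nu id s = cexp (- (1 * (pi * s ^+ 2)%:C)).
  have := @gauss_kernel R 0 1 s (leq0n 1) (ltr01 : 0 < complex.Re (1 : R[i])).
  rewrite !expr0 !mul1r gauss_int1 !mul1r invr1 mul1r => <-.
  apply: eq_cint => t; rewrite mul1r /nu mul1r; congr (_ * cexp (- _)).
  by apply: complex_ext; rewrite ?Re_mul ?Im_mul /=; ring.
transitivity (cint (@lebesgue_measure R) (fun s => s%:C ^+ 0 * fline (@lebesgue_measure R) nu id s *
    cexp (- (w * (pi * s ^+ 2)%:C)))).
  apply: eq_cint => s; rewrite fE expr0 !mul1r -cexpD; congr cexp; ring.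
rewrite h; congr (_ * _); apply: eq_cint => s.
by rewrite expr0 !mul1r /nu -cexpD; congr cexp; ring.
Qed.

(** * Hardy's theorem for measures on a line *)

Section Moments.
Context d (T : measurableType d) {R : realType} (mu : {measure set T -> \bar R}).
Implicit Types (a y : T -> R).

(** Vanishing moments annihilate every entire function of exponential type,
    by dominated convergence of its power series. *)
Lemma Rintegral_moments0 a y (f : R -> R) (u : nat -> R) :
  measurable_fun setT a -> measurable_fun setT y -> measurable_fun setT f ->
  (forall x, series (fun n => u n * (x ^+ n / n`!%:R)) @ \oo --> f x) ->
  (forall n, `|u n| <= 1) ->
  rintegrable mu (fun x => `|a x| * expR `|y x|) ->
  (forall n, rintegrable mu (fun x => a x * y x ^+ n)) ->
  (forall n, \int[mu]_x (a x * y x ^+ n) = 0) ->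
  \int[mu]_x (a x * f (y x)) = 0.
Proof.
move=> ma my mf uf u1 ig iy m0.
pose S n x := series (fun n => u n * (x ^+ n / n`!%:R)) n.
pose P n x : R := a x * S n (y x).
have SE n x : P n x = \sum_(i < n) (u i / i`!%:R) * (a x * y x ^+ i).
  rewrite /P /S /series /= big_mkord mulr_sumr; apply: eq_bigr => i _; ring.
have iP n : rintegrable mu (P n) /\ \int[mu]_x P n x = 0.
  elim: n => [|n [IH1 IH2]].
    have e x : P 0%N x = 0 by rewrite SE big_ord0.
    split; first by rewrite (_ : P 0%N = cst 0); [exact: integrable0|apply/funext].
    by rewrite (@eq_Rintegral _ _ _ mu setT (cst 0)) ?Rintegral_cst ?mul0r// => x _; rewrite e.
  have e x : P n.+1 x = P n x + (u n / n`!%:R) * (a x * y x ^+ n).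
    by rewrite !SE big_ord_recr.
  have iz := rintegrableZ (u n / n`!%:R) (iy n).
  split.
    by apply: eq_integrable (rintegrableD IH1 iz) => // x _ /=; rewrite e.
  rewrite (@eq_Rintegral _ _ _ mu setT (fun x => P n x + (u n / n`!%:R) * (a x * y x ^+ n))).
    by rewrite RintegralD// IH2 add0r (RintegralZl _ measurableT (iy n)) m0 mulr0.
  by move=> x _; rewrite e.
have SB n x : `|S n x| <= expR `|x|.
  apply: (@le_trans _ _ (series (exp_coeff `|x|) n)).
    rewrite /S /series /=; apply: le_trans (ler_norm_sum _ _ _) _.
    apply: ler_sum => i _; rewrite normrM /exp_coeff /= normrM normrX normfV normr_nat.
    by rewrite ler_piMl// divr_ge0.
  apply: (@nondecreasing_cvgn_le _ (series (exp_coeff `|x|))); last exact: is_cvg_series_exp_coeff.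
  apply/nondecreasing_seqP => k; rewrite /series /= big_nat_recr//= lerDl.
  by rewrite exp_coeff_ge0.
have [_ _] := @dominated_convergence _ _ _ mu setT measurableT (fun n => EFin \o P n)
  (fun x => (a x * f (y x))%:E) (fun x => (`|a x| * expR `|y x|)%:E)
  (fun n => (measurable_int _ (iP n).1))
  ltac:(by apply/measurable_EFinP; apply: measurable_funM => //; exact: measurableT_comp mf my)
  ltac:(by apply: aeW => x _; apply: cvg_EFin; [exact: nearW|apply: cvgM; [exact: cvg_cst|exact: uf]])
  ig ltac:(by apply: aeW => x n _ /=; rewrite lee_fin /P normrM ler_wpM2l).
have -> : [sequence (\int[mu]_x ((EFin \o P n) x))%E]_n = cst 0%E.
  by apply/funext => n /=; rewrite (rintegrable_EFin (iP n).1) (iP n).2.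
by move=> /cvg_lim; rewrite lim_cst// => h; rewrite /Rintegral -h.
Qed.

Lemma Rintegral_moments0_cos a y : measurable_fun setT a -> measurable_fun setT y ->
  rintegrable mu (fun x => `|a x| * expR `|y x|) ->
  (forall n, rintegrable mu (fun x => a x * y x ^+ n)) ->
  (forall n, \int[mu]_x (a x * y x ^+ n) = 0) ->
  \int[mu]_x (a x * cos (y x)) = 0.
Proof.
move=> ma my; apply: (Rintegral_moments0 (u := fun n => (~~ odd n)%:R * (-1) ^+ n./2)) => //.
- exact: continuous_measurable_fun (@continuous_cos R).
- move=> x; rewrite (_ : (fun n => _) = cos_coeff x); last first.
    by apply/funext => n; rewrite /cos_coeff /= !mulrA.
  by rewrite cos.unlock; exact: is_cvg_series_cos_coeff.
- by move=> n; rewrite normrM normrX normrN1 expr1n mulr1; case: odd; rewrite ?normr0 ?normr1.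
Qed.

Lemma Rintegral_moments0_sin a y : measurable_fun setT a -> measurable_fun setT y ->
  rintegrable mu (fun x => `|a x| * expR `|y x|) ->
  (forall n, rintegrable mu (fun x => a x * y x ^+ n)) ->
  (forall n, \int[mu]_x (a x * y x ^+ n) = 0) ->
  \int[mu]_x (a x * sin (y x)) = 0.
Proof.
move=> ma my; apply: (Rintegral_moments0 (u := fun n => (odd n)%:R * (-1) ^+ n.-1./2)) => //.
- exact: continuous_measurable_fun (@continuous_sin R).
- move=> x; rewrite (_ : (fun n => _) = sin_coeff x); last first.
    by apply/funext => n; rewrite /sin_coeff /= !mulrA.
  by rewrite sin.unlock; exact: is_cvg_series_sin_coeff.
- by move=> n; rewrite normrM normrX normrN1 expr1n mulr1; case: odd; rewrite ?normr0 ?normr1.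
Qed.

End Moments.

Section Hardy.
Context d (T : measurableType d) {R : realType} (mu : {sigma_finite_measure set T -> \bar R}).
Local Notation leb1 := (@lebesgue_measure R).
Local Notation RR := (measurableTypeR R).
Variables (nu : T -> R[i]) (y : T -> R) (C1 C2 : R).
Hypothesis gt : gauss_type mu nu y C1.
Hypothesis decay : forall s : R, normc (fline mu nu y s) <= C2 * expR (- (pi * s ^+ 2)).

Let L1 k := laplace mu (fun x => (y x)%:C ^+ k * nu x) (fun x => pi * y x ^+ 2).
Let L2 k := laplace leb1 (fun s : RR => s%:C ^+ k * fline mu nu y s) (fun s => pi * s ^+ 2).

Lemma minus_i_neq0 k : (minus_i : R[i]) ^+ k != 0.
Proof. by rewrite expf_neq0// eq_complex /= oppr_eq0 oner_eq0 andbF. Qed.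

Let inu : rintegrable mu (fun x => normc (nu x)).
Proof.
apply: eq_integrable (gauss_type_integrable gt (leq0n 1)) => // x _ /=.
by rewrite expr0 mul1r.
Qed.

Let mE : @cmeas _ RR R (fline mu nu y).
Proof. by have [mnu my _] := gt; exact: fline_cmeas mnu my inu (gauss_type_integrable gt (leqnn 1)). Qed.

Let gtE : gauss_type leb1 (fline mu nu y) (id : RR -> R) C2.
Proof.
split; [exact: mE|exact: measurable_id|].
move=> r /andP[r0 r1].
have ib := rintegrableZ C2 (rintegrable_rgauss r0).
have le s : normc (fline mu nu y s) * expR ((1 - r) * (pi * s ^+ 2)) <= C2 * expR (- (r * (pi * s ^+ 2))).
  apply: le_trans (ler_wpM2r (expR_ge0 _) (decay s)) _.
  rewrite -mulrA -expRD le_eqVlt; apply/orP; left; apply/eqP; congr (_ * expR _); ring.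
have jb : rintegrable leb1 (fun s : RR => normc (fline mu nu y s) * expR ((1 - r) * (pi * s ^+ 2))).
  apply: rintegrable_le ib _.
    apply: measurable_funM; first exact: measurable_normc.
    apply: measurableT_comp => //.
    by apply: measurable_funM; [exact: measurable_cst|exact: measurable_sqr].
  by move=> s; rewrite ger0_norm ?mulr_ge0 ?normc_ge0 ?expR_ge0.
split => //; apply: le_trans (le_Rintegral measurableT jb ib (fun s _ => le s)) _.
by rewrite RintegralZl// ?Rintegral_rgauss//; exact: rintegrable_rgauss.
Qed.

(** The transform of [nu] satisfies the same growth condition as [nu], so the
    two Laplace transforms are the two halves of one entire function. *)
Lemma hardy_psi k : (k <= 1)%N -> exists c : R[i],
  (forall u, 1 / 2 <= complex.Re u -> psi gauss_int (L1 k) k u = c) /\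
  (forall u, complex.Re u <= 1 / 2 -> (minus_i ^+ k)^-1 * psi gauss_int (L2 k) k (1 - u) = c).
Proof.
move=> k1; have [mnu my _] := gt.
pose C := 2 ^+ k.+1 * (C1 ^+ 2 + C2 ^+ 2).
apply: (@psi_constant R gauss_int (L1 k) (L2 k) k C (minus_i ^+ k)).
- exact: gauss_int_hol.
- exact: gauss_int_sqr.
- exact: gauss_int_dual.
- by move=> b r b1; exact: (gauss_type_hol r gt).
- by move=> b r b1; exact: (gauss_type_hol r gtE).
- move=> t t1 t2; apply: le_trans (gauss_type_bound gt k1 t1 t2) _.
  by rewrite /C mulrDr lerDl mulr_ge0 ?sqr_ge0 ?exprn_ge0.
- move=> t t1 t2; apply: le_trans (gauss_type_bound gtE k1 t1 t2) _.
  by rewrite /C mulrDr lerDr mulr_ge0 ?sqr_ge0 ?exprn_ge0.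
- exact: minus_i_neq0.
- move=> w w0; apply: fline_duality => //.
  exact: gauss_type_integrable gt k1.
Qed.

Lemma laplace0_fline0 : L1 0 0 = fline mu nu y 0.
Proof.
apply: eq_cint => x; rewrite expr0 mul1r mul0r oppr0 (_ : 0 +i* 0 = 0 :> R[i])//.
by rewrite mul0r oppr0.
Qed.

Lemma normc_sqr_gauss_int (v : R) : 0 < v -> normc (gauss_int v%:C) ^+ 2 = v^-1.
Proof.
move=> v0; have := @gauss_int_sqr R v%:C v0 => /(congr1 (@normc R)).
rewrite normcM normcX normc_real normc1 gtr0_norm// => h.
by rewrite -[LHS]mul1r -(mulVf (lt0r_neq0 v0)) -mulrA h mulr1.
Qed.

Lemma inv_growth_le0 (x B : R) : (forall v, 1 <= v -> x <= B / v) -> x <= 0.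
Proof.
move=> h; apply: (@le0_mul_small _ _ `|B|) => e e0.
pose v := 1 + e^-1.
have ei : 0 < e^-1 by rewrite invr_gt0.
have v1 : 1 <= v by rewrite lerDl ltW.
apply: le_trans (h v v1) _.
apply: le_trans (_ : `|B| / v <= _).
  by rewrite ler_pM2r ?ler_norm// invr_gt0 (lt_le_trans ltr01).
apply: ler_wpM2l => //.
rewrite -[leRHS]invrK lef_pV2 ?posrE//; first by rewrite /v lerDr.
by rewrite (lt_le_trans ltr01).
Qed.

(** Decay faster than the critical Gaussian kills the transform at the centre:
    the constant of [psi_constant] is read off along [u -> -oo]. *)
Lemma hardy_supercritical (m C3 : R) : 1 < m ->
  (forall s : R, normc (fline mu nu y s) <= C3 * expR (- (m * (pi * s ^+ 2)))) ->
  fline mu nu y 0 = 0.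
Proof.
move=> m1 dm; have [c [h1 h2]] := hardy_psi (leq0n 1).
have cE : c = fline mu nu y 0.
  rewrite -(h1 1) /=; last by lra.
  by rewrite /psi invr1 subrr laplace0_fline0 gauss_int1 expr1 mulr1 mulr1.
rewrite -cE; apply/eqP; rewrite -normc_eq0 -sqrf_eq0 eq_le sqr_ge0 andbT.
have m0 : 0 < m - 1 by lra.
have ib := rintegrableZ C3 (rintegrable_rgauss m0).
pose B := \int[leb1]_s (C3 * expR (- ((m - 1) * (pi * s ^+ 2)))).
apply: (@inv_growth_le0 _ (B ^+ 2)) => v v1.
have v0 : 0 < v by lra.
have vr : complex.Re ((1 - v)%:C : R[i]) <= 1 / 2 by rewrite /=; lra.
rewrite -(h2 _ vr) expr0 invr1 mul1r /psi.
have -> : (1 - (1 - v)%:C)^-1 = (v^-1)%:C :> R[i].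
  by rewrite rmorphB rmorph1 opprB addrC subrK fmorphV.
have BL : normc (L2 0 ((v^-1)%:C - 1)) <= B.
  apply: normc_cint_le => //.
    apply: laplace_meas; last exact: measurable_sqr.
    by apply: cmeas_powM => //; exact: measurable_id.
  move=> s; rewrite expr0 mul1r normcM normc_laplace_kernel.
  apply: le_trans (ler_wpM2r (expR_ge0 _) (dm s)) _.
  have C30 : 0 <= C3.
    have := dm 0; rewrite expr0n !mulr0 oppr0 expR0 mulr1; apply: le_trans; exact: normc_ge0.
  rewrite -mulrA ler_wpM2l// -expRD ler_expR Re_sub /=.
  have : 0 <= v^-1 * (pi * s ^+ 2).
    by rewrite mulr_ge0 ?invr_ge0 ?(ltW v0)// mulr_ge0 ?pi_ge0 ?sqr_ge0.
  by rewrite -[1%R]/(complex.Re 1); set z := pi * s ^+ 2; set vi := v^-1; rewrite /=; lra.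
move: (L2 0 ((v^-1)%:C - 1)) BL => A BL.
rewrite normcM (normcM A) expr1 (normc_real v^-1) exprMn (exprMn _ (normc A)).
rewrite normc_sqr_gauss_int ?invr_gt0// invrK gtr0_norm ?invr_gt0// -mulrA.
rewrite (_ : v * v^-1 ^+ 2 = v^-1); last by field; rewrite gt_eqF.
apply: ler_wpM2r; first by rewrite invr_ge0 ltW.
by apply: lerXn2r => //; rewrite nnegrE ?normc_ge0// (le_trans _ BL)// normc_ge0.
Qed.

(** In the critical case a transform vanishing at the centre has all its
    Gaussian averages equal to zero. *)
Lemma hardy_laplace0 k (t : R[i]) : (k <= 1)%N -> fline mu nu y 0 = 0 ->
  normc t < 1 -> L1 k t = 0.
Proof.
move=> k1 E0 t1; have [c [h1 _]] := hardy_psi k1.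
have c0 : c = 0.
  case: k k1 h1 => [_|[_|//]] h1.
    rewrite -(h1 1) /=; last by lra.
    by rewrite /psi invr1 subrr laplace0_fline0 E0 !mul0r.
  apply/eqP; rewrite -normc_eq0 -sqrf_eq0 eq_le sqr_ge0 andbT.
  have bL t' := @gauss_type_bound _ _ _ _ _ _ _ 1 t' gt (leqnn 1).
  apply: (@inv_growth_le0 _ (2 ^+ 2 * C1 ^+ 2)) => v v1.
  have v0 : 0 < v by lra.
  have vr : 1 / 2 <= complex.Re (v%:C : R[i]) by rewrite /=; lra.
  have := normc_psi (@gauss_int_sqr R) bL vr; rewrite h1// normc_real gtr0_norm//=.
  by rewrite ler_pdivlMr// expr2 mulrA ler_pM2r.
have t0 : 0 < complex.Re (1 + t).
  have := le_lt_trans (ler_normc_Re t) t1; rewrite ltr_norml => /andP[? _].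
  by rewrite Re_add /=; lra.
have tn0 := Re_gt0_neq0 t0.
have u2 : 1 / 2 <= complex.Re (1 + t)^-1.
  rewrite Re_inv ler_pdivlMr ?exprn_gt0 ?normc_gt0//.
  have t2 : normc t ^+ 2 < 1.
    by rewrite expr2 mulr_ilt1 ?normc_ge0.
  by move: t2; rewrite !normcE2 !Re_add Im_add /=; set a := complex.Re t; set b := complex.Im t; lra.
have := h1 _ u2; rewrite c0 /psi invrK addrAC subrr add0r => /eqP.
rewrite !mulf_eq0 expf_eq0 /= (negPf tn0) orbF => /orP[/eqP //|/eqP g0].
by have := gauss_int_sqr t0; rewrite g0 expr0n mulr0 => /eqP; rewrite eq_sym oner_eq0.
Qed.

Let q x := pi * y x ^+ 2.

Let gm k m (x : T) : R[i] := (- (q x)%:C) ^+ m * ((y x)%:C ^+ k * nu x).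

Let gm_meas k m : cmeas (gm k m).
Proof.
have [mnu my _] := gt.
have mq : cmeas (fun x => (- q x)%:C : R[i]).
  by apply: cmeas_real; apply: measurableT_comp => //; exact: measurable_q.
rewrite /gm (_ : (fun x => _) = (fun x => (- q x)%:C ^+ m * ((y x)%:C ^+ k * nu x))).
  apply: cmeas_powM; first by apply: measurableT_comp => //; exact: measurable_q.
  exact: cmeas_powM.
by apply/funext => x; rewrite rmorphN.
Qed.

(** Successive derivatives of a vanishing Laplace transform vanish. *)
Let laplace_moments k m (t : R[i]) : (k <= 1)%N -> fline mu nu y 0 = 0 ->
  normc t < 1 / 2 -> laplace mu (gm k m) q t = 0.
Proof.
move=> k1 E0; have [mnu my _] := gt.
have mq : measurable_fun setT q by exact: measurable_q.
(* the weight exp (3 pi y^2 / 4) dominates |t| <= 1 / 2 and any power of y *)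
have [ig _] := gauss_type_moment gt k1 (r := 1 / 4) ltac:(apply/andP; split; lra).
elim: m t => [|m IH] t t2.
  rewrite -[RHS](hardy_laplace0 (k := k) (t := t))//; last by lra.
  by apply: eq_cint => x; rewrite /gm expr0 mul1r.
pose D (z : R[i]) : Prop := normc z < 1 / 2.
pose G0 x := (m`!%:R / (1 / 8) ^+ m) * (normc ((y x)%:C ^+ k * nu x) * expR ((1 - 1 / 4) * (pi * y x ^+ 2))).
have f0 : 0 < m`!%:R :> R by rewrite ltr0n fact_gt0.
have hD : hol D (laplace mu (gm k m) q) (laplace mu (fun x => - (q x)%:C * gm k m x) q).
  have e8 : 0 < 1 / 8 :> R by lra.
  apply: (@laplace_hol _ _ _ _ D _ _ (1 / 8) G0 e8 (gm_meas k m) mq); first exact: rintegrableZ.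
  move=> z x Dz; rewrite /gm normcM normcX normcN normc_real /G0.
  have q0 : 0 <= q x by rewrite mulr_ge0 ?pi_ge0 ?sqr_ge0.
  rewrite (ger0_norm q0).
  have qm : q x ^+ m <= m`!%:R / (1 / 8) ^+ m * expR (1 / 8 * q x).
    have q8 : 0 <= 1 / 8 * q x by rewrite mulr_ge0//; lra.
    rewrite mulrAC ler_pdivlMr ?exprn_gt0//.
    rewrite -exprMn [q x * _]mulrC.
    case: m {IH f0 G0} => [|m].
      by rewrite fact0 expr0 [leRHS]mul1r; apply: le_trans (expR_ge1Dx _); rewrite lerDl.
    have := expR_ge1Dxn m q8; have g0 : 0 < m.+1`!%:R :> R by rewrite ltr0n fact_gt0.
    move=> h; rewrite [leRHS]mulrC -ler_pdivrMr//.
    by apply: le_trans h; rewrite lerDr.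
  apply: le_trans (ler_wpM2r (expR_ge0 _) (ler_wpM2r (normc_ge0 _) qm)) _.
  have EE : expR (1 / 8 * q x) * expR (- complex.Re z * q x + 1 / 8 * q x) <=
      expR ((1 - 1 / 4) * q x).
    rewrite -expRD ler_expR.
    have h1 : normc z < 1 / 2 := Dz; have h2 := ler_normc_Re z.
    have : - complex.Re z <= 1 / 2 by move: h2; rewrite ler_norml => /andP[h2 _]; lra.
    by move=> /(ler_wpM2r q0) h3; lra.
  set N := normc _; set K := _ / _; set E1 := expR _ in EE *; set E2 := expR _ in EE *.
  rewrite (_ : K * E1 * N * E2 = K * (N * (E1 * E2))); last by ring.
  apply: ler_wpM2l; first by rewrite /K divr_ge0 ?ltW// exprn_gt0.
  by apply: ler_wpM2l; [exact: normc_ge0|].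
have h0 : hol D (laplace mu (gm k m) q) (fun=> 0).
  by apply: hol_ext (hol_cst D 0) => // p Dp; rewrite IH.
have acc (e : R) : 0 < e -> exists p, [/\ D p, p != t & normc (p - t) <= e].
  move=> e0; pose h := Num.min e ((1 / 2 - normc t) / 2).
  have h00 : 0 < h by rewrite lt_min e0 /=; lra.
  have h1 : h <= (1 / 2 - normc t) / 2 by rewrite ge_min lexx orbT.
  exists (t + h%:C); split.
  - rewrite /D; apply: le_lt_trans (le_normcD _ _) _; rewrite normc_real gtr0_norm//.
    have : normc t < 1 / 2 := t2; lra.
  - by rewrite -subr_eq0 addrAC subrr add0r -normc_eq0 normc_real gtr0_norm// gt_eqF.
  - by rewrite addrAC subrr add0r normc_real gtr0_norm// ge_min lexx.
rewrite -(hol_der_unique hD h0 t2 acc).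
by apply: eq_cint => x; rewrite /gm exprS mulrA.
Qed.

Lemma linear_le_gauss (c z : R) : c * z <= c ^+ 2 + (1 - 1 / 2) * (pi * z ^+ 2).
Proof.
have p2 : 2 <= pi :> R := pi_ge2 R.
have h1 : 2 * z ^+ 2 <= pi * z ^+ 2 by rewrite ler_wpM2r ?sqr_ge0.
have h2 : 0 <= (2 * c - z) ^+ 2 by exact: sqr_ge0.
have h3 : 0 <= z ^+ 2 by exact: sqr_ge0.
nra.
Qed.

Let exp_moment (c : R) : rintegrable mu (fun x => normc (nu x) * expR (c * `|y x|)).
Proof.
have [mnu my H] := gt; have [i1 _] := H (1 / 2) ltac:(apply/andP; split; lra).
apply: rintegrable_le (rintegrableZ (expR (c ^+ 2)) i1) _.
  apply: measurable_funM; first exact: measurable_normc.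
  apply: measurableT_comp => //; apply: measurable_funM; first exact: measurable_cst.
  exact: measurableT_comp.
move=> x; rewrite ger0_norm ?mulr_ge0 ?normc_ge0 ?expR_ge0//= mulrCA -expRD.
rewrite ler_wpM2l ?normc_ge0// ler_expR.
rewrite -[y x ^+ 2]real_normK ?num_real//; exact: linear_le_gauss.
Qed.

Let moment_integrable j : cintegrable mu (fun x => (y x ^+ j)%:C * nu x).
Proof.
have [mnu my _] := gt.
have f0 : 0 < j`!%:R :> R by rewrite ltr0n fact_gt0.
apply: cintegrable_le (rintegrableZ j`!%:R (exp_moment 1)) _.
  by apply: cmeasM => //; apply: cmeas_real; exact: measurable_funX.
move=> x; rewrite normcM normc_real /= mulrC mulrCA ler_wpM2l ?normc_ge0// mul1r.
rewrite mulrC -ler_pdivrMr// normrX.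
case: j f0 => [|j] f0; first by rewrite expr0 fact0 divr1; apply: le_trans (expR_ge1Dx _); rewrite lerDl.
by apply: le_trans (expR_ge1Dxn j (normr_ge0 (y x))); rewrite lerDr.
Qed.

(** The moments of even and odd order are Taylor coefficients at 0 of the
    vanishing averages for [k = 0] and [k = 1]. *)
Lemma hardy_moments j : fline mu nu y 0 = 0 -> cint mu (fun x => (y x ^+ j)%:C * nu x) = 0.
Proof.
move=> E0; pose k : nat := odd j; pose m := j./2.
have k1 : (k <= 1)%N by rewrite /k; case: odd.
have t0 : normc (0 : R[i]) < 1 / 2 by rewrite normc0 divr_gt0.
have := laplace_moments m k1 E0 t0.
have -> : laplace mu (gm k m) q 0 = (- pi%:C) ^+ m * cint mu (fun x => (y x ^+ j)%:C * nu x).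
  rewrite -cintZ//; apply: eq_cint => x.
  rewrite mul0r oppr0 cexp0 mulr1 /gm /q rmorphM /= rmorphXn /= -mulNr exprMn -exprM mul2n.
  rewrite -[in RHS](odd_double_half j) -/k -/m exprD rmorphM !rmorphXn /=; ring.
move/eqP; rewrite mulf_eq0 expf_eq0 oppr_eq0 => /orP[/andP[_ /eqP p0]|/eqP //].
by have := pi_gt0 R; rewrite (complexI p0) ltxx.
Qed.

(** Expanding the cosine and the sine of [2 pi s y] under the integral reduces
    the claim to the vanishing of all moments. *)
Lemma hardy_critical : fline mu nu y 0 = 0 -> forall s : R, fline mu nu y s = 0.
Proof.
move=> E0 s; have [mnu my _] := gt.
pose th x := 2 * pi * s * y x.
have mth : measurable_fun setT th by apply: measurable_funM; [exact: measurable_cst|].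
have mom (a : T -> R) (p : R[i] -> R) : (forall x, a x = p (nu x)) -> (forall z, `|p z| <= normc z) ->
  measurable_fun setT a -> (forall j, rintegrable mu (fun x => y x ^+ j * a x)) ->
  (forall j, \int[mu]_x (y x ^+ j * a x) = 0) ->
  \int[mu]_x (a x * cos (th x)) = 0 /\ \int[mu]_x (a x * sin (th x)) = 0 /\
  rintegrable mu (fun x => a x * cos (th x)) /\ rintegrable mu (fun x => a x * sin (th x)).
  move=> ap pn ma ia za.
  have ig : rintegrable mu (fun x => `|a x| * expR `|th x|).
    apply: rintegrable_le (exp_moment `|2 * pi * s|) _.
      apply: measurable_funM; first exact: measurableT_comp.
      by apply: measurableT_comp => //; exact: measurableT_comp.
    move=> x; rewrite ger0_norm ?mulr_ge0 ?expR_ge0//= /th normrM ler_wpM2r ?expR_ge0//.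
    by rewrite ap.
  have iy n : rintegrable mu (fun x => a x * th x ^+ n).
    apply: eq_integrable (rintegrableZ ((2 * pi * s) ^+ n) (ia n)) => // x _ /=.
    by rewrite /th (exprMn n (2 * pi * s) (y x)); congr EFin; ring.
  have zy n : \int[mu]_x (a x * th x ^+ n) = 0.
    rewrite (@eq_Rintegral _ _ _ mu setT (fun x => (2 * pi * s) ^+ n * (y x ^+ n * a x))).
      by rewrite (RintegralZl _ measurableT (ia n)) za mulr0.
    by move=> x _; rewrite /th (exprMn n (2 * pi * s) (y x)); ring.
  have ia0 : rintegrable mu (fun x => `|a x|).
    by apply: rintegrable_norm; apply: eq_integrable (ia 0%N) => // x _ /=; rewrite expr0 mul1r.
  split; first exact: Rintegral_moments0_cos.
  split; first exact: Rintegral_moments0_sin.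
  split; apply: rintegrable_le ia0 _.
  - apply: measurable_funM => //; apply: measurableT_comp mth.
    exact: continuous_measurable_fun (@continuous_cos R).
  - by move=> x; rewrite normrM ler_piMr// cos_max.
  - apply: measurable_funM => //; apply: measurableT_comp mth.
    exact: continuous_measurable_fun (@continuous_sin R).
  - by move=> x; rewrite normrM ler_piMr// sin_max.
have reM j x : y x ^+ j * complex.Re (nu x) = complex.Re ((y x ^+ j)%:C * nu x).
  by rewrite Re_mul /= mul0r subr0.
have imM j x : y x ^+ j * complex.Im (nu x) = complex.Im ((y x ^+ j)%:C * nu x).
  by rewrite Im_mul /= mul0r addr0.
have [c1 [s1 [ic1 is1]]] := mom (fun x => complex.Re (nu x)) (@complex.Re R) (fun=> erefl)
  (@ler_normc_Re R) mnu.1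
  (fun j => ltac:(by apply: eq_integrable (moment_integrable j).1 => // x _ /=; rewrite reM))
  (fun j => ltac:(by under eq_Rintegral do rewrite reM; rewrite -Re_cint hardy_moments)).
have [c2 [s2 [ic2 is2]]] := mom (fun x => complex.Im (nu x)) (@complex.Im R) (fun=> erefl)
  (@ler_normc_Im R) mnu.2
  (fun j => ltac:(by apply: eq_integrable (moment_integrable j).2 => // x _ /=; rewrite imM))
  (fun j => ltac:(by under eq_Rintegral do rewrite imM; rewrite -[LHS]/(complex.Im (cint mu _)) hardy_moments)).
have ke x : cexp (- ((0 +i* s) * (2 * pi * y x)%:C)) = cos (th x) +i* - sin (th x).
  have -> : - ((0 +i* s) * (2 * pi * y x)%:C) = 0 +i* - th x.
    by apply: complex_ext; rewrite ?Re_opp ?Im_opp ?Re_mul ?Im_mul /th /=; ring.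
  by apply: complex_ext; rewrite ?Re_cexp ?Im_cexp /= expR0 mul1r ?cosN ?sinN.
apply: complex_ext.
  rewrite Re_cint (@eq_Rintegral _ _ _ mu setT (fun x => complex.Re (nu x) * cos (th x) + complex.Im (nu x) * sin (th x))).
    by rewrite RintegralD// c1 s2 addr0.
  by move=> x _; rewrite ke Re_mul /=; ring.
transitivity (\int[mu]_x (complex.Im (nu x) * cos (th x) - complex.Re (nu x) * sin (th x))).
  by apply: eq_Rintegral => x _; rewrite ke Im_mul /=; ring.
by rewrite RintegralB// c2 s1 subrr.
Qed.

End Hardy.

(** * Lebesgue measure on tuples *)

Section LebesgueTuple.
Context {R : realType}.
Local Notation RR := (measurableTypeR R).

Definition tshift n (b x : Rn R n) : Rn R n := [tuple tnth x i + tnth b i | i < n].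

Lemma tnth_tshift n (b x : Rn R n) i : tnth (tshift b x) i = tnth x i + tnth b i.
Proof. by rewrite tnth_mktuple. Qed.

Lemma measurable_tshift n (b : Rn R n) : measurable_fun setT (tshift b).
Proof.
apply/measurable_fun_tnthP => i.
apply: (@eq_measurable_fun _ _ _ _ _ (fun x : Rn R n => tnth x i + tnth b i)).
  by move=> x _ /=; rewrite tnth_tshift.
by apply: measurable_funD; [exact: measurable_tnth|exact: measurable_cst].
Qed.

Lemma leb_tonelli n (f : Rn R n.+1 -> \bar R) : measurable_fun setT f ->
  (forall x, 0 <= f x)%E ->
  (\int[leb n.+1]_z f z = \int[@lebesgue_measure R]_x \int[leb n]_y f (tcons (x, y)))%E.
Proof.
move=> mf f0; rewrite /= /leb_cons ge0_integral_pushforward ?preimage_setT//; last first.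
  exact: measurable_tcons.
have mft : measurable_fun setT (f \o @tcons R n).
  by apply: measurableT_comp mf _; exact: measurable_tcons.
by rewrite (fubini_tonelli1 (f \o @tcons R n))// => x; exact: f0.
Qed.

Lemma tcons_tuncons n (x : Rn R n.+1) : tcons (tuncons x) = x.
Proof. by rewrite /tcons /tuncons /= -tuple_eta. Qed.

Lemma tshift_tcons n (b : Rn R n.+1) x (y : Rn R n) :
  tshift b (tcons (x, y)) = tcons (x + (tuncons b).1, tshift (tuncons b).2 y).
Proof.
rewrite -{1}(tcons_tuncons b); case: (tuncons b) => b0 b' /=.
apply: eq_from_tnth => i; rewrite tnth_tshift /tcons.
by case: (unliftP ord0 i) => [j|] -> /=; rewrite ?tnth0 // !tnthS tnth_tshift.
Qed.

(** One coordinate at a time, by Tonelli's theorem. *)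
Lemma leb_shift_integral n (b : Rn R n) (f : Rn R n -> \bar R) : measurable_fun setT f ->
  (forall x, 0 <= f x)%E ->
  (\int[leb n]_x f (tshift b x) = \int[leb n]_x f x)%E.
Proof.
elim: n b f => [b f mf f0|n IH b f mf f0].
  by apply: eq_integral => x _; congr f; rewrite [LHS]tuple0 [RHS]tuple0.
rewrite !leb_tonelli//; last exact: measurableT_comp mf (measurable_tshift b).
pose G (x : RR) := (\int[leb n]_y f (tcons (x, y)))%E.
have mG : measurable_fun setT G.
  apply: (measurable_fun_fubini_tonelli_F (f \o @tcons R n)) => [|x]; last exact: f0.
  by apply: measurableT_comp mf _; exact: measurable_tcons.
transitivity (\int[@lebesgue_measure R]_x G (1 * x + (tuncons b).1)%R)%E.
  apply: eq_integral => x _; rewrite /G mul1r.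
  rewrite -(IH (tuncons b).2 (fun y => f (tcons (x + (tuncons b).1, y))))//.
    by apply: eq_integral => y _; rewrite tshift_tcons.
  apply: measurableT_comp mf _.
  have mp : measurable_fun setT (fun y : Rn R n => (x + (tuncons b).1 : RR, y)).
    exact: pair1_measurable.
  apply: measurableT_comp mp. exact: measurable_tcons.
have := @ge0_integral_change _ _ RR RR R lebesgue_measure lebesgue_measure _ (NngNum (@ler01 R))
  (measurable_affine 1 (tuncons b).1) (@lebesgue_affine R 1 (tuncons b).1 ltr01) _ mG.
rewrite mul1e => <-// x; exact: integral_ge0.
Qed.

Lemma leb_shift n (b : Rn R n) A : measurable A ->
  leb n A = ((NngNum (@ler01 R))%:num%:E * leb n (tshift b @^-1` A))%E.
Proof.
move=> mA; rewrite mul1e.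
have mB : measurable (tshift b @^-1` A).
  by rewrite -[X in measurable X]setTI; exact: measurable_tshift.
have := @leb_shift_integral n b (fun x => (\1_A x)%:E) _ _.
rewrite !integral_indic// !setIT => <-//; first last.
  by apply/measurable_EFinP; exact: measurable_indic.
Qed.

Definition box n (b : Rn R n) (e : R) : set (Rn R n) :=
  [set x | forall i, `|tnth x i - tnth b i| < e].

Lemma measurable_box n (b : Rn R n) (e : R) : measurable (box b e).
Proof.
rewrite (_ : box b e = \bigcap_(i in [set: 'I_n]) ((@tnth n R ^~ i) @^-1` `]tnth b i - e, tnth b i + e[)).
  apply: fin_bigcap_measurable; first exact: finite_finset.
  by move=> i _; rewrite -[X in measurable X]setTI; apply: measurable_tnth.
apply/seteqP; split => [x xb i _|x xb i].
  by have := xb i; rewrite /= in_itv/= ltr_distl.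
by have := xb i Logic.I; rewrite /= in_itv/= ltr_distl.
Qed.

Lemma leb_box_gt0 n (b : Rn R n) (e : R) : 0 < e -> (0 < leb n (box b e))%E.
Proof.
move=> e0; elim: n b => [b|n IH b].
  by rewrite /= diracE mem_set ?lte_fin//; case.
pose I : set R := `](tuncons b).1 - e, (tuncons b).1 + e[%classic.
have bE : @tcons R n @^-1` box b e =
    (I : set RR) `*` box (tuncons b).2 e.
  rewrite /I -{1}(tcons_tuncons b); case: (tuncons b) => b0 b' /=.
  apply/seteqP; split => [[x y] /= h|[x y] /= [+ h2] i].
    split; first by have := h ord0; rewrite /= /tcons !tnth0 in_itv/= ltr_distl.
    by move=> i; have := h (lift ord0 i); rewrite /tcons !tnthS.
  rewrite in_itv/= -ltr_distl /tcons => h1.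
  by case: (unliftP ord0 i) => [j|] ->; rewrite ?tnth0// !tnthS.
change (0 < (@lebesgue_measure R \x leb n) (@tcons R n @^-1` box b e))%E; rewrite bE.
have -> : ((@lebesgue_measure R \x leb n) (I `*`
    box (tuncons b).2 e) = lebesgue_measure (I : set R) *
    leb n (box (tuncons b).2 e))%E.
  apply: (@product_measure1E _ _ RR (Rn R n) R lebesgue_measure (leb n) I).
    exact: measurable_itv.
  exact: measurable_box.
apply: mule_gt0 => //.
have := @lebesgue_measure_itv R `](tuncons b).1 - e, (tuncons b).1 + e[.
by rewrite /= lte_fin ifT /I => [->|]; rewrite -?EFinB ?lte_fin; lra.
Qed.

End LebesgueTuple.

(** * Quadratic forms *)

Section Dot.
Context {R : realType} {n : nat}.
Implicit Types (u v w : 'cV[R]_n) (M : 'M[R]_n).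

Lemma dotE u v : dot u v = \sum_i u i ord0 * v i ord0.
Proof. by rewrite /dot mxE; apply: eq_bigr => i _; rewrite mxE. Qed.

Lemma dotC u v : dot u v = dot v u.
Proof. by rewrite !dotE; apply: eq_bigr => i _; rewrite mulrC. Qed.

Lemma dotDl u v w : dot (u + v) w = dot u w + dot v w.
Proof. by rewrite !dotE -big_split /=; apply: eq_bigr => i _; rewrite mxE mulrDl. Qed.

Lemma dotZl (a : R) u v : dot (a *: u) v = a * dot u v.
Proof. by rewrite !dotE mulr_sumr; apply: eq_bigr => i _; rewrite mxE mulrA. Qed.

Lemma dotDr u v w : dot w (u + v) = dot w u + dot w v.
Proof. by rewrite dotC dotDl !(dotC w). Qed.

Lemma dotZr (a : R) u v : dot u (a *: v) = a * dot u v.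
Proof. by rewrite dotC dotZl dotC. Qed.

Lemma dotN u v : dot u (- v) = - dot u v.
Proof. by rewrite -scaleN1r dotZr mulN1r. Qed.

Lemma dot_adj M u v : dot u (M *m v) = dot (M^T *m u) v.
Proof. by rewrite /dot trmx_mul trmxK mulmxA. Qed.

Lemma dot_sym M u v : M^T = M -> dot u (M *m v) = dot v (M *m u).
Proof. by move=> Ms; rewrite dot_adj Ms dotC. Qed.

Lemma quadD M u v : M^T = M ->
  dot (u + v) (M *m (u + v)) = dot u (M *m u) + 2 * dot u (M *m v) + dot v (M *m v).
Proof. by move=> Ms; rewrite mulmxDr dotDl !dotDr (dot_sym v u Ms); ring. Qed.

Lemma quadZ M (a : R) u : dot (a *: u) (M *m (a *: u)) = a ^+ 2 * dot u (M *m u).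
Proof. by rewrite -scalemxAr dotZl dotZr mulrA. Qed.

Lemma posdef_ge0 M u : posdef M -> 0 <= dot u (M *m u).
Proof.
move=> [_ pM]; have [->|u0] := eqVneq u 0; last by rewrite ltW// pM.
by rewrite mulmx0 dotE big1// => i _; rewrite mxE mul0r.
Qed.

Lemma posdef_unit M : posdef M -> M \in unitmx.
Proof.
move=> [Ms pM]; rewrite unitmxE unitfE; apply/det0P => -[v v0 vM].
have vT0 : v^T != 0 by rewrite -(inj_eq trmx_inj) trmxK trmx0.
have := pM _ vT0; rewrite (_ : M *m v^T = 0).
  by rewrite dotE big1 ?ltxx// => i _; rewrite [in X in _ * X]mxE mulr0.
by rewrite -Ms -trmx_mul vM trmx0.
Qed.

(** Positivity of the form at [a u - b v], with [a = v.M v], [b = u.M v]. *)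
Lemma posdef_cauchy_schwarz M u v : posdef M ->
  dot u (M *m v) ^+ 2 <= dot u (M *m u) * dot v (M *m v).
Proof.
move=> pM; have [->|v0] := eqVneq v 0.
  have d0 w : dot w (M *m 0) = 0 by rewrite mulmx0 dotE big1// => i _; rewrite mxE mulr0.
  by rewrite !d0 expr0n mulr0.
have a0 := pM.2 _ v0; set a := dot v _ in a0 *; set b := dot u (M *m v).
have := posdef_ge0 (a *: u + (- b) *: v) pM.
rewrite quadD; last exact: pM.1.
rewrite !quadZ -scalemxAr dotZl dotZr -/a -/b sqrrN => h.
have : 0 <= a * (dot u (M *m u) * a - b ^+ 2) by apply: le_trans h _; nra.
by rewrite pmulr_rge0// subr_ge0.
Qed.

(** By Cauchy-Schwarz between [v] and [M^-1 v], a positive definite form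
    dominates a multiple of the Euclidean one, without compactness. *)
Lemma posdef_coercive M : posdef M ->
  exists2 c : R, 0 < c & forall v, c * dot v v <= dot v (M *m v).
Proof.
move=> pM; pose M' := invmx M.
pose K := 1 + \sum_i \sum_j `|M' i j|.
have S0 : 0 <= \sum_i \sum_j `|M' i j| by do 2!apply: sumr_ge0 => ? _.
have K0 : 0 < K by rewrite ltr_pwDl.
exists K^-1; first by rewrite invr_gt0.
move=> v; rewrite -(ler_pM2l K0) mulrA mulfV ?gt_eqF// mul1r.
have ci i : `|v i ord0| ^+ 2 <= dot v v.
  rewrite dotE (bigD1 i)//= real_normK ?num_real// -expr2 lerDl.
  by apply: sumr_ge0 => j _; rewrite -expr2 sqr_ge0.
have vv0 : 0 <= dot v v.
  by rewrite dotE; apply: sumr_ge0 => j _; rewrite -expr2 sqr_ge0.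
have h1 : dot v (M' *m v) <= K * dot v v.
  apply: (@le_trans _ _ ((\sum_i \sum_j `|M' i j|) * dot v v)); last first.
    by rewrite ler_wpM2r// lerDr.
  rewrite dotE mulr_suml; apply: ler_sum => i _; rewrite mxE mulr_sumr mulr_suml.
  apply: ler_sum => j _; apply: le_trans (ler_norm _) _; rewrite !normrM.
  rewrite mulrCA ler_wpM2l//; have := ci i; have := ci j.
  have := sqr_ge0 (`|v i ord0| - `|v j ord0|); nra.
have h2 := posdef_cauchy_schwarz v (M' *m v) pM.
rewrite mulmxA mulmxV ?posdef_unit// mul1mx dotC in h2.
rewrite (dotC (M' *m v)) in h2.
have [->|vn0] := eqVneq (dot v v) 0; first by rewrite mulr_ge0 ?posdef_ge0// ltW.
have vp : 0 < dot v v by rewrite lt_neqAle eq_sym vn0.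
rewrite -(ler_pM2r vp) -expr2; apply: le_trans h2 _.
rewrite (_ : K * _ * _ = dot (M *m v) v * (K * dot v v)); last by rewrite (dotC v); ring.
by rewrite ler_wpM2l// dotC posdef_ge0.
Qed.

Lemma dot_vec (x : Rn R n) v : dot (vec x) v = \sum_i tnth x i * v i ord0.
Proof. by rewrite dotE; apply: eq_bigr => i _; rewrite mxE. Qed.

Lemma measurable_dot v : measurable_fun setT (fun x : Rn R n => dot (vec x) v).
Proof.
rewrite (_ : (fun x => _) = (fun x => \sum_i tnth x i * v i ord0)); last by apply/funext => x; rewrite dot_vec.
apply: measurable_sum => i; apply: measurable_funM; last exact: measurable_cst.
exact: measurable_tnth.
Qed.

Lemma measurable_quad M : measurable_fun setT (fun x : Rn R n => dot (vec x) (M *m vec x)).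
Proof.
rewrite (_ : (fun x => _) = (fun x => \sum_i tnth x i * \sum_j M i j * tnth x j)); last first.
  apply/funext => x; rewrite dot_vec; apply: eq_bigr => i _; congr (_ * _).
  by rewrite mxE; apply: eq_bigr => j _; rewrite mxE.
apply: measurable_sum => i; apply: measurable_funM; first exact: measurable_tnth.
apply: measurable_sum => j; apply: measurable_funM; first exact: measurable_cst.
exact: measurable_tnth.
Qed.

Definition tvec v : Rn R n := [tuple v i ord0 | i < n].

Lemma tvecK v : vec (tvec v) = v.
Proof. by apply/colP => i; rewrite mxE tnth_mktuple. Qed.

Lemma vec_tshift (b x : Rn R n) : vec (tshift b x) = vec x + vec b.
Proof. by apply/colP => i; rewrite !mxE tnth_tshift. Qed.

End Dot.

(** * Gaussian integrals in several variables *)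

Section GaussianTuple.
Context {R : realType}.
Local Notation leb1 := (@lebesgue_measure R).
Local Notation RR := (measurableTypeR R).

(** The integral is a product of one-dimensional ones, by Tonelli. *)
Lemma rintegrable_gauss_leb n (c : R) : 0 < c ->
  rintegrable (leb n) (fun x => expR (- (c * dot (vec x) (vec x)))).
Proof.
move=> c0; pose g : R := \int[leb1]_s expR (- (c * s ^+ 2)).
have mdd k : measurable_fun setT (fun x : Rn R k => expR (- (c * dot (vec x) (vec x)))).
  apply: measurableT_comp => //; apply: measurableT_comp => //.
  apply: measurable_funM; first exact: measurable_cst.
  have := @measurable_quad R k 1%:M; under eq_fun do rewrite mul1mx; exact.
suff [K HK] : exists K : R,
    (\int[leb n]_x (expR (- (c * dot (vec x) (vec x))))%:E <= K%:E)%E.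
  by have [] := rintegrable_ge0 (mdd n) (fun=> expR_ge0 _) HK.
elim: n => [|n [K IH]].
  exists 1; rewrite /= integral_dirac//; last by apply/measurable_EFinP; exact: (mdd 0%N).
  rewrite diracE mem_set// mul1e lee_fin.
  by rewrite -expR0 ler_expR oppr_le0 mulr_ge0 ?(ltW c0)// dotE big_ord0.
exists (K * g).
rewrite leb_tonelli; [|by apply/measurable_EFinP; exact: (mdd n.+1)|by move=> x; rewrite lee_fin expR_ge0].
have ig : rintegrable leb1 (fun s => expR (- (c * s ^+ 2))) by exact: rintegrable_gauss0.
apply: (@le_trans _ _ (\int[leb1]_s (K * expR (- (c * s ^+ 2)))%:E)%E); last first.
  rewrite (rintegrable_EFin (rintegrableZ K ig)) lee_fin.
  by rewrite (RintegralZl _ measurableT ig).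
apply: ge0_le_integral => //.
- by move=> x _; apply: integral_ge0 => y _; rewrite lee_fin expR_ge0.
- apply: (measurable_fun_fubini_tonelli_F (fun xy => (expR (- (c * dot (vec (tcons xy)) (vec (tcons xy)))))%:E)).
    apply/measurable_EFinP; apply: (measurableT_comp (mdd n.+1)); exact: measurable_tcons.
  by move=> xy; rewrite lee_fin expR_ge0.
- apply/measurable_EFinP; exact: rintegrable_meas (rintegrableZ K ig).
move=> s _.
have e (y : Rn R n) : (expR (- (c * dot (vec (tcons (s, y))) (vec (tcons (s, y))))))%:E =
    ((expR (- (c * s ^+ 2)))%:E * (expR (- (c * dot (vec y) (vec y))))%:E)%E.
  rewrite -EFinM -expRD; congr (expR _)%:E.
  rewrite !dotE big_ord_recl !mxE /tcons tnth0 /= -opprD -mulrDr; congr (- (_ * (_ + _))).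
  by apply: eq_bigr => i _; rewrite !mxE tnthS.
under eq_integral do rewrite e.
rewrite ge0_integralZl ?lee_fin ?expR_ge0//; last first.
  by apply/measurable_EFinP; exact: mdd.
by rewrite EFinM muleC; apply: lee_wpmul2r => //; rewrite lee_fin expR_ge0.
Qed.

Section Quadratic.
Variables (n : nat) (M : 'M[R]_n).
Hypothesis pM : posdef M.

Definition gaussM (x : Rn R n) : R := expR (- dot (vec x) (M *m vec x)).

Lemma measurable_gaussM : measurable_fun setT gaussM.
Proof. by apply: measurableT_comp => //; apply: measurableT_comp => //; exact: measurable_quad. Qed.

Lemma rintegrable_gaussM : rintegrable (leb n) gaussM.
Proof.
have [c c0 hc] := posdef_coercive pM.
apply: rintegrable_le (rintegrable_gauss_leb n c0) _; first exact: measurable_gaussM.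
by move=> x; rewrite ger0_norm ?expR_ge0// ler_expR lerN2.
Qed.

Definition gmass : R := \int[leb n]_x gaussM x.

Lemma gmass_ge0 : 0 <= gmass.
Proof. by apply: Rintegral_ge0 => x _; exact: expR_ge0. Qed.

(** Completing the square: a linear factor only translates the Gaussian. *)
Lemma gaussM_shift (w : 'cV[R]_n) (x : Rn R n) :
  gaussM x * expR (2 * dot (vec x) (M *m w)) =
  expR (dot w (M *m w)) * gaussM (tshift (tvec (- w)) x).
Proof.
rewrite -!expRD vec_tshift tvecK quadD; last exact: pM.1.
rewrite mulmxN !dotN (dotC (- w)) dotN (dotC (M *m w) w); congr expR; ring.
Qed.

Lemma gaussM_linear (w : 'cV[R]_n) :
  rintegrable (leb n) (fun x => gaussM x * expR (2 * dot (vec x) (M *m w))) /\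
  \int[leb n]_x (gaussM x * expR (2 * dot (vec x) (M *m w))) = expR (dot w (M *m w)) * gmass.
Proof.
have := @rintegrable_change _ _ (Rn R n) (Rn R n) R (leb n) (leb n) _ (NngNum (@ler01 R))
  (measurable_tshift (tvec (- w))) (@leb_shift R n _) ltr01 _ rintegrable_gaussM.
have := @Rintegral_change _ _ (Rn R n) (Rn R n) R (leb n) (leb n) _ (NngNum (@ler01 R))
  (measurable_tshift (tvec (- w))) (@leb_shift R n _) ltr01 _ rintegrable_gaussM.
rewrite mul1r => e i; split.
  rewrite (_ : (fun x => _) = (fun x => expR (dot w (M *m w)) * gaussM (tshift (tvec (- w)) x))).
    exact: rintegrableZ i.
  by apply/funext => x; exact: gaussM_shift.
rewrite /gmass e -(RintegralZl _ measurableT i).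
by apply: eq_Rintegral => x _; rewrite gaussM_shift.
Qed.

End Quadratic.
End GaussianTuple.

(** * Multivariate Gaussians along a line *)

Section GaussianLine.
Context {R : realType}.
Local Notation leb1 := (@lebesgue_measure R).
Local Notation RR := (measurableTypeR R).
Variables (n : nat) (M : 'M[R]_n) (a : 'cV[R]_n).
Hypothesis pM : posdef M.
Hypothesis a1 : pi * dot a (M *m a) = 1.

Let y (x : Rn R n) : R := dot (vec x) (M *m a).
Local Notation gauss := (gaussM M).
Local Notation mass := (gmass M).

Lemma sqr_pi (s : R) : (pi * s) ^+ 2 * dot a (M *m a) = pi * s ^+ 2.
Proof.
rewrite (_ : _ * _ = pi * s ^+ 2 * (pi * dot a (M *m a))); last by ring.
by rewrite a1 mulr1.
Qed.

Lemma gaussM_line s :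
  rintegrable (leb n) (fun x => gauss x * expR (2 * pi * s * y x)) /\
  \int[leb n]_x (gauss x * expR (2 * pi * s * y x)) = expR (pi * s ^+ 2) * mass.
Proof.
have [i e] := gaussM_linear pM ((pi * s) *: a).
have yE x : 2 * dot (vec x) (M *m ((pi * s) *: a)) = 2 * pi * s * y x.
  by rewrite -scalemxAr dotZr /y; ring.
split; first by apply: eq_integrable i => // x _ /=; rewrite yE.
transitivity (\int[leb n]_x (gauss x * expR (2 * dot (vec x) (M *m ((pi * s) *: a))))).
  by apply: eq_Rintegral => x _; rewrite yE.
by rewrite e quadZ sqr_pi.
Qed.

(** The Gaussian weight [exp ((1 - r) pi y^2)] is itself a superposition of the
    exponentials [exp (2 pi s y)], whose integrals are known exactly. *)
Lemma gaussM_weight r : 0 < r <= 1 ->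
  rintegrable (leb n) (fun x => gauss x * expR ((1 - r) * (pi * y x ^+ 2))) /\
  \int[leb n]_x (gauss x * expR ((1 - r) * (pi * y x ^+ 2))) <= mass / Num.sqrt r.
Proof.
move=> /andP[r0]; rewrite le_eqVlt => /predU1P[->|r1].
  have e x : gauss x * expR ((1 - 1) * (pi * y x ^+ 2)) = gauss x.
    by rewrite subrr mul0r expR0 mulr1.
  split; first by apply: eq_integrable (rintegrable_gaussM pM) => // x _ /=; rewrite e.
  by rewrite sqrtr1 divr1 (@eq_Rintegral _ _ _ (leb n) setT gauss)// => x _; rewrite e.
have q0 : 0 < 1 - r by rewrite subr_gt0.
pose w := (1 - r)^-1; have w0 : 0 < w by rewrite invr_gt0.
have wE : w - 1 = r * w by rewrite /w; field; exact: lt0r_neq0.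
have rw0 : 0 < w - 1 by rewrite wE mulr_gt0.
have my : measurable_fun setT y by exact: measurable_dot.
have mg := @measurable_gaussM R n M.
apply: rintegrable_ge0.
- apply: measurable_funM => //; apply: measurableT_comp => //.
  by apply: measurable_funM; [exact: measurable_cst|exact: measurable_q].
- by move=> x; rewrite mulr_ge0 ?expR_ge0.
pose G (xs : Rn R n * RR) : R := Num.sqrt w * (gauss xs.1 *
   expR (- (w * (pi * xs.2 ^+ 2)) + y xs.1 * (2 * pi * xs.2))).
have mfst : measurable_fun setT (fun sx : Rn R n * RR => sx.1) by exact: measurable_fst.
have msnd : measurable_fun setT (fun sx : Rn R n * RR => sx.2) by exact: measurable_snd.
have G0 xs : 0 <= G xs by rewrite !mulr_ge0 ?expR_ge0 ?sqrtr_ge0.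
have mG : measurable_fun setT G.
  apply: measurable_funM; first exact: measurable_cst.
  apply: measurable_funM; first exact: measurableT_comp mg mfst.
  apply: measurableT_comp => //; apply: measurable_funD.
    apply: measurableT_comp => //; apply: measurable_funM; first exact: measurable_cst.
    exact: measurableT_comp (measurable_sqr pi) msnd.
  apply: measurable_funM; first exact: measurableT_comp my mfst.
  exact: measurableT_comp (measurable_lin (2 * pi)) msnd.
have e1 x : (gauss x * expR ((1 - r) * (pi * y x ^+ 2)))%:E = (\int[leb1]_s (G (x, s))%:E)%E.
  have i1 := rintegrable_rgauss_lin (y x) w0.
  have i2 : rintegrable leb1 (fun s => gauss x * expR (- (w * (pi * s ^+ 2)) + y x * (2 * pi * s))).
    exact: rintegrableZ i1.
  have i3 : rintegrable leb1 (fun s => G (x, s)) by exact: rintegrableZ i2.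
  rewrite (rintegrable_EFin i3) (RintegralZl _ measurableT i2) (RintegralZl _ measurableT i1).
  rewrite Rintegral_rgauss_lin// /w invrK; congr EFin.
  have : Num.sqrt w != 0 by rewrite gt_eqF// sqrtr_gt0.
  rewrite /w; set q := Num.sqrt _ => q1.
  rewrite [RHS]mulrCA mulVKf//; congr (_ * expR _); ring.
have e2 s : (\int[leb n]_x (G (x, s))%:E)%E = (Num.sqrt w * mass * expR (- ((w - 1) * (pi * s ^+ 2))))%:E.
  have [i ei] := gaussM_line s.
  have Ge x : G (x, s) = (Num.sqrt w * expR (- (w * (pi * s ^+ 2)))) * (gauss x * expR (2 * pi * s * y x)).
    by rewrite /G expRD (mulrC (y x)) /=; ring.
  under eq_integral do rewrite Ge.
  have iz := rintegrableZ (Num.sqrt w * expR (- (w * (pi * s ^+ 2)))) i.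
  rewrite (rintegrable_EFin iz) (RintegralZl _ measurableT i) ei; congr EFin.
  rewrite (_ : - ((w - 1) * (pi * s ^+ 2)) = - (w * (pi * s ^+ 2)) + pi * s ^+ 2); last by ring.
  by rewrite expRD; ring.
under eq_integral do rewrite e1.
rewrite (fubini_tonelli (fun xs => (G xs)%:E)); last 2 first.
- by apply/measurable_EFinP.
- by move=> xs; rewrite lee_fin.
under eq_integral do rewrite e2.
have i2 := rintegrable_rgauss rw0.
have iz := rintegrableZ (Num.sqrt w * mass) i2.
rewrite (rintegrable_EFin iz) (RintegralZl _ measurableT i2) lee_fin.
rewrite Rintegral_rgauss// wE sqrtrM ?(ltW r0)//.
have : Num.sqrt w != 0 by rewrite gt_eqF// sqrtr_gt0.
have : Num.sqrt r != 0 by rewrite gt_eqF// sqrtr_gt0.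
set p := Num.sqrt w; set q := Num.sqrt r => q1 p1.
by rewrite le_eqVlt; apply/orP; left; apply/eqP; field; rewrite p1 q1.
Qed.

(** For [y] normalised by [pi a.M a = 1] the image of the Gaussian under [y]
    is exactly critical. *)
Lemma gauss_type_gaussM (nu : Rn R n -> R[i]) K : cmeas nu ->
  (forall x, normc (nu x) <= K * gauss x) -> gauss_type (leb n) nu y (K * mass).
Proof.
move=> mnu nuK; have my : measurable_fun setT y by exact: measurable_dot.
have K0 : 0 <= K.
  have := le_trans (normc_ge0 _) (nuK (tvec 0)).
  by rewrite pmulr_lge0// expR_gt0.
split=> // r r01; have [i h] := gaussM_weight r01.
have le1 x : normc (nu x) * expR ((1 - r) * (pi * y x ^+ 2)) <=
    K * (gauss x * expR ((1 - r) * (pi * y x ^+ 2))).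
  by rewrite mulrA ler_wpM2r ?expR_ge0.
have i' : rintegrable (leb n) (fun x => normc (nu x) * expR ((1 - r) * (pi * y x ^+ 2))).
  apply: rintegrable_le (rintegrableZ K i) _.
    apply: measurable_funM; first exact: measurable_normc.
    apply: measurableT_comp => //.
    by apply: measurable_funM; [exact: measurable_cst|exact: measurable_q].
  by move=> x; rewrite ger0_norm ?mulr_ge0 ?expR_ge0 ?normc_ge0.
split => //; rewrite -mulrA; apply: (@le_trans _ _ (K * \int[leb n]_x (gauss x * expR ((1 - r) * (pi * y x ^+ 2))))).
  rewrite -(RintegralZl _ measurableT i); apply: le_Rintegral => //.
  exact: (rintegrableZ K i).
by rewrite ler_wpM2l.
Qed.

(** The Gaussian restricted to a line has a Gaussian transform, because
    translating along [a] multiplies it by an exponential. *)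
Lemma fline_gaussM s :
  fline (leb n) (fun x => (gauss x)%:C) y s = (mass * expR (- (pi * s ^+ 2)))%:C.
Proof.
have my : measurable_fun setT y by exact: measurable_dot.
have mg := @measurable_gaussM R n M.
pose J := laplace (leb n) (fun x => (gauss x)%:C) (fun x => 2 * pi * y x).
have J0 : J 0 = mass%:C.
  by rewrite -cint_real; apply: eq_cint => x; rewrite mul0r oppr0 cexp0 mulr1.
pose G0 r (x : Rn R n) := gauss x * expR (2 * pi * (r + 1) * y x) + gauss x * expR (2 * pi * (- (r + 1)) * y x).
have iG0 r : rintegrable (leb n) (G0 r) by apply: rintegrableD; apply: (gaussM_line _).1.
have G0le r (b : R) x : `|b| <= r -> gauss x * expR (- b * (2 * pi * y x) + 1 * `|2 * pi * y x|) <= G0 r x.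
  move=> br; rewrite /G0 -mulrDr ler_wpM2l ?expR_ge0//.
  have : - b * (2 * pi * y x) + 1 * `|2 * pi * y x| <= (r + 1) * `|2 * pi * y x|.
    rewrite [leRHS]mulrDl lerD2r; apply: le_trans (ler_norm _) _.
    by rewrite normrM normrN ler_wpM2r.
  rewrite -ler_expR => /le_trans; apply.
  have [y0|y0] := leP 0 (2 * pi * y x).
    rewrite (ger0_norm y0) (_ : (r + 1) * _ = 2 * pi * (r + 1) * y x); last by ring.
    by rewrite lerDl expR_ge0.
  rewrite (ltr0_norm y0) (_ : (r + 1) * _ = 2 * pi * - (r + 1) * y x); last by ring.
  by rewrite lerDr expR_ge0.
have holJ r : exists J', hol (cdisc 0 r) J J'.
  eexists; apply: laplace_hol (iG0 r) _; [exact: ltr01|exact: cmeas_real| |].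
    by apply: measurable_funM => //; exact: measurable_cst.
  move=> z x; rewrite /cdisc subr0 => zr.
  rewrite normc_real ger0_norm ?expR_ge0//; apply: G0le.
  exact: le_trans (ler_normc_Re _) zr.
have iJ z : cintegrable (leb n) (fun x => (gauss x)%:C * cexp (- (z * (2 * pi * y x)%:C))).
  apply: cintegrable_le (iG0 (normc z)) _.
    apply: laplace_meas; first exact: cmeas_real.
    by apply: measurable_funM => //; exact: measurable_cst.
  move=> x; rewrite normcM normc_real ger0_norm ?expR_ge0// normc_laplace_kernel.
  apply: le_trans (G0le (normc z) (complex.Re z) x (ler_normc_Re _)).
  by rewrite ler_wpM2l ?expR_ge0// ler_expR lerDl mul1r.
have shJ (h : R) z : J z = cexp (- (1 * (pi * h ^+ 2)%:C) - z * (2 * pi * h)%:C) * J (z + 1 * h%:C).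
  have := @cint_change _ _ (Rn R n) (Rn R n) R (leb n) (leb n) _ (NngNum (@ler01 R))
    (measurable_tshift (tvec ((pi * h) *: a))) (@leb_shift R n _) ltr01 _ (iJ z).
  rewrite (mul1r (cint _ _)) /J /laplace => ->; rewrite -cintZ; last exact: iJ.
  apply: eq_cint => x; rewrite -!cexp_real -!cexpD; congr cexp.
  rewrite vec_tshift tvecK quadD; last exact: pM.1.
  rewrite quadZ -scalemxAr dotZr /y vec_tshift tvecK dotDl dotZl.
  have -> : (pi * h) * dot a (M *m a) = h by rewrite mulrAC a1 mul1r.
  have -> : (pi * h) ^+ 2 * dot a (M *m a) = pi * h ^+ 2.
    exact: sqr_pi.
  set t := dot (vec x) (M *m a); set u := dot _ _.
  by apply: complex_ext; rewrite ?Re_add ?Im_add ?Re_opp ?Im_opp ?Re_mul ?Im_mul /= ?Re_add ?Im_add ?Re_mul ?Im_mul /=; ring.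
have := gauss_of_shift (0 +i* s) (oner_neq0 _) holJ shJ.
rewrite J0 /fline -/y => h; transitivity (J (0 +i* s)) => //.
rewrite h rmorphM /=; congr (_ * _); rewrite -cexp_real; congr cexp.
by rewrite divr1 expr2; apply: complex_ext; rewrite ?Re_mul ?Im_mul /= ?Re_mul ?Im_mul /=; ring.
Qed.

End GaussianLine.

(** * Measures with vanishing Fourier transform *)

Section PiLambda.
Context d d' (T : measurableType d) (S : measurableType d') {R : realType}.
Variables (mu : {measure set T -> \bar R}) (p : T -> S) (u : T -> R) (G : set (set S)).

(** The sets over which the integral vanishes form a Dynkin system. *)
Lemma Rintegral_pi_lambda : measurable_fun setT p -> rintegrable mu u ->
  @measurable _ S = <<s G >> -> setI_closed G -> \int[mu]_x u x = 0 ->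
  (forall A, G A -> \int[mu]_(x in p @^-1` A) u x = 0) ->
  forall A, measurable A -> \int[mu]_(x in p @^-1` A) u x = 0.
Proof.
move=> mp iu mG GI uT uG A; rewrite mG; move: A.
have mpA A : measurable A -> measurable (p @^-1` A).
  by move=> mA; rewrite -[X in measurable X]setTI; exact: mp.
have iuB B : measurable B -> mu.-integrable B (EFin \o u).
  by move=> mB; apply: integrableS iu.
pose P A := \int[mu]_(x in p @^-1` A) u x = 0.
apply: (dynkin_induction (P := P)) => //.
- rewrite /P => A mA uA.
  have := @Rintegral_setU _ _ _ mu (p @^-1` A) (p @^-1` (~` A)) u (mpA _ mA) (mpA _ (measurableC mA)).
  rewrite -preimage_setU setUv preimage_setT uT uA add0r => /(_ iu) <-//.
  by rewrite disj_set2E -preimage_setI setICr preimage_set0.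
- rewrite /P => F mF tF uF; rewrite preimage_bigcup /Rintegral integral_bigcup//.
  + rewrite eseries0// => k _ _.
    have fk := integrable_fin_num (mpA _ (mF k)) (iuB _ (mpA _ (mF k))).
    by rewrite -(fineK fk); congr (_%:E); exact: uF.
  + by apply/trivIsetP => i j _ _ ij; rewrite -preimage_setI; move/trivIsetP : tF => ->.
  + by move=> k; exact: mpA.
  + by apply: iuB; apply: bigcupT_measurable => k; exact: mpA.
Qed.

End PiLambda.

Section Injectivity.
Context d (T : measurableType d) {R : realType} (mu : {sigma_finite_measure set T -> \bar R}).
Local Notation leb1 := (@lebesgue_measure R).
Local Notation RR := (measurableTypeR R).
Variables (g : T -> R[i]) (p : T -> R).
Hypothesis ig : cintegrable mu g.
Hypothesis mp : measurable_fun setT p.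
Hypothesis g0 : forall s, fline mu g p s = 0.

Let mg := cintegrable_meas ig.
Let ing := rintegrable_normc ig.

Lemma fline_shift (c s : R) : fline mu g (fun x => p x - c) s =
  cexp ((0 +i* s) * (2 * pi * c)%:C) * fline mu g p s.
Proof.
rewrite /fline -cintZ; last exact: fline_integrable.
apply: eq_cint => x; rewrite [RHS]mulrCA -cexpD; congr (_ * cexp _).
by apply: complex_ext; rewrite ?Re_add ?Im_add ?Re_opp ?Im_opp ?Re_mul ?Im_mul /=; ring.
Qed.

(** Translated Gaussians of [p] are averages of the vanishing transform. *)
Lemma mean_gauss_eq0 (e c : R) : 0 < e ->
  cint mu (fun x => g x * (expR (- (e^-1 ^+ 2 * (pi * (p x - c) ^+ 2))))%:C) = 0.
Proof.
move=> e0; pose w : R[i] := (e ^+ 2)%:C.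
have w0 : 0 < complex.Re w by rewrite /= exprn_gt0.
have mpc : measurable_fun setT (fun x => p x - c) by apply: measurable_funB => //; exact: measurable_cst.
have i0 : rintegrable mu (fun x => normc ((p x - c)%:C ^+ 0 * g x)).
  by apply: eq_integrable ing => // x _ /=; rewrite expr0 mul1r.
have := fline_duality mg mpc ing i0 (leq0n 1) w0.
rewrite !expr0 !mul1r /laplace => h.
have gn0 : gauss_int w != 0.
  by apply/eqP => gw; have := gauss_int_sqr w0; rewrite gw expr0n mulr0 => /esym/eqP; rewrite oner_eq0.
apply: (mulfI gn0); rewrite mulr0; transitivity (gauss_int w *
    cint mu (fun x => (p x - c)%:C ^+ 0 * g x * cexp (- (w^-1 * (pi * (p x - c) ^+ 2)%:C)))).
  congr (_ * _); apply: eq_cint => x; rewrite expr0 mul1r -cexp_real; congr (_ * cexp _).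
  by rewrite /w rmorphN rmorphM /= exprVn fmorphV.
rewrite -h; transitivity (cint leb1 (fun s : RR => (0 : R)%:C)).
  by apply: eq_cint => s; rewrite fline_shift g0 mulr0 mulr0 mul0r.
by rewrite cint_real Rintegral_cst// mul0r.
Qed.

Lemma Rintegral_rgauss1 : \int[leb1]_s expR (- (pi * s ^+ 2)) = 1.
Proof.
rewrite -[RHS]invr1 -[in RHS](sqrtr1 R) -(Rintegral_rgauss ltr01).
by apply: eq_Rintegral => s _; rewrite mul1r.
Qed.

(** Mollification by narrow Gaussians moves a Lipschitz function by a small
    amount, and mollified functions are annihilated. *)
Lemma mean_lipschitz_eq0 (f : R -> R) (L : R) : rintegrable leb1 (f : RR -> R) ->
  (forall s t, `|f s - f t| <= L * `|s - t|) -> (forall t, `|f t| <= 1) ->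
  cint mu (fun x => g x * (f (p x))%:C) = 0.
Proof.
move=> i_f fL f1; have mf := rintegrable_meas i_f.
pose ker (s : R) := expR (- (pi * s ^+ 2)).
have iker : rintegrable leb1 (ker : RR -> R).
  by apply: eq_integrable (rintegrable_rgauss ltr01) => // s _ /=; rewrite mul1r.
have iker1 : rintegrable leb1 ((fun s => `|s| * ker s) : RR -> R).
  apply: rintegrable_le (rintegrable_gauss 1 (pi_gt0 R)) _.
    by apply: measurable_funM; [exact: normr_measurable|exact: rintegrable_meas iker].
  move=> s; rewrite ger0_norm ?mulr_ge0 ?expR_ge0// expRD mul1r mulrC ler_wpM2l ?expR_ge0//.
  by have := expR_ge1Dx `|s|; lra.
pose c1 := \int[leb1]_s (`|s| * ker s).
have mmol e t : measurable_fun setT ((fun s : RR => f (e * s + t) * ker s) : RR -> R).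
  apply: measurable_funM; last exact: rintegrable_meas iker.
  exact: (measurableT_comp mf (measurable_affine e t)).
have imol e t : rintegrable leb1 ((fun s : RR => f (e * s + t) * ker s) : RR -> R).
  apply: rintegrable_le iker _ => // s.
  by rewrite normrM [`|ker s|]ger0_norm ?expR_ge0// ler_piMl ?expR_ge0.
pose mol e t := \int[leb1]_s (f (e * s + t) * ker s).
have molE e t : 0 < e -> `|mol e t - f t| <= L * e * c1.
  move=> e0; rewrite -[f t]mulr1 -Rintegral_rgauss1 -/ker -(RintegralZl _ measurableT iker).
  have idf : rintegrable leb1 (fun s : RR => f (e * s + t) * ker s - f t * ker s).
    apply: eq_integrable (rintegrableD (imol e t) (rintegrableZ (- f t) iker)) => // s _ /=.
    by rewrite mulNr.
  rewrite -RintegralB; [|by []|exact: imol|exact: rintegrableZ].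
  apply: le_trans (le_normr_Rintegral _ idf) _ => //.
  rewrite /c1 -(RintegralZl _ measurableT iker1).
  apply: le_Rintegral => //.
  - exact: rintegrable_norm.
  - exact: rintegrableZ.
  move=> s _; rewrite -mulrBl normrM [`|ker s|]ger0_norm ?expR_ge0// mulrA ler_wpM2r ?expR_ge0//.
  by apply: le_trans (fL _ _) _; rewrite addrK normrM gtr0_norm// mulrA.
have imolx e : 0 < e -> cintegrable mu (fun x => g x * (mol e (p x))%:C).
  move=> e0. apply: (cintegrable_le (b := fun x => (1 + `|L * e * c1|) * normc (g x))).
  - apply: cmeasM => //; apply: cmeas_real.
    apply: (measurableT_comp _ mp).
    apply: (@lipschitz_measurable _ _ L) => s t.
    rewrite /mol -RintegralB; [|by []|exact: imol|exact: imol].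
    have idf : rintegrable leb1 (fun u : RR => f (e * u + s) * ker u - f (e * u + t) * ker u).
      apply: eq_integrable (rintegrableD (imol e s) (rintegrableZ (-1) (imol e t))) => // u _ /=.
      by rewrite mulN1r.
    apply: le_trans (le_normr_Rintegral _ idf) _ => //.
    rewrite -[leRHS]mulr1 -Rintegral_rgauss1 -(RintegralZl _ measurableT iker).
    apply: le_Rintegral => //; [exact: rintegrable_norm|exact: rintegrableZ|].
    move=> u _; rewrite -mulrBl normrM [`|ker u|]ger0_norm ?expR_ge0// ler_wpM2r ?expR_ge0//.
    by apply: le_trans (fL _ _) _; rewrite opprD addrACA subrr add0r.
  - exact: rintegrableZ.
  move=> x; rewrite normcM normc_real mulrC ler_wpM2r ?normc_ge0//.
  rewrite -[mol e (p x)](subrK (f (p x))) addrC; apply: le_trans (ler_normD _ _) _.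
  by apply: lerD => //; apply: le_trans (molE e (p x) e0) (ler_norm _).
have mol0 e : 0 < e -> cint mu (fun x => g x * (mol e (p x))%:C) = 0.
  move=> e0; have en0 : e != 0 by rewrite gt_eqF.
  have molE2 t : mol e t = e^-1 * \int[leb1]_u (f u * expR (- (e^-1 ^+ 2 * (pi * (t - u) ^+ 2)))).
    pose a u := f u * expR (- (e^-1 ^+ 2 * (pi * (t - u) ^+ 2))).
    have ia : rintegrable leb1 (a : RR -> R).
      apply: rintegrable_le (rintegrable_norm i_f) _ => [|u].
        apply: measurable_funM => //; apply: measurableT_comp => //; apply: measurableT_comp => //.
        apply: measurable_funM; first exact: measurable_cst.
        by apply: measurable_q; apply: measurable_funB => //; exact: measurable_cst.
      rewrite normrM ler_piMr// ger0_norm ?expR_ge0// -expR0 ler_expR oppr_le0.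
      by rewrite mulr_ge0 ?sqr_ge0// mulr_ge0 ?pi_ge0 ?sqr_ge0.
    rewrite (@Rintegral_change _ _ RR RR R leb1 leb1 _ (NngNum (ltW e0)) (measurable_affine e t)
      (@lebesgue_affine R e t e0) e0 a ia) /= mulKf//.
    apply: eq_Rintegral => v _; rewrite /a /ker; congr (_ * expR (- _)).
    by field.
  pose F (xu : T * RR) : R[i] := g xu.1 * (f xu.2 * expR (- (e^-1 ^+ 2 * (pi * (p xu.1 - xu.2) ^+ 2))))%:C.
  have mF : cmeas F.
    have mfst : measurable_fun setT (fun xu : T * RR => xu.1) by exact: measurable_fst.
    have msnd : measurable_fun setT (fun xu : T * RR => xu.2) by exact: measurable_snd.
    apply: cmeasM.
      by split; [exact: measurableT_comp mg.1 mfst|exact: measurableT_comp mg.2 mfst].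
    apply: cmeas_real; apply: measurable_funM; first exact: measurableT_comp mf msnd.
    apply: measurableT_comp => //; apply: measurableT_comp => //.
    apply: measurable_funM; first exact: measurable_cst.
    apply: measurable_q; apply: measurable_funB => //; exact: measurableT_comp mp mfst.
  have Fle x u : normc (F (x, u)) <= normc (g x) * `|f u|.
    rewrite normcM normc_real ler_wpM2l ?normc_ge0// normrM ler_piMr//.
    rewrite ger0_norm ?expR_ge0// -expR0 ler_expR oppr_le0.
    by rewrite mulr_ge0 ?sqr_ge0// mulr_ge0 ?pi_ge0 ?sqr_ge0.
  have := cint_fubini mF ing (rintegrable_norm i_f) Fle.
  have -> : cint leb1 (fun u : RR => cint mu (fun x => F (x, u))) = 0.
    transitivity (cint leb1 (fun u : RR => (0 : R)%:C)).
      apply: eq_cint => u; rewrite -[RHS](mulr0 (f u)%:C) -(mean_gauss_eq0 u e0) -cintZ; last first.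
        apply: cintegrable_le ing _ => [|x].
          apply: cmeasM => //; apply: cmeas_real; apply: measurableT_comp => //; apply: measurableT_comp => //.
          apply: measurable_funM; first exact: measurable_cst.
          by apply: measurable_q; apply: measurable_funB => //; exact: measurable_cst.
        rewrite normcM normc_real ler_piMr ?normc_ge0// ger0_norm ?expR_ge0// -expR0 ler_expR oppr_le0.
        by rewrite mulr_ge0 ?sqr_ge0// mulr_ge0 ?pi_ge0 ?sqr_ge0.
      by apply: eq_cint => x; rewrite /F /= rmorphM /= mulrCA.
    by rewrite cint_real Rintegral_cst// mul0r.
  have FE x : cint leb1 (fun u : RR => F (x, u)) = e%:C * (g x * (mol e (p x))%:C).
    have ifk : cintegrable leb1 (fun u : RR => (f u * expR (- (e^-1 ^+ 2 * (pi * (p x - u) ^+ 2))))%:C).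
      apply: cintegrable_le (rintegrable_norm i_f) _ => [|u].
        apply: cmeas_real; apply: measurable_funM => //; apply: measurableT_comp => //; apply: measurableT_comp => //.
        apply: measurable_funM; first exact: measurable_cst.
        by apply: measurable_q; apply: measurable_funB => //; exact: measurable_cst.
      rewrite normc_real normrM ler_piMr// ger0_norm ?expR_ge0// -expR0 ler_expR oppr_le0.
      by rewrite mulr_ge0 ?sqr_ge0// mulr_ge0 ?pi_ge0 ?sqr_ge0.
    rewrite /F /= (cintZ (g x) ifk) cint_real molE2 mulrCA; congr (_ * _).
    by rewrite -rmorphM /= mulVKf.
  rewrite (eq_cint _ FE) (cintZ _ (imolx e e0)) => /eqP.
  by rewrite mulf_eq0 (inj_eq (@complexI R)) (negPf en0) => /eqP.
suff n0 : normc (cint mu (fun x => g x * (f (p x))%:C)) <= 0.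
  by apply/eqP; rewrite -normc_eq0 eq_le n0 normc_ge0.
pose I := \int[mu]_x normc (g x).
apply: (@le0_mul_small _ _ (L * c1 * I)) => e e0.
have igf : cintegrable mu (fun x => g x * (f (p x))%:C).
  apply: (cintegrable_le _ ing) => [|x].
    by apply: cmeasM => //; apply: cmeas_real; exact: measurableT_comp mf mp.
  by rewrite normcM normc_real ler_piMr ?normc_ge0.
rewrite -[cint mu _]subr0 -(mol0 e e0) -cintB//; last exact: imolx.
have := @normc_cint_le _ _ _ mu (fun x => g x * (f (p x))%:C - g x * (mol e (p x))%:C)
  (fun x => (L * e * c1) * normc (g x)) (cintegrable_meas (cintegrableB igf (imolx e e0))) (rintegrableZ _ ing).
rewrite (RintegralZl _ measurableT ing) => h; apply: le_trans (h _) _; last by rewrite /I; nra.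
move=> x; rewrite -mulrBr -rmorphB normcM normc_real distrC mulrC ler_wpM2r ?normc_ge0//.
exact: molE.
Qed.

End Injectivity.

Section Ramp.
Context {R : realType}.
Implicit Types c t : R.

(** Trapezoid equal to 1 on [c, c + k + 1] with a steep rise before [c] and
    a descent that moves to infinity: a Lipschitz integrable approximation of
    the indicator of a closed ray. *)
Definition ramp c (k : nat) t : R :=
  Num.max 0 (Num.min 1 (Num.min (1 + k.+1%:R * (t - c)) (1 + (c + k.+1%:R - t)))).

Lemma ramp_ge0 c k t : 0 <= ramp c k t.
Proof. by rewrite le_max lexx. Qed.

Lemma ramp_le1 c k t : ramp c k t <= 1.
Proof. by rewrite ge_max ler01 ge_min lexx. Qed.

Lemma ramp_lip c k s t : `|ramp c k s - ramp c k t| <= k.+1%:R * `|s - t|.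
Proof.
have k1 : 1 <= k.+1%:R :> R by rewrite ler1n.
set K := k.+1%:R in k1 *.
have nm (a b e d : R) : `|a - b| <= d -> `|Num.max e a - Num.max e b| <= d.
  move=> h; apply: le_trans h; rewrite ler_norml.
  by have := ler_norm (a - b); have := ler_norm (- (a - b)); rewrite normrN;
    case: (leP e a); case: (leP e b); lra.
have nn (a b a' b' d : R) : `|a - b| <= d -> `|a' - b'| <= d ->
    `|Num.min a a' - Num.min b b'| <= d.
  by rewrite !ler_norml; case: (leP a a'); case: (leP b b'); lra.
have n0 : 0 <= `|s - t| by [].
have ns := ler_norm (s - t); have nt := ler_norm (- (s - t)); rewrite normrN in nt.
rewrite /ramp; apply: (nm); apply: (nn); first by rewrite subrr normr0; nra.
apply: (nn); first by rewrite ler_norml; apply/andP; split; nra.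
by rewrite ler_norml; apply/andP; split; nra.
Qed.

Lemma ramp_integrable c k : rintegrable (@lebesgue_measure R) (ramp c k : measurableTypeR R -> R).
Proof.
pose b := `|c| + k.+1%:R + 1.
apply: rintegrable_le (rintegrableZ (expR (b ^+ 2)) (rintegrable_gauss0 (ltr01 : 0 < 1 :> R))) _.
  exact: lipschitz_measurable (ramp_lip c k).
move=> t; rewrite ger0_norm ?ramp_ge0// -expRD mul1r.
have k1 : 1 <= k.+1%:R :> R by rewrite ler1n.
have ncp := ler_norm c; have ncn := ler_norm (- c); rewrite normrN in ncn.
have [h|h] := leP (ramp c k t) 0; first by rewrite (le_trans h)// expR_ge0.
apply: le_trans (ramp_le1 _ _ _) _; rewrite -expR0 ler_expR subr_ge0.
have b0 : 0 <= b by rewrite /b; lra.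
rewrite -(real_normK (num_real t)) lerXn2r ?nnegrE//.
move: h; rewrite /ramp lt_max ltxx/= lt_min ltr01/= lt_min => /andP[h1 h2].
rewrite ler_norml /b; apply/andP; split; last by lra.
have : -1 <= t - c by nra.
lra.
Qed.

Lemma ramp_cvg c t : ramp c k t @[k --> \oo] --> (\1_(`[c, +oo[%classic : set R) t : R).
Proof.
apply: cvg_near_cst; rewrite indicE.
have [ct|tc] := leP c t.
  near=> k; rewrite mem_set; last by rewrite /= in_itv/= andbT.
  have : t - c <= k.+1%:R.
    near: k; exists (Num.truncn `|t - c|) => // k /= hk.
    apply: le_trans (ler_norm _) _; rewrite ltW//.
    have := truncnS_gt `|t - c|; move/lt_le_trans; apply.
    by rewrite ler_nat.
  move=> h; apply/eqP; rewrite /ramp (min_idPl _).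
    by rewrite (max_idPr _)// ler01.
  by rewrite le_min; apply/andP; split; [rewrite lerDl mulr_ge0 ?ler0n//; lra|lra].
near=> k; rewrite memNset; last by rewrite /= in_itv/= andbT => /(lt_le_trans tc); rewrite ltxx.
apply/eqP; rewrite /ramp (max_idPl _)// ge_min; apply/orP; right; rewrite ge_min; apply/orP; left.
have : (c - t)^-1 <= k.+1%:R.
  near: k; exists (Num.truncn (c - t)^-1) => // k /= hk.
  have := truncnS_gt (c - t)^-1; move=> /ltW/le_trans; apply.
  by rewrite ler_nat.
have ct0 : 0 < c - t by rewrite subr_gt0.
by rewrite -(ler_pM2r ct0) mulVf ?gt_eqF//; nra.
Unshelve. all: by end_near. Qed.

End Ramp.

Section Borel.
Context d (T : measurableType d) {R : realType} (mu : {sigma_finite_measure set T -> \bar R}).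
Local Notation RR := (measurableTypeR R).
Variables (g : T -> R[i]) (p : T -> R).
Hypothesis ig : cintegrable mu g.
Hypothesis mp : measurable_fun setT p.
Hypothesis g0 : forall s, fline mu g p s = 0.

Let part_borel (u : T -> R) : rintegrable mu u -> \int[mu]_x u x = 0 ->
  (forall c k, \int[mu]_x (u x * ramp c k (p x)) = 0) ->
  forall A : set RR, measurable A -> \int[mu]_(x in p @^-1` A) u x = 0.
Proof.
move=> iu u0 ur; have mu_ := rintegrable_meas iu.
apply: (@Rintegral_pi_lambda _ _ T RR R mu p u (@RGenCInfty.G R)) => //.
- exact: RGenCInfty.measurableE.
- move=> _ _ [a ->] [b ->]; exists (Num.max a b).
  apply/seteqP; split => t /=; rewrite !in_itv/= !andbT ge_max; first by move=> [-> ->].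
  by move/andP.
move=> _ [c ->]; rewrite Rintegral_mkcond patch_indic.
have mr k : measurable_fun setT (fun x => u x * ramp c k (p x)).
  apply: measurable_funM => //; apply: measurableT_comp mp.
  exact: lipschitz_measurable (ramp_lip c k).
pose v k x := u x * ramp c k (p x).
have mE k : measurable_fun setT (EFin \o v k).
  by apply/measurable_EFinP; exact: mr.
have mI : measurable (p @^-1` (`[c, +oo[%classic : set RR)).
  by rewrite -[X in measurable X]setTI; exact: mp.
have mf : measurable_fun setT (EFin \o (u \* \1_(p @^-1` (`[c, +oo[%classic : set R)))).
  by apply/measurable_EFinP; apply: measurable_funM => //; exact: measurable_indic.
have cv : {ae mu, forall x, [set: T] x -> (fun k => (EFin \o v k) x)
    @ \oo --> (EFin \o (u \* \1_(p @^-1` (`[c, +oo[%classic : set R)))) x}.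
  apply: aeW => x _; apply: cvg_EFin; first exact: nearW.
  by apply: cvgM; [exact: cvg_cst|exact: ramp_cvg].
have dm : {ae mu, forall x k, [set: T] x -> (`|(EFin \o v k) x| <= `|(EFin \o u) x|)%E}.
  apply: aeW => x k _ /=; rewrite lee_fin /v normrM ler_piMr//.
  by rewrite ger0_norm ?ramp_ge0// ramp_le1.
have [_ _] := dominated_convergence measurableT mE mf cv (integrable_abse iu) dm.
have -> : [sequence (\int[mu]_x ((EFin \o v n) x))%E]_n = cst 0%E.
  apply/funext => k /=.
  have ik : rintegrable mu (v k).
    apply: rintegrable_le (mr k) (rintegrable_norm iu) _ => x.
    by rewrite /v normrM ler_piMr// ger0_norm ?ramp_ge0// ramp_le1.
  by rewrite (rintegrable_EFin ik) ur.
by move=> /cvg_lim; rewrite lim_cst// => h; rewrite /Rintegral -h.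
Qed.

Let ramped c k : cint mu (fun x => g x * (ramp c k (p x))%:C) = 0.
Proof.
apply: (mean_lipschitz_eq0 ig mp g0 (ramp_integrable c k) (@ramp_lip _ c k)) => t.
by rewrite ger0_norm ?ramp_ge0 ?ramp_le1.
Qed.

(** Ramps give closed rays by dominated convergence, and closed rays generate
    the Borel sets. *)
Lemma fline_eq0_borel (A : set RR) : measurable A ->
  cintegrable mu (fun x => g x * (\1_A (p x))%:C) /\
  cint mu (fun x => g x * (\1_A (p x))%:C) = 0.
Proof.
move=> mA; have [g1 g2] := ig.
have c0 : cint mu g = 0.
  rewrite -(g0 0); apply: eq_cint => x.
  by rewrite mul0r oppr0 cexp0 mulr1.
split.
  apply: cintegrable_le (rintegrable_normc ig) _ => [|x].
    apply: cmeasM; first exact: (cintegrable_meas ig).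
    by apply: cmeas_real; apply: measurableT_comp mp; exact: measurable_indic.
  rewrite normcM normc_real ler_piMr ?normc_ge0// indicE ger0_norm ?ler0n//.
  by case: (_ \in _).
apply: complex_ext => /=.
  transitivity (\int[mu]_(x in p @^-1` A) complex.Re (g x)).
    rewrite [RHS]Rintegral_mkcond patch_indic; apply: eq_Rintegral => x _.
    by rewrite Re_mul /= mulr0 subr0.
  apply: (part_borel g1) => //; first by rewrite -Re_cint c0.
  move=> c k; have h := ramped c k; rewrite -[RHS]/(complex.Re (0 : R[i])) -h.
  by apply: eq_Rintegral => x _; rewrite Re_mul /= mulr0 subr0.
transitivity (\int[mu]_(x in p @^-1` A) complex.Im (g x)).
  rewrite [RHS]Rintegral_mkcond patch_indic; apply: eq_Rintegral => x _.
  by rewrite Im_mul /= mulr0 add0r.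
apply: (part_borel g2) => //; first by rewrite -[RHS]/(complex.Im (0 : R[i])) -c0.
move=> c k; have h := ramped c k; rewrite -[RHS]/(complex.Im (0 : R[i])) -h.
by apply: eq_Rintegral => x _; rewrite Im_mul /= mulr0 add0r.
Qed.

End Borel.

(** * Injectivity of the Fourier transform in several variables *)

Section FourierTuple.
Context {R : realType} {n : nat}.
Local Notation RR := (measurableTypeR R).
Implicit Types (h : Rn R n -> R[i]) (v w : 'cV[R]_n).

Definition chi w (x : Rn R n) : R[i] := cexp (- ((0 +i* 1) * (2 * pi * dot (vec x) w)%:C)).

Definition ft h v : R[i] := cint (leb n) (fun x => h x * chi v x).

Lemma chiD v w x : chi (v + w) x = chi v x * chi w x.
Proof.
rewrite /chi -cexpD dotDr; congr cexp.
by apply: complex_ext; rewrite ?Re_add ?Im_add ?Re_opp ?Im_opp ?Re_mul ?Im_mul /=; ring.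
Qed.

Lemma chi0 x : chi 0 x = 1.
Proof.
rewrite /chi dotE big1 => [|i _]; last by rewrite [X in _ * X]mxE mulr0.
by rewrite mulr0 mulr0 oppr0 cexp0.
Qed.

Lemma normc_chi w x : normc (chi w x) = 1.
Proof. exact: normc_character. Qed.

Lemma measurable_chi w : cmeas (chi w).
Proof.
apply: cmeas_exp; apply: cmeasN; apply: cmeasM; first exact: cmeas_cst.
apply: cmeas_real; apply: measurable_funM; first exact: measurable_cst.
exact: measurable_dot.
Qed.

Lemma cintegrable_chi h w : cintegrable (leb n) h -> cintegrable (leb n) (fun x => h x * chi w x).
Proof.
move=> ih; apply: cintegrable_le (rintegrable_normc ih) _ => [|x].
  by apply: cmeasM; [exact: (cintegrable_meas ih)|exact: measurable_chi].
by rewrite normcM normc_chi mulr1.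
Qed.

Lemma fline_ft h w v s :
  fline (leb n) (fun x => h x * chi w x) (fun x => dot (vec x) v) s = ft h (w + s *: v).
Proof.
apply: eq_cint => x; rewrite chiD -[LHS]mulrA; congr (_ * (_ * cexp (- _))).
by rewrite dotZr; apply: complex_ext; rewrite ?Re_mul ?Im_mul /=; ring.
Qed.

(** Products of arbitrary Borel sets: closed under intersection, and the
    preimages of Borel sets under the coordinates are among them. *)
Definition brick (A : 'I_n -> set RR) : set (Rn R n) := [set x | forall i, A i (tnth x i)].

Lemma measurable_brick (A : 'I_n -> set RR) : (forall i, measurable (A i)) -> measurable (brick A).
Proof.
move=> mA; rewrite (_ : brick A = \bigcap_(i in [set: 'I_n]) ((@tnth n R ^~ i) @^-1` A i)).
  apply: fin_bigcap_measurable; first exact: finite_finset.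
  by move=> i _; rewrite -[X in measurable X]setTI; apply: measurable_tnth.
by apply/seteqP; split => [x xb i _|x xb i]; [exact: xb|exact: (xb i)].
Qed.

Definition bricks : set (set (Rn R n)) :=
  [set B | exists2 A : 'I_n -> set RR, (forall i, measurable (A i)) & B = brick A].

Lemma measurable_bricks : @measurable _ (Rn R n) = <<s bricks >>.
Proof.
apply/seteqP; split; last first.
  apply: smallest_sub; first exact: sigma_algebra_measurable.
  by move=> _ [A mA ->]; exact: measurable_brick.
apply: smallest_sub; first exact: smallest_sigma_algebra.
rewrite -bigcup_seq => _ [i _ [Y mY <-]]; apply: sub_sigma_algebra.
exists (fun j => if j == i then Y else setT).
  by move=> j; case: ifP.
apply/seteqP; split => x /=.
  by move=> [_ Yx] j; case: eqVneq => // ->.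
by move=> /(_ i); rewrite eqxx.
Qed.

Lemma setI_closed_bricks : setI_closed bricks.
Proof.
move=> _ _ [A mA ->] [B mB ->]; exists (fun i => A i `&` B i).
  by move=> i; exact: measurableI.
by apply/seteqP; split => [x [Ax Bx] i|x ABx]; [split|split => i; case: (ABx i)].
Qed.

(** Restricting one coordinate at a time to a Borel set keeps the transform
    zero, since its restrictions to lines parallel to that axis vanish. *)
Lemma ft_eq0_restrict h (A : 'I_n -> set RR) (s : seq 'I_n) :
  cintegrable (leb n) h -> (forall v, ft h v = 0) -> (forall i, measurable (A i)) ->
  let hs x := h x * (\prod_(i <- s) \1_(A i) (tnth x i))%:C in
  cintegrable (leb n) hs /\ forall v, ft hs v = 0.
Proof.
move=> ih h0 mA; elim: s => [|i s [IH1 IH2]] /=.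
  rewrite (_ : (fun x => _) = h)//.
  by apply/funext => x; rewrite big_nil mulr1.
have pE (x : Rn R n) : dot (vec x) (delta_mx i ord0) = tnth x i.
  rewrite dot_vec (bigD1 i)//= mxE !eqxx mulr1 big1 ?addr0// => j ji.
  by rewrite mxE (negPf ji) mulr0.
have step w := @fline_eq0_borel _ _ R (leb n) _ (fun x => tnth x i) (cintegrable_chi w IH1)
  (measurable_tnth i) _ (A i) (mA i).
have z w t : fline (leb n) (fun x => (h x * (\prod_(i <- s) \1_(A i) (tnth x i))%:C) * chi w x)
    (fun x => tnth x i) t = 0.
  by rewrite -(IH2 (w + t *: delta_mx i ord0)) -fline_ft; apply: eq_cint => x; rewrite pE.
have {z} step := step z.
split.
  apply: eq_cintegrable (step 0).1 => x.
  by rewrite chi0 mulr1 big_cons mulrC rmorphM /= mulrCA mulrA.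
move=> w; rewrite -(step w).2; apply: eq_cint => x.
by rewrite big_cons rmorphM /=; ring.
Qed.

Lemma Rintegral_eq0_ae (u : Rn R n -> R) : rintegrable (leb n) u ->
  (forall A, measurable A -> \int[leb n]_(x in A) u x = 0) ->
  {ae leb n, forall x, u x = 0}.
Proof.
move=> iu u0; have mu_ := rintegrable_meas iu.
have : ae_eq (leb n) setT (EFin \o u) (cst 0%E).
  apply: integral_ae_eq => //.
  move=> E _ mE; rewrite integral0; have iE : (leb n).-integrable E (EFin \o u).
    by apply: integrableS iu.
  by rewrite -(fineK (integrable_fin_num mE iE)); congr (_%:E); exact: u0.
by apply: filterS => x /(_ Logic.I) /= [].
Qed.

(** Restriction of all coordinates shows that the integral over every brick
    vanishes, hence over every measurable set. *)
Lemma ft_injective h : cintegrable (leb n) h -> (forall v, ft h v = 0) ->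
  {ae leb n, forall x, h x = 0}.
Proof.
move=> ih h0; have [i1 i2] := ih.
have hb B : bricks B -> cint (leb n) (fun x => h x * (\1_B x)%:C) = 0.
  move=> [A mA ->]; have [_ /(_ 0) <-] := ft_eq0_restrict (index_enum _) ih h0 mA.
  apply: eq_cint => x; rewrite chi0 mulr1; congr (_ * (_)%:C).
  rewrite indicE; case: (boolP (x \in brick A)) => xA.
    by rewrite big1// => i _; rewrite indicE mem_set//; exact: (set_mem xA).
  have [i Ai] : exists i, ~ A i (tnth x i).
    by apply/existsNP => xA'; move/negP : xA; apply; rewrite inE.
  by rewrite (bigD1 i)//= indicE memNset// mul0r.
have c0 : cint (leb n) h = 0.
  by rewrite -(h0 0); apply: eq_cint => x; rewrite chi0 mulr1.
have part (u : Rn R n -> R) : rintegrable (leb n) u -> \int[leb n]_x u x = 0 ->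
    (forall B, bricks B -> \int[leb n]_x (u x * \1_B x) = 0) -> {ae leb n, forall x, u x = 0}.
  move=> iu u0 uB; apply: Rintegral_eq0_ae => // A mA.
  have := @Rintegral_pi_lambda _ _ _ _ R (leb n) id u bricks (@measurable_id _ _ _) iu
    measurable_bricks setI_closed_bricks u0 _ A mA.
  rewrite preimage_id; apply=> B bB; rewrite preimage_id Rintegral_mkcond patch_indic.
  exact: uB.
have r0 := part _ i1 _ _; have m0 := part _ i2 _ _.
apply: filterS2 (r0 _ _) (m0 _ _) => [x r1 r2||B bB||B bB].
- by apply: complex_ext.
- by rewrite -Re_cint c0.
- rewrite -[RHS]/(complex.Re (0 : R[i])) -(hb B bB); apply: eq_Rintegral => x _.
  by rewrite Re_mul /= mulr0 subr0.
- by rewrite -[RHS]/(complex.Im (0 : R[i])) -c0.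
- rewrite -[RHS]/(complex.Im (0 : R[i])) -(hb B bB); apply: eq_Rintegral => x _.
  by rewrite Im_mul /= mulr0 add0r.
Qed.

End FourierTuple.

(** * Eigenvalues of a product of symmetric matrices *)

Section LinearAlgebra.
Context {R : realType} {n : nat}.
Implicit Types (M P : 'M[R]_n) (l : R).

(** [P M] is symmetric for the inner product defined by [M], which makes its
    eigenvalues real, with real eigenvectors. *)
Lemma symmetric_eigenvector M P (lam : R[i]) : posdef M -> P^T = P ->
  root (char_poly (cmx (M *m P))) lam ->
  exists l : R, lam = l%:C /\ exists2 a : 'cV[R]_n, a != 0 & P *m (M *m a) = l *: a.
Proof.
move=> pM Ps; rewrite -eigenvalue_root_char => /eigenvalueP[v vE v0].
pose a : 'cV[R]_n := \col_i complex.Re (v ord0 i).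
pose b : 'cV[R]_n := \col_i complex.Im (v ord0 i).
have PMs u : P *m (M *m u) = (M *m P)^T *m u by rewrite trmx_mul Ps pM.1 mulmxA.
have ea : P *m (M *m a) = complex.Re lam *: a - complex.Im lam *: b.
  apply/colP => i; rewrite PMs !mxE.
  have := congr1 (fun w : 'rV[R[i]]_n => complex.Re (w ord0 i)) vE.
  rewrite !mxE Re_mul Re_sum => <-; apply: eq_bigr => j _.
  by rewrite !mxE Re_mul /= mulr0 subr0 mulrC.
have eb : P *m (M *m b) = complex.Im lam *: a + complex.Re lam *: b.
  apply/colP => i; rewrite PMs !mxE addrC.
  have := congr1 (fun w : 'rV[R[i]]_n => complex.Im (w ord0 i)) vE.
  rewrite !mxE Im_mul Im_sum => <-; apply: eq_bigr => j _.
  by rewrite !mxE Im_mul /= mulr0 add0r mulrC.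
have sym : dot b (M *m (P *m (M *m a))) = dot a (M *m (P *m (M *m b))).
  by rewrite [RHS]dot_adj pM.1 (dot_sym _ _ Ps) [LHS]dot_adj pM.1.
have ab0 : 0 < dot a (M *m a) + dot b (M *m b).
  have := posdef_ge0 a pM; have := posdef_ge0 b pM.
  have [a0|a0] := eqVneq a 0; last by have := pM.2 _ a0; lra.
  have [b0|b0] := eqVneq b 0; last by have := pM.2 _ b0; lra.
  move/eqP : v0 => []; apply/rowP => i; rewrite mxE.
  move/colP : a0 => /(_ i); move/colP : b0 => /(_ i); rewrite !mxE => h1 h2.
  exact: complex_ext.
have l0 : complex.Im lam = 0.
  move: sym; rewrite ea eb !mulmxDr mulmxN !dotDr dotN -!scalemxAr !dotZr (dot_sym b a pM.1).
  move=> /eqP; rewrite -subr_eq0 => /eqP h.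
  have : complex.Im lam * (dot a (M *m a) + dot b (M *m b)) = 0 by rewrite -[RHS]oppr0 -h; ring.
  by move/eqP; rewrite mulf_eq0 (gt_eqF ab0) orbF => /eqP.
exists (complex.Re lam); split; first by apply: complex_ext.
rewrite l0 !scale0r subr0 in ea; rewrite l0 scale0r add0r in eb.
have [a0|a0] := eqVneq a 0; last by exists a.
have [b0|b0] := eqVneq b 0; last by exists b.
by move: ab0; rewrite a0 b0 dotE big1 ?addr0 ?ltxx// => i _; rewrite mxE mul0r.
Qed.

End LinearAlgebra.

(** [P M - l] is nilpotent by Cayley-Hamilton and symmetric for the inner
    product of [M]; such an operator is zero, because [K^2 w = 0] gives
    [|K w|^2 = 0]. *)
Lemma symmetric_single_eigenvalue (R : realType) n (M P : 'M[R]_n) (l : R) : posdef M -> P^T = P ->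
  char_poly (cmx (M *m P)) = ('X - l%:C%:P) ^+ n -> P *m M = l%:M.
Proof.
case: n M P => [|n] M P pM Ps chi; first by rewrite [LHS]flatmx0 [RHS]flatmx0.
pose K := P *m M - l%:M.
have Knil : K ^+ n.+1 = 0.
  have := Cayley_Hamilton (cmx (M *m P)); rewrite chi rmorphXn /= rmorphB /= horner_mx_X horner_mx_C.
  have -> : cmx (M *m P) - (l%:C)%:M = cmx (M *m P - l%:M).
    by rewrite /cmx map_mxB map_scalar_mx.
  rewrite -(rmorphXn (map_mx (real_complex R))) => h.
  have : (M *m P - l%:M) ^+ n.+1 = 0.
    by apply: (map_mx_inj (f := real_complex R)); rewrite [LHS]h raddf0.
  move/(congr1 trmx); rewrite trmx0 => <-.
  have trX k (A : 'M[R]_n.+1) : (A ^+ k)^T = A^T ^+ k.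
    by elim: k => [|k IH]; rewrite ?expr0 ?trmx1// exprS trmx_mul IH exprSr.
  by rewrite trX /K; congr (_ ^+ _); rewrite linearB /= trmx_mul Ps pM.1 tr_scalar_mx.
have Ksym u v : dot (K *m u) (M *m v) = dot u (M *m (K *m v)).
  have KE w : K *m w = P *m (M *m w) - l *: w.
    by rewrite mulmxBl mul_scalar_mx mulmxA.
  have e1 : dot (P *m (M *m u)) (M *m v) = dot (M *m u) (P *m (M *m v)).
    by rewrite [RHS]dot_adj Ps.
  have e2 : dot u (M *m v) = dot (M *m u) v by rewrite dot_adj pM.1.
  rewrite [RHS]dot_adj pM.1 !KE dotDl dotDr dotN -scaleN1r !dotZl dotZr e1 e2.
  by rewrite mulN1r.
have step k : K ^+ k.+2 = 0 -> K ^+ k.+1 = 0.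
  move=> K2; apply/matrixP => i j; pose e : 'cV[R]_n.+1 := delta_mx j ord0.
  pose w := K ^+ k *m e.
  have Kw : K *m w = K ^+ k.+1 *m e by rewrite /w mulmxA exprS.
  have KKw : K *m (K *m w) = 0 by rewrite Kw mulmxA [K *m _]( _ : _ = K ^+ k.+2) ?K2 ?mul0mx// exprS.
  have [z|z] := eqVneq (K *m w) 0.
    by have /colP/(_ i) := z; rewrite Kw -colE !mxE.
  by have := pM.2 _ z; rewrite Ksym KKw mulmx0 dotE big1 ?ltxx// => k' _; rewrite [X in _ * X]mxE mulr0.
have K1 k : K ^+ k.+1 = 0 -> K = 0.
  by elim: k => [|k IH]; [rewrite expr1|move=> /step /IH].
by apply/eqP; rewrite -subr_eq0 -/K (K1 _ Knil).
Qed.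

(** * Hardy's theorem in several variables *)

Section Core.
Context {R : realType} {n : nat}.
Variables (M P : 'M[R]_n) (h : Rn R n -> R[i]) (K1 K2 : R).
Hypothesis pM : posdef M.
Hypothesis Ps : P^T = P.
Hypothesis mh : cmeas h.
Hypothesis hM : forall x, normc (h x) <= K1 * gaussM M x.
Hypothesis hP : forall v, normc (ft h v) <= K2 * expR (- dot v (P *m v)).

Lemma posdef_normalize (a : 'cV[R]_n) : a != 0 ->
  exists2 t : R, 0 < t & pi * dot (t *: a) (M *m (t *: a)) = 1.
Proof.
move=> a0; have q0 : 0 < pi * dot a (M *m a) by rewrite mulr_gt0 ?pi_gt0 ?pM.2.
exists (Num.sqrt (pi * dot a (M *m a)))^-1; first by rewrite invr_gt0 sqrtr_gt0.
by rewrite quadZ mulrCA exprVn sqr_sqrtr ?(ltW q0)// mulVf// gt_eqF.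
Qed.

Lemma gauss_dom_integrable (k : Rn R n -> R[i]) (K : R) : cmeas k ->
  (forall x, normc (k x) <= K * gaussM M x) -> cintegrable (leb n) k.
Proof. by move=> mk kK; apply: cintegrable_le (rintegrableZ K (rintegrable_gaussM pM)) _. Qed.

Let ih := gauss_dom_integrable mh hM.

Lemma K2_ge0 : 0 <= K2.
Proof. by have := le_trans (normc_ge0 _) (hP 0); rewrite pmulr_lge0 ?expR_gt0. Qed.

(** If some eigenvalue [l] of [P M] exceeds [pi^2], the transform decays
    along every line in the direction [M a] faster than Hardy's critical
    rate, so it vanishes on each of these lines. *)
Lemma supercritical_eq0 (a : 'cV[R]_n) (l : R) : a != 0 -> P *m (M *m a) = l *: a ->
  pi ^+ 2 < l -> {ae leb n, forall x, h x = 0}.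
Proof.
move=> a0 al lpi; apply: ft_injective ih _ => xi.
have [t t0 t1] := posdef_normalize a0.
pose b := t *: a; have bl : P *m (M *m b) = l *: b.
  by rewrite /b -!scalemxAr al !scalerA mulrC.
pose v := M *m b; have pi0 := pi_gt0 R.
have vP : dot v (P *m v) = l / pi.
  rewrite /v bl dotZr dotC; apply: (mulIf (lt0r_neq0 pi0)).
  by rewrite divfK ?gt_eqF// -mulrA [_ * pi]mulrC t1 mulr1.
pose nu x := h x * chi xi x.
have mnu : cmeas nu by apply: cmeasM => //; exact: measurable_chi.
have nuM x : normc (nu x) <= K1 * gaussM M x by rewrite normcM normc_chi mulr1.
have gt := gauss_type_gaussM pM t1 mnu nuM.
pose q := l / pi ^+ 2; have q1 : 1 < q.
  by rewrite ltr_pdivlMr ?exprn_gt0// mul1r.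
(* strictly between 1 and q, leaving room for the terms linear in s *)
pose m := (1 + q) / 2; have m1 : 1 < m by rewrite /m; lra.
pose beta := dot xi (P *m v).
pose C3 := K2 * expR (- dot xi (P *m xi) + beta ^+ 2 / (pi * (q - m))).
have C30 : 0 <= C3 by rewrite mulr_ge0 ?K2_ge0 ?expR_ge0.
have qm : 0 < q - m by rewrite /m; lra.
have lq : l / pi = pi * q by rewrite /q expr2 invfM mulrCA (mulrA pi) mulfV ?mul1r// gt_eqF.
have dec s : normc (fline (leb n) nu (fun x => dot (vec x) v) s) <= C3 * expR (- (m * (pi * s ^+ 2))).
  rewrite fline_ft; apply: le_trans (hP _) _; rewrite /C3 -mulrA ler_wpM2l ?K2_ge0// -expRD ler_expR.
  rewrite quadD// quadZ vP -scalemxAr dotZr -/beta lq.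
  (* the cross term is absorbed by completing the square *)
  have pq : 0 < pi * (q - m) by rewrite mulr_gt0.
  have DE : s ^+ 2 * (pi * (q - m)) = s ^+ 2 * (pi * q) - m * (pi * s ^+ 2) by ring.
  set D := pi * (q - m) in pq DE *; have Dn0 : D != 0 by rewrite gt_eqF.
  have : 0 <= (s * D + beta) ^+ 2 / D by rewrite divr_ge0 ?sqr_ge0// ltW.
  rewrite (_ : _ / D = s ^+ 2 * D + 2 * (s * beta) + beta ^+ 2 / D); last by field.
  rewrite DE; set z := beta ^+ 2 / D; lra.
have dec1 s : normc (fline (leb n) nu (fun x => dot (vec x) v) s) <= C3 * expR (- (pi * s ^+ 2)).
  apply: le_trans (dec s) _; rewrite ler_wpM2l// ler_expR lerN2.
  by rewrite ler_peMl ?(ltW m1)// mulr_ge0 ?sqr_ge0// ltW.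
by have := hardy_supercritical gt dec1 m1 dec; rewrite fline_ft scale0r addr0.
Qed.

Lemma fline_ft0 (k : Rn R n -> R[i]) v s : fline (leb n) k (fun x => dot (vec x) v) s = ft k (s *: v).
Proof.
by rewrite -[s *: v]add0r -fline_ft; apply: eq_cint => x; rewrite chi0 mulr1.
Qed.

(** When [P M = pi^2], every direction is critical; subtracting a multiple of
    the Gaussian makes the transform vanish at the origin, hence on every line
    through it. *)
Lemma critical_gaussian : P *m M = (pi ^+ 2)%:M ->
  exists K : R[i], {ae leb n, forall x, h x = K * (gaussM M x)%:C}.
Proof.
move=> PM; pose G (x : Rn R n) : R[i] := (gaussM M x)%:C; pose K := ft h 0 / (gmass M)%:C.
have mG : cmeas G by apply: cmeas_real; exact: measurable_gaussM.
have iG : cintegrable (leb n) G.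
  apply: (gauss_dom_integrable (K := 1)) => // x.
  by rewrite normc_real ger0_norm ?mul1r ?expR_ge0.
have ft0 k : ft k 0 = cint (leb n) k by apply: eq_cint => x; rewrite chi0 mulr1.
pose k x := h x - K * G x.
have mk : cmeas k by apply: cmeasB => //; apply: cmeasM => //; exact: cmeas_cst.
have kM x : normc (k x) <= (K1 + normc K) * gaussM M x.
  apply: le_trans (le_normcD _ _) _; rewrite mulrDl normcN; apply: lerD => //.
  by rewrite normcM normc_real [`|_|]ger0_norm ?expR_ge0.
have ik := gauss_dom_integrable mk kM.
have ftk v : ft k v = ft h v - K * ft G v.
  rewrite /ft -cintZ; last exact: cintegrable_chi.
  rewrite -cintB; [|exact: cintegrable_chi|exact/cintegrableZ/cintegrable_chi].
  by apply: eq_cint => x; rewrite /k mulrBl mulrA.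
have k0 : ft k 0 = 0.
  rewrite ftk (ft0 _ G) cint_real -/(gmass M) /K.
  have [g0|g0] := eqVneq (gmass M) 0; last by rewrite divfK ?subrr// (inj_eq (@complexI R)).
  (* the default value of the quotient is harmless, as h integrates to 0 too *)
  rewrite g0 mulr0 subr0; apply/eqP; rewrite -normc_eq0 eq_le normc_ge0 andbT ft0.
  apply: le_trans (normc_cint_le mh (rintegrableZ K1 (rintegrable_gaussM pM)) hM) _.
  by rewrite (RintegralZl _ measurableT (rintegrable_gaussM pM)) -/(gmass M) g0 mulr0.
suff kv v : ft k v = 0.
  exists K; apply: filterS (ft_injective ik kv) => x /eqP.
  by rewrite subr_eq0 => /eqP.
have [->//|v0] := eqVneq v 0.
have u0 : invmx M *m v != 0.
  by apply: contra_neq v0 => /(congr1 (mulmx M)); rewrite mulmxA mulmxV ?posdef_unit// mul1mx mulmx0.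
have [t t0 t1] := posdef_normalize u0; set a := t *: _ in t1.
have Ma : M *m a = t *: v by rewrite /a -scalemxAr mulmxA mulmxV ?posdef_unit// mul1mx.
have gt := gauss_type_gaussM pM t1 mk kM.
have dec s : normc (fline (leb n) k (fun x => dot (vec x) (M *m a)) s) <=
    (K2 + normc K * gmass M) * expR (- (pi * s ^+ 2)).
  rewrite fline_ft0 ftk -[ft G _]fline_ft0 fline_gaussM//.
  apply: le_trans (le_normcD _ _) _; rewrite [leRHS]mulrDl normcN; apply: lerD.
    apply: le_trans (hP _) _; rewrite quadZ mulmxA PM mul_scalar_mx dotZr dotC.
    rewrite (_ : s ^+ 2 * (pi ^+ 2 * dot a (M *m a)) = pi * s ^+ 2 * (pi * dot a (M *m a))); last by ring.
    by rewrite t1 mulr1.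
  by rewrite normcM normc_real ger0_norm ?mulr_ge0 ?expR_ge0 ?gmass_ge0// mulrA.
have := hardy_critical gt dec _ t^-1; rewrite !fline_ft0 scale0r k0 Ma scalerA mulVf ?gt_eqF// scale1r.
exact.
Qed.

End Core.

(** * From almost everywhere bounds to pointwise bounds *)

Section AlmostEverywhere.
Context {R : realType} {n : nat}.

(** Boxes have positive measure, so sets of full measure are dense. *)
Lemma ae_box (Q : Rn R n -> Prop) (b : Rn R n) (e : R) : 0 < e ->
  {ae leb n, forall x, Q x} -> exists2 x, box b e x & Q x.
Proof.
move=> e0 [Z [mZ Z0 QZ]]; apply: contrapT => nQ.
have bZ : box b e `<=` Z.
  by move=> x bx; apply: QZ => Qx; apply: nQ; exists x.
have := leb_box_gt0 b e0.
have : (leb n (box b e) <= leb n Z)%E.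
  by apply: le_measure => //; rewrite inE//; exact: measurable_box.
by rewrite Z0 => /le_lt_trans h /h; rewrite ltxx.
Qed.

Lemma cint_ae (f g : Rn R n -> R[i]) : cmeas f -> cmeas g ->
  {ae leb n, forall x, f x = g x} -> cint (leb n) f = cint (leb n) g.
Proof.
move=> [f1 f2] [g1 g2] fg; congr (_ +i* _); rewrite /Rintegral; congr fine.
  apply: ae_eq_integral => //; try exact/measurable_EFinP.
  by apply: filterS fg => x ->.
apply: ae_eq_integral => //; try exact/measurable_EFinP.
by apply: filterS fg => x ->.
Qed.

End AlmostEverywhere.

Section Continuity.
Context {R : realType} {n : nat}.
Variables (M : 'M[R]_n) (h : Rn R n -> R[i]) (K1 : R).
Hypothesis pM : posdef M.
Hypothesis mh : cmeas h.
Hypothesis hM : forall x, normc (h x) <= K1 * gaussM M x.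

Let size1 (x : Rn R n) : R := \sum_i `|tnth x i|.

Lemma measurable_abs_tnth i : measurable_fun setT (fun x : Rn R n => `|tnth x i| : R).
Proof. by apply: measurableT_comp => //; exact: measurable_tnth. Qed.

(** A coordinate is at most a sum of two exponentials of linear forms, which
    the Gaussian absorbs. *)
Lemma rintegrable_size1 : rintegrable (leb n) (fun x => size1 x * normc (h x)).
Proof.
have mn := measurable_normc mh.
have i1 i : rintegrable (leb n) (fun x => `|tnth x i| * normc (h x)).
  (* chosen so that the linear form 2 x.M w is the i-th coordinate *)
  pose w : 'cV[R]_n := 2^-1 *: (invmx M *m delta_mx i ord0).
  have wE x : 2 * dot (vec x) (M *m w) = tnth x i.
    rewrite -scalemxAr mulmxA mulmxV ?posdef_unit// mul1mx dotZr mulrA mulfV// mul1r.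
    rewrite dot_vec (bigD1 i)//= mxE !eqxx mulr1 big1 ?addr0// => j ji.
    by rewrite mxE (negPf ji) mulr0.
  have wE' x : 2 * dot (vec x) (M *m - w) = - tnth x i by rewrite mulmxN dotN mulrN wE.
  have ig := rintegrableZ K1 (rintegrableD (gaussM_linear pM w).1 (gaussM_linear pM (- w)).1).
  apply: rintegrable_le ig _ => [|x].
    by apply: measurable_funM => //; exact: measurable_abs_tnth.
  rewrite wE wE' ger0_norm ?mulr_ge0 ?normc_ge0// mulrC -mulrDr mulrA.
  apply: ler_pM => //; first exact: normc_ge0.
  have [t0|t0] := leP 0 (tnth x i).
    by rewrite (ger0_norm t0); have := expR_ge1Dx (tnth x i); have := expR_ge0 (- tnth x i); lra.
  by rewrite (ltr0_norm t0); have := expR_ge1Dx (- tnth x i); have := expR_ge0 (tnth x i); lra.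
have : rintegrable (leb n) (fun x => \sum_i (`|tnth x i| * normc (h x))).
  have : (leb n).-integrable setT (fun x => \sum_(i <- index_enum 'I_n) (`|tnth x i| * normc (h x))%:E)%E.
    by apply: integrable_sum => // i _; exact: i1.
  apply: eq_integrable => // x _ /=.
  by rewrite sumEFin.
by apply: eq_integrable => // x _ /=; rewrite mulr_suml.
Qed.

(** The increment of the transform along [e] is that of the restriction to a
    line, whose Lipschitz constant is a first moment. *)
Lemma ft_lip v (e : 'cV[R]_n) (d : R) : (forall i, `|e i ord0| <= d) ->
  normc (ft h v - ft h (v + e)) <= 2 * pi * (\int[leb n]_x (size1 x * normc (h x))) * d.
Proof.
move=> ed; have i1 := rintegrable_size1; have ih := gauss_dom_integrable pM mh hM.
pose nu x := h x * chi v x.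
have mnu : cmeas nu by apply: cmeasM => //; exact: measurable_chi.
have inu : rintegrable (leb n) (fun x => normc (nu x)) by apply: rintegrable_normc; exact: cintegrable_chi.
have my : measurable_fun setT (fun x : Rn R n => dot (vec x) e) by exact: measurable_dot.
have le1 x : normc ((dot (vec x) e)%:C ^+ 1 * nu x) <= d * (size1 x * normc (h x)).
  rewrite expr1 normcM normc_real /nu (normcM (h x)) normc_chi mulr1 mulrA ler_wpM2r ?normc_ge0//.
  rewrite dot_vec mulr_sumr; apply: le_trans (ler_norm_sum _ _ _) _; apply: ler_sum => i _.
  by rewrite normrM mulrC ler_wpM2r.
have iy : rintegrable (leb n) (fun x => normc ((dot (vec x) e)%:C ^+ 1 * nu x)).
  apply: rintegrable_le (rintegrableZ d i1) _ => [|x]; last by rewrite ger0_norm ?normc_ge0.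
  by apply: measurable_normc; exact: cmeas_powM.
have := fline_lip 0 1 mnu my inu iy.
rewrite !fline_ft scale0r addr0 scale1r sub0r normrN1 mulr1 => /le_trans; apply.
rewrite -[leRHS]mulrA ler_wpM2l ?mulr_ge0 ?pi_ge0// mulrC -(RintegralZl _ measurableT i1).
by apply: le_Rintegral => //; exact: rintegrableZ.
Qed.

(** An almost everywhere bound by a Gaussian of the continuous function
    [ft h] composed with a linear map holds everywhere, because null sets
    have dense complements. *)
Lemma ft_gauss_everywhere (N B' : 'M[R]_n) (K : R) : posdef N -> 0 <= K ->
  {ae leb n, forall xi, normc (ft h (B' *m vec xi)) <= K * gaussM N xi} ->
  forall xi : 'cV[R]_n, normc (ft h (B' *m xi)) <= K * expR (- dot xi (N *m xi)).
Proof.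
move=> pN K0 ae xi; rewrite -subr_le0.
pose I := \int[leb n]_x (size1 x * normc (h x)).
have I0 : 0 <= I.
  by apply: Rintegral_ge0 => x _; rewrite mulr_ge0 ?normc_ge0// sumr_ge0.
pose b := \sum_i \sum_j `|B' i j|.
pose c := \sum_i `|(N *m xi) i ord0|.
have b0 : 0 <= b by do 2!apply: sumr_ge0 => ? _.
have c0 : 0 <= c by apply: sumr_ge0.
pose g := expR (- dot xi (N *m xi)); have g0 : 0 <= g by exact: expR_ge0.
pose C := 2 * pi * I * b + K * g * (2 * c * expR (2 * c)).
have C0 : 0 <= C by rewrite /C addr_ge0// ?mulr_ge0 ?pi_ge0 ?expR_ge0.
apply: (@le0_mul_small _ _ C) => e' e'0.
pose e := Num.min e' 1; have e0 : 0 < e by rewrite lt_min e'0 ltr01.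
apply: (@le_trans _ _ (C * e)); last by rewrite ler_wpM2l// ge_min lexx.
have e1 : e <= 1 by rewrite ge_min lexx orbT.
have [x bx Qx] := ae_box (tvec xi) e0 ae.
pose d := vec x - xi.
have de i : `|d i ord0| <= e.
  by have := bx i; rewrite tnth_mktuple /d !mxE => /ltW.
have xE : vec x = xi + d by rewrite /d addrC subrK.
have h1 : normc (ft h (B' *m xi)) <= normc (ft h (B' *m vec x)) + 2 * pi * I * (b * e).
  rewrite -[ft h (B' *m xi)](subrK (ft h (B' *m vec x))) addrC.
  apply: le_trans (le_normcD _ _) _; rewrite lerD2l xE mulmxDr.
  apply: ft_lip => i; rewrite mxE; apply: le_trans (ler_norm_sum _ _ _) _.
  rewrite /b [in leRHS](bigD1 i)//= mulrDl -[leLHS]addr0; apply: lerD.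
    rewrite mulr_suml; apply: ler_sum => j _; rewrite normrM ler_wpM2l//.
  by rewrite mulr_ge0 ?(ltW e0)//; do 2!apply: sumr_ge0 => ? _.
have h2 : gaussM N x <= g * expR (2 * c * e).
  rewrite /gaussM /g -expRD ler_expR xE quadD; last exact: pN.1.
  rewrite -[2 * c * e]mulrA -addrA opprD lerD2l opprD -[leRHS]addr0; apply: lerD.
    rewrite -mulrN ler_wpM2l// (dot_sym _ _ pN.1) dotE -sumrN mulr_suml; apply: ler_sum => i _.
    by apply: le_trans (ler_norm _) _; rewrite normrN normrM mulrC ler_wpM2l.
  by rewrite oppr_le0 posdef_ge0.
have h3 : expR (2 * c * e) <= 1 + 2 * c * expR (2 * c) * e.
  have c2 : 0 <= 2 * c by rewrite mulr_ge0.
  rewrite -lerBlDl; apply: le_trans (expR_sub1_le _) _.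
  rewrite [leRHS]mulrAC ler_wpM2l ?mulr_ge0 ?(ltW e0)//.
  by rewrite ler_expR ler_piMr.
have h4 : K * gaussM N x <= K * (g * (1 + 2 * c * expR (2 * c) * e)).
  by rewrite ler_wpM2l//; apply: le_trans h2 _; rewrite ler_wpM2l.
rewrite -/g lerBlDl; apply: le_trans h1 (le_trans (lerD (le_trans Qx h4) (lexx _)) _).
rewrite (_ : C * e = 2 * pi * I * (b * e) + K * g * (2 * c * expR (2 * c) * e)); last by rewrite /C; ring.
by rewrite addrA [in leRHS]addrAC lerD2r mulrA mulrDr mulr1.
Qed.

End Continuity.

(** * The linear canonical transform *)

Section Truncation.
Context {R : realType} {n : nat}.

(** A Gaussian bound valid almost everywhere becomes valid everywhere after
    changing the function on a null set. *)
Lemma gauss_bounded_everywhere (M : 'M[R]_n) (f : Rn R n -> R[i]) : cmeas f -> gauss_bounded M f ->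
  exists f0 : Rn R n -> R[i], exists K : R,
    [/\ cmeas f0, eq_ae f f0 & forall x, normc (f0 x) <= K * gaussM M x].
Proof.
move=> mf [K K0 fK]; have mg := @measurable_gaussM R n M.
pose S : set (Rn R n) := (fun x => K * gaussM M x - normc (f x)) @^-1` `[0, +oo[%classic.
have mS : measurable S.
  rewrite -[X in measurable X]setTI; apply: (measurable_funB _ (measurable_normc mf)) => //.
  by apply: measurable_funM => //; exact: measurable_cst.
have SE x : S x <-> normc (f x) <= K * gaussM M x.
  by rewrite /S /= in_itv/= andbT subr_ge0.
exists (fun x => f x * (\1_S x)%:C), K; split.
- by apply: cmeasM => //; apply: cmeas_real; exact: measurable_indic.
- by apply: filterS fK => x fx; rewrite indicE mem_set ?mulr1//; exact/SE.
move=> x; rewrite normcM normc_real indicE; case: (boolP (x \in S)) => [/set_mem/SE xS|_].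
  by rewrite normr1 mulr1.
by rewrite normr0 mulr0 mulr_ge0 ?expR_ge0 ?ltW.
Qed.

(** Gives access to the integral formula of the transform. *)
Lemma inL1_ae (f f0 : Rn R n -> R[i]) : cmeas f -> cintegrable (leb n) f0 -> eq_ae f f0 ->
  inLp 1%:E f.
Proof.
move=> mf if0 ff0; split; first exact: mf.
rewrite /Lpnorm Lnorm1.
rewrite (ae_eq_integral (fun x => (normc (f0 x))%:E)) //.
- by rewrite (rintegrable_EFin (rintegrable_normc if0)) ltry.
- by apply: measurableT_comp => //; apply/measurable_EFinP; exact: measurable_normc.
- by apply/measurable_EFinP; apply: measurable_normc; exact: (cintegrable_meas if0).
by apply: filterS ff0 => x -> _ /=; rewrite ger0_norm ?normc_ge0.
Qed.

End Truncation.

Section LinearCanonicalTransform.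
Context {R : realType} {n : nat}.
Variables (A B D : 'M[R]_n).

Definition chirp (x : Rn R n) : R[i] := cexp ('i%C * (pi * dot (vec x) (invmx B *m A *m vec x))%:C).

Lemma normc_chirp x : normc (chirp x) = 1.
Proof. by rewrite normc_cexp Re_mul /= mulr0 mul0r subrr expR0. Qed.

Lemma cmeas_chirp : cmeas chirp.
Proof.
apply: cmeas_exp; apply: cmeasM; first exact: cmeas_cst.
apply: cmeas_real; apply: measurable_funM; first exact: measurable_cst.
exact: measurable_quad.
Qed.

Let outer (xi : Rn R n) : R[i] := cexp ('i%C * (pi * dot (vec xi) (D *m invmx B *m vec xi))%:C).

Lemma cexp_lct_phase xi x :
  cexp (lct_phase A B D xi x) = outer xi * (chirp x * chi (invmx B *m vec xi) x).
Proof.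
rewrite /outer /chirp /chi -!cexpD; congr cexp; rewrite /lct_phase.
by apply: complex_ext; rewrite ?Re_add ?Im_add ?Re_opp ?Im_opp ?Re_mul ?Im_mul /=; ring.
Qed.

(** The chirp factors reduce the transform to a Fourier transform evaluated
    at [B^-1 xi], up to a unimodular factor. *)
Lemma normc_lct_int (kappa : R[i]) (f f0 : Rn R n -> R[i]) (xi : Rn R n) :
  cmeas f -> cintegrable (leb n) f0 -> eq_ae f f0 ->
  normc (lct_int kappa A B D f xi) =
  normc kappa^-1 * normc (ft (fun x => f0 x * chirp x) (invmx B *m vec xi)).
Proof.
move=> mf if0 ff0; rewrite /lct_int normcM; congr (_ * _).
pose k x := chirp x * chi (invmx B *m vec xi) x.
have mk : cmeas k by apply: cmeasM; [exact: cmeas_chirp|exact: measurable_chi].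
have nouter : normc (outer xi) = 1 by rewrite normc_cexp Re_mul /= mulr0 mul0r subrr expR0.
rewrite -[RHS]mul1r -nouter -normcM; congr normc.
transitivity (cint (leb n) (fun x => f x * (outer xi * k x))).
  by apply: eq_cint => x; rewrite cexp_lct_phase.
rewrite (cint_ae _ _ (g := fun x => f0 x * (outer xi * k x))); first last.
- by apply: filterS ff0 => x ->.
- apply: cmeasM; first exact: (cintegrable_meas if0).
  by apply: cmeasM => //; exact: cmeas_cst.
- by apply: cmeasM => //; apply: cmeasM => //; exact: cmeas_cst.
rewrite -cintZ; last first.
  apply: cintegrable_chi; apply: cintegrable_le (rintegrable_normc if0) _ => [|x].
    by apply: cmeasM; [exact: (cintegrable_meas if0)|exact: cmeas_chirp].
  by rewrite normcM normc_chirp mulr1.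
by apply: eq_cint => x; rewrite -[in RHS](mulrA (f0 x)) [RHS]mulrCA.
Qed.

End LinearCanonicalTransform.

Lemma dot_cmx {R : realType} n (u v : 'cV[R]_n) : dot (cmx u) (cmx v) = (dot u v)%:C.
Proof. by rewrite dotE rmorph_sum /dot mxE; apply: eq_bigr => i _; rewrite !mxE rmorphM. Qed.

Theorem theorem29 (R : realType) (n : nat)
    (M N A B C D : 'M[R]_n) (kappa : R[i])
    (f fS : Rn R n -> R[i]) (lambda : 'I_n -> R[i])
    (hM : posdef M) (hN : posdef N)
    (hS : symplectic (block_mx A B C D)) (hB : \det B != 0)
    (hkappa : kappa ^+ 2 = 'i%C ^+ n * (\det B)%:C)
    (hf : inLp 2%:E f) (hf0 : ~ eq_ae f (fun=> 0))
    (hfS : is_lct kappa A B D f fS)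
    (hfM : gauss_bounded M f) (hfN : gauss_bounded N fS)
    (hlambda : char_poly (cmx (M *m B^T *m N *m B))
               = \prod_(j < n) ('X - (lambda j)%:P)) :
  (forall j, lambda j <= (pi ^+ 2)%:C) /\
  ((forall j, lambda j = (pi ^+ 2)%:C) ->
   exists K : R[i],
     eq_ae f (fun x =>
       K * cexp (- dot (cmx (vec x))
                     ((cmx M + ('i%C * pi%:C) *: cmx (invmx B *m A))
                        *m cmx (vec x))))).
Proof.
have mf : cmeas f := hf.1.
have [f0 [K1 [mf0 ff0 f0M]]] := gauss_bounded_everywhere mf hfM.
have if0 := gauss_dom_integrable hM mf0 f0M.
have [_ _ /(_ (inL1_ae mf if0 ff0)) fSE _] := hfS.
pose h x := f0 x * chirp A B x.
have mh : cmeas h by apply: cmeasM => //; exact: cmeas_chirp.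
have hhM x : normc (h x) <= K1 * gaussM M x by rewrite normcM normc_chirp mulr1.
have Bu : B \in unitmx by rewrite unitmxE unitfE.
have k0 : kappa != 0.
  apply/eqP => k0; move: hkappa; rewrite k0 expr0n => /esym/eqP.
  rewrite mulf_eq0 (inj_eq (@complexI R)) (negPf hB) orbF expf_eq0 => /andP[_].
  by rewrite eq_complex /= oner_eq0 andbF.
have nk0 : 0 < normc kappa by rewrite normc_gt0.
pose P := B^T *m N *m B.
have Ps : P^T = P by rewrite /P !trmx_mul trmxK hN.1 mulmxA.
have [K2 K20 fSN] := hfN.
have hP v : normc (ft h v) <= normc kappa * K2 * expR (- dot v (P *m v)).
  rewrite -[v in ft h v](mulKmx Bu).
  have -> : dot v (P *m v) = dot (B *m v) (N *m (B *m v)).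
    by rewrite /P -!mulmxA dot_adj trmxK.
  apply: (ft_gauss_everywhere hM mh hhM (N := N)) => //.
    by rewrite mulr_ge0 ?normc_ge0// ltW.
  apply: filterS2 fSE fSN => xi -> .
  rewrite (normc_lct_int A B D kappa xi mf if0 ff0) => hx.
  have : normc kappa * (normc kappa^-1 * normc (ft h (invmx B *m vec xi))) <=
     normc kappa * (K2 * gaussM N xi) by rewrite ler_wpM2l ?normc_ge0.
  by rewrite !mulrA -normcM mulfV// normc1 mul1r.
rewrite (_ : M *m B^T *m N *m B = M *m P) in hlambda; last by rewrite /P !mulmxA.
have fh : {ae leb n, forall x, f x = h x * (chirp A B x)^-1}.
  by apply: filterS ff0 => x ->; rewrite mulfK// cexp_neq0.
split=> [j|lpi].
  have : root (char_poly (cmx (M *m P))) (lambda j).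
    by rewrite hlambda rootE horner_prod (bigD1 j)//= hornerXsubC subrr mul0r.
  case/(symmetric_eigenvector hM Ps) => l [-> [a a0 al]].
  rewrite lecR leNgt; apply/negP => lpi; apply: hf0.
  apply: filterS2 fh (supercritical_eq0 hM Ps mh hhM hP a0 al lpi) => x -> ->.
  by rewrite mul0r.
have [|K hK] := critical_gaussian hM mh hhM hP.
  apply: symmetric_single_eigenvalue hM Ps _.
  by rewrite hlambda (eq_bigr (fun=> 'X - (pi ^+ 2)%:C%:P)) ?prodr_const ?card_ord// => j _; rewrite lpi.
exists K; apply: filterS2 fh hK => x -> ->.
rewrite -mulrA /gaussM -cexp_real -cexpN -cexpD; congr (_ * cexp _).
have -> : (cmx M + ('i%C * pi%:C) *: cmx (invmx B *m A)) *m cmx (vec x) =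
    cmx (M *m vec x) + ('i%C * pi%:C) *: cmx (invmx B *m A *m vec x).
  by rewrite mulmxDl -scalemxAl /cmx !map_mxM.
have -> : dot (cmx (vec x)) (cmx (M *m vec x) + ('i%C * pi%:C) *: cmx (invmx B *m A *m vec x)) =
    dot (cmx (vec x)) (cmx (M *m vec x)) + ('i%C * pi%:C) * dot (cmx (vec x)) (cmx (invmx B *m A *m vec x)).
  by rewrite /dot mulmxDr -scalemxAr !mxE.
rewrite !dot_cmx.
by apply: complex_ext; rewrite ?Re_add ?Im_add ?Re_opp ?Im_opp ?Re_mul ?Im_mul /=; ring.
Qed.
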